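(* In the setting described in the context, assume conditions C1–C4 and that $d$ is known. Let $\tilde{\mathcal{M}}=\operatorname{span}\{\hat\psi_1,\ldots,\hat\psi_d\}$, where $\hat\psi_1,\ldots,\hat\psi_d$ are the orthonormal eigenfunctions of $\hat K$ corresponding to its $d$ largest eigenvalues. Then as $n\to\infty$, $D(\tilde{\mathcal{M}},\mathcal{M})=O_p(n^{-1/2})$.
   Context: $\mathcal{I}$ is a compact interval, $L_2(\mathcal{I})$ has inner product $\langle f,g\rangle=\int_{\mathcal{I}}fg$; kernels act as integral operators. Model: $Y_t(u)=X_t(u)+\varepsilon_t(u)$ with $E\varepsilon_t(u)=0$, $\operatorname{cov}(\varepsilon_t(u),\varepsilon_s(v))=0$ for all $u,v$ when $t\neq s$; $\int_{\mathcal{I}}E\{X_t^2+\varepsilon_t^2\}<\infty$; $\mu(u)=EX_t(u)$ and $M_k(u,v)=\operatorname{cov}(X_t(u),X_{t+k}(v))$ independent of $t$. With $M_0(u,v)=\sum_j\lambda_j\varphi_j(u)\varphi_j(v)$ ($\lambda_j$ decreasing, $\varphi_j$ orthonormal), $X_t$ is $d$-dimensional ($\lambda_d\ne0=\lambda_{d+1}$, $d\ge1$ fixed) and $\mathcal{M}=\operatorname{span}\{\varphi_1,\ldots,\varphi_d\}$. For a fixed integer $p\ge1$: $N_k(u,v)=\int M_k(u,z)M_k(v,z)dz$, $K=\sum_{k=1}^pN_k$, with eigenvalues $\theta_1\ge\theta_2\ge\cdots$. From $Y_1,\ldots,Y_n$: $\bar Y=n^{-1}\sum Y_j$, $\hat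 M_k(u,v)=\frac1{n-p}\sum_{j=1}^{n-p}\{Y_j(u)-\bar Y(u)\}\{Y_{j+k}(v)-\bar Y(v)\}$, $\hat K(u,v)=\sum_{k=1}^p\int\hat M_k(u,z)\hat M_k(v,z)dz$. For $d$-dimensional subspaces $\mathcal{N}_1,\mathcal{N}_2$ of $L_2(\mathcal{I})$ with orthonormal bases $\{\zeta_{11},\ldots,\zeta_{1d}\}$, $\{\zeta_{21},\ldots,\zeta_{2d}\}$, $D(\mathcal{N}_1,\mathcal{N}_2)=\sqrt{1-\frac1d\sum_{j,k=1}^d\langle\zeta_{2j},\zeta_{1k}\rangle^2}$ (independent of the bases chosen). Conditions: C1: $\{Y_t\}$ strictly stationary and $\psi$-mixing, $\psi(l)=\sup_{A\in\mathcal{F}_{-\infty}^0,B\in\mathcal{F}_l^\infty,P(A)P(B)>0}|1-P(B|A)/P(B)|$ with $\mathcal{F}_i^j=\sigma\{Y_i,\ldots,Y_j\}$, and $\sum_l l\psi^{1/2}(l)<\infty$. C2: $E\{\int_{\mathcal{I}}Y_t(u)^2du\}^2<\infty$. C3: $\theta_1>\cdots>\theta_d>0=\theta_{d+1}=\cdots$. C4: $\operatorname{cov}\{X_s(u),\varepsilon_t(v)\}=0$ for all $s,t,u,v$. *)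

(* Defs.v *)
From HB Require Import structures.
From mathcomp Require Import all_boot all_order all_algebra.
From mathcomp Require Import all_classical all_reals all_analysis.
Set Implicit Arguments. Unset Strict Implicit. Unset Printing Implicit Defensive.
Import Order.TTheory GRing.Theory Num.Theory.
Import numFieldNormedType.Exports.
Local Open Scope classical_set_scope.
Local Open Scope ring_scope.

Section FunctionalTS.
Variable R : realType.

Definition Iab (a b : R) : set R := [set u | a <= u <= b].

Definition leb := (@lebesgue_measure R).

Definition L2I (a b : R) (f : R -> R) : Prop :=
  measurable_fun (Iab a b) f /\
  (\int[leb]_(u in Iab a b) ((f u) ^+ 2)%:E < +oo)%E.

Definition innerI (a b : R) (f g : R -> R) : R :=
  Rintegral leb (Iab a b) (fun u => f u * g u).

Definition orthonormalI (a b : R) (d : nat) (z : 'I_d -> R -> R) : Prop :=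
  (forall j, L2I a b (z j)) /\
  (forall j k, innerI a b (z j) (z k) = (j == k)%:R).

Definition kerop (a b : R) (K : R -> R -> R) (f : R -> R) (u : R) : R :=
  Rintegral leb (Iab a b) (fun v => K u v * f v).

Definition is_eigenI (a b : R) (K : R -> R -> R) (lam : R) (f : R -> R) : Prop :=
  L2I a b f /\ {ae leb, forall u, Iab a b u -> kerop a b K f u = lam * f u}.

(* psi_1..psi_d are orthonormal eigenfunctions of K corresponding to its d
   largest eigenvalues lam_1 >= ... >= lam_d (counted with multiplicity):
   every eigenvalue of an eigenfunction orthogonal to psi_1..psi_d is <= lam_d. *)
Definition top_eigenI (a b : R) (d : nat) (K : R -> R -> R)
    (lam : 'I_d -> R) (psi : 'I_d -> R -> R) : Prop :=
  [/\ orthonormalI a b psi,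
      (forall j, is_eigenI a b K (lam j) (psi j)),
      (forall j k : 'I_d, (j <= k)%N -> lam k <= lam j) &
      (forall (mu : R) (g : R -> R), is_eigenI a b K mu g -> innerI a b g g != 0 ->
          (forall j, innerI a b g (psi j) = 0) -> forall j, mu <= lam j)].

(* D(N1, N2) for N1 = span z1, N2 = span z2 (orthonormal bases) *)
Definition distD (a b : R) (d : nat) (z1 z2 : 'I_d -> R -> R) : R :=
  Num.sqrt (1 - d%:R^-1 *
    \sum_(j < d) \sum_(k < d) (innerI a b (z2 j) (z1 k)) ^+ 2).

Definition Kker (a b : R) (p : nat) (M : nat -> R -> R -> R) (u v : R) : R :=
  \sum_(1 <= k < p.+1) Rintegral leb (Iab a b) (fun z => M k u z * M k v z).

Section Process.
Context {d0 : measure_display} {Omega : measurableType d0}.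
Variable P : probability Omega R.

Definition Ex (f : Omega -> R) : \bar R := (\int[P]_w (f w)%:E)%E.

Definition gen_sigma (a b : R) (Y : int -> Omega -> R -> R) (T : set int)
  : set (set Omega) :=
  <<s [set A | exists t u (B : set R), [/\ T t, Iab a b u, measurable B &
         A = (fun w => Y t w u) @^-1` B]] >>.

Definition strictly_stationary (a b : R) (Y : int -> Omega -> R -> R) : Prop :=
  forall (k : nat) (ts : 'I_k -> int) (us : 'I_k -> R) (Bs : 'I_k -> set R) (h : int),
    (forall i, Iab a b (us i)) -> (forall i, measurable (Bs i)) ->
    P [set w | forall i, Bs i (Y (ts i) w (us i))] =
    P [set w | forall i, Bs i (Y (ts i + h) w (us i))].

(* psi-mixing with sum_l l psi(l)^{1/2} < oo: c l bounds the psi-mixing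
   coefficient psi(l) = sup |1 - P(B|A)/P(B)| over A in F_{-oo}^0,
   B in F_l^oo with P(A)P(B) > 0. *)
Definition psi_mixing_summable (a b : R) (Y : int -> Omega -> R -> R) : Prop :=
  exists c : nat -> R,
    [/\ (forall l, 0 <= c l),
        (forall (l : nat) (A B : set Omega), (0 < l)%N ->
           gen_sigma a b Y [set t | t <= 0] A ->
           gen_sigma a b Y [set t | l%:Z <= t] B ->
           (0 < P A)%E -> (0 < P B)%E ->
           `|1 - fine (P (A `&` B)) / (fine (P A) * fine (P B))| <= c l) &
        exists Mb : R, forall N : nat,
          \sum_(l < N) l%:R * Num.sqrt (c l) <= Mb].

Definition Ybar (Y : int -> Omega -> R -> R) (n : nat) (w : Omega) (u : R) : R :=
  n%:R^-1 * \sum_(1 <= j < n.+1) Y j%:Z w u.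

Definition Mhat (Y : int -> Omega -> R -> R) (n p k : nat) (w : Omega) (u v : R) : R :=
  (n - p)%:R^-1 * \sum_(1 <= j < (n - p).+1)
     ((Y j%:Z w u - Ybar Y n w u) * (Y (j + k)%:Z w v - Ybar Y n w v)).

Definition Khat (a b : R) (Y : int -> Omega -> R -> R) (n p : nat) (w : Omega) (u v : R) : R :=
  \sum_(1 <= k < p.+1)
    Rintegral leb (Iab a b) (fun z => Mhat Y n p k w u z * Mhat Y n p k w v z).

(* Z_n = O_p(n^{-1/2}), with outer probability (Z_n need not be measurable) *)
Definition Op_root_n (Z : nat -> Omega -> R) : Prop :=
  forall e : R, 0 < e -> exists C : R, 0 < C /\ exists N : nat, forall n : nat, (N <= n)%N ->
    exists A : set Omega, [/\ measurable A,
       [set w | C / Num.sqrt n%:R < Z n w] `<=` A & (P A <= e%:E)%E].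

End Process.
End FunctionalTS.

(* Main.v *)
(* Let M_k be the integral operator with kernel M_k(u, v) and M^_k the one with the
   empirical kernel. Since k >= 1 and the noise is white, M_k(u, v) is the covariance of
   Y_j(u) and Y_{j+k}(v). Psi-mixing bounds the variance of a sum of n of the products by n
   times a second moment; integrating over u and v, the squared Hilbert-Schmidt distances
   |M^_k - M_k|^2 have a sum delta = O_p(1/n).

   If f is orthogonal to phi_1, ..., phi_d then E <X_t - mu, f>^2 = <M_0 f, f> = 0, so every
   adjoint M_k^* annihilates f. Apply this to the residual r of an estimated eigenfunction
   psi^_j modulo span(phi): |M^_k^* r| <= |M^_k - M_k| |r|. As K^ = sum_k M^_k M^_k^*,
   Cauchy-Schwarz gives
     lambda^_j |r|^2 = <K^ psi^_j, r> <= sqrt(lambda^_j) sqrt(delta) |r|,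
   that is, |r|^2 <= delta / lambda^_j. A min-max argument bounds lambda^_j below by
   theta_d / 4 once delta <= theta_d / 4, and D(M~, M)^2 is the average of the |r|^2. *)

(* The psi^_j are maximal only among eigenfunctions; no bound on Rayleigh quotients is given. The
   min-max argument therefore has to exhibit an eigenfunction orthogonal to all of them. It exists
   because K^ has finite rank: its range lies in the span of the centred curves, so a top
   eigenvector of a real symmetric matrix provides it.

   Under C2 the products of Y_j(u) and Y_{j+k}(v) have second moments only. Psi-mixing bounds a
   covariance by psi(l) E|xi| E|eta|, which asks for no more, and C1 makes psi(l) summable because
   psi^{1/2}(l) is bounded by the weighted sum.

   C2 and the second-moment condition are integrated over u, so a moment at a fixed u may be
   infinite. The variance bounds are thus stated in \bar R, and finiteness enters only after
   integration. The distance need not be measurable in w; it is bounded off a measurable event,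
   which is the exceptional event of Markov's inequality together with a null set. *)
Require Import Defs.
From HB Require Import structures.
From mathcomp Require Import all_boot all_order all_algebra.
From mathcomp Require Import complex zify ring lra.
From mathcomp Require Import all_classical all_reals all_analysis.
From mathcomp Require Import measurable_realfun.
Set Implicit Arguments. Unset Strict Implicit. Unset Printing Implicit Defensive.
Import Order.TTheory GRing.Theory Num.Theory.
Import numFieldNormedType.Exports.
Local Open Scope classical_set_scope.
Local Open Scope ring_scope.

(** * Real symmetric matrices *)

Section real_symmetric.
Variable R : rcfType.
Local Notation toC := (map_mx (real_complex R)).

(* [U] and [V] are the real and imaginary parts of the unitary matrix that
   diagonalises [A] over R[i]; hence the doubled completeness relations. *)
Lemma sym_spectral n (A : 'M[R]_n) : A^T = A ->
  exists (U V : 'M[R]_n) (D : 'I_n -> R),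
  [/\ forall i j, A i j = \sum_r D r * (U r i * U r j + V r i * V r j),
      forall i j, \sum_r (U r i * U r j + V r i * V r j) = (i == j)%:R,
      forall r i, \sum_j A i j * U r j = D r * U r i,
      forall r i, \sum_j A i j * V r j = D r * V r i &
      forall r, \sum_i (U r i ^+ 2 + V r i ^+ 2) = 1].
Proof.
move=> Asym.
have Asw i j : A j i = A i j by rewrite -[in LHS]Asym mxE.
have Aherm : toC A \is hermsymmx.
  apply: realsym_hermsym.
    apply/is_hermitianmxP; rewrite expr0 scale1r.
    by apply/matrixP => i j; rewrite !mxE /= -[in LHS]Asym mxE.
  apply/mxOverP => i j; rewrite mxE; apply/CrealP.
  by rewrite /Num.conj /= oppr0.
have /orthomx_spectralP Aeq := hermitian_normalmx Aherm.
have Dreal := hermitian_spectral_diag_real Aherm.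
have Punit := spectral_unitarymx (toC A).
move: Aeq Dreal Punit; set P := spectralmx _; set E := spectral_diag _.
move=> Aeq Dreal Punit.
have ER r : E 0 r = (complex.Re (E 0 r))%:C%C.
  move/mxOverP : Dreal => /(_ 0 r)/CrealP; rewrite /Num.conj /=.
  case: (E 0 r) => x y [] /= /eqP; rewrite eq_sym -addr_eq0 -mulr2n mulrn_eq0 /=.
  by move/eqP ->.
have Re_sum (I : finType) (F : I -> R[i]) : complex.Re (\sum_i F i) = \sum_i complex.Re (F i).
  exact: (raddf_sum (@complex.Re R : {additive Rcomplex R -> R})).
have Im_sum (I : finType) (F : I -> R[i]) : complex.Im (\sum_i F i) = \sum_i complex.Im (F i).
  exact: (raddf_sum (@complex.Im R : {additive Rcomplex R -> R})).
rewrite invmx_unitary // in Aeq.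
have PA : P *m toC A = diag_mx E *m P.
  by rewrite {1}Aeq !mulmxA (unitarymxP Punit) mul1mx.
have PP : (map_mx Num.conj P)^T *m P = 1%:M.
  by apply: mulmx1C; rewrite -(unitarymxP Punit) map_trmx.
have row r i : \sum_j P r j * (A j i)%:C%C = E 0 r * P r i.
  have /matrixP/(_ r i) := PA; rewrite mxE mul_diag_mx !mxE => <-.
  by apply: eq_bigr => j _; rewrite mxE.
exists (\matrix_(i, j) complex.Re (P i j)), (\matrix_(i, j) complex.Im (P i j)), (fun r => complex.Re (E 0 r)).
split.
- move=> i j; have /matrixP/(_ i j) := Aeq; rewrite -mulmxA mxE => /(congr1 (@complex.Re R)).
  rewrite mxE Re_sum => Eij; rewrite (Eij : A i j = _); apply: eq_bigr => r _.
  rewrite mul_diag_mx !mxE ER /Num.conj /=.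
  by case: (P r i) (P r j) => x y [x' y'] /=; ring.
- move=> i j; have /matrixP/(_ i j) := PP; rewrite [in X in X -> _]mxE => /(congr1 (@complex.Re R)).
  rewrite [in X in _ = X -> _]mxE Re_sum => H; transitivity (complex.Re ((i == j)%:R : R[i])); last by case: eqP.
  rewrite -H; apply: eq_bigr => r _; rewrite !mxE /Num.conj /=.
  by case: (P r i) (P r j) => x y [x' y'] /=; ring.
- move=> r i; have /(congr1 (@complex.Re R)) := row r i; rewrite Re_sum ER !mxE => H.
  transitivity (complex.Re ((complex.Re (E 0 r))%:C%C * P r i)); last by case: (P r i) => x y /=; ring.
  rewrite -H; apply: eq_bigr => j _; rewrite mxE -(Asw i j).
  by case: (P r j) => x y /=; ring.
- move=> r i; have /(congr1 (@complex.Im R)) := row r i; rewrite Im_sum ER !mxE => H.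
  transitivity (complex.Im ((complex.Re (E 0 r))%:C%C * P r i)); last by case: (P r i) => x y /=; ring.
  rewrite -H; apply: eq_bigr => j _; rewrite mxE -(Asw i j).
  by case: (P r j) => x y /=; ring.
- move=> r; have /unitarymxP/matrixP/(_ r r) := Punit.
  rewrite [in X in X -> _]mxE => /(congr1 (@complex.Re R)).
  rewrite [in X in _ = X -> _]mxE eqxx Re_sum => H.
  transitivity (complex.Re (true%:R : R[i])) => //.
  rewrite -H; apply: eq_bigr => i _; rewrite !mxE /Num.conj /=.
  by case: (P r i) => x y /=; ring.
Qed.

(** An eigenvalue is the value of the form at the real part of a unit eigenvector plus its value at
    the imaginary part, hence nonnegative. Both parts, scaled by its square root, serve as columns
    of [B], which is why there are [n + n] of them. *)
Lemma psd_factor n (A : 'M[R]_n) : A^T = A ->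
  (forall x : 'I_n -> R, 0 <= \sum_i \sum_j A i j * x i * x j) ->
  exists (N : nat) (B : 'I_n -> 'I_N -> R),
    forall i j, A i j = \sum_s B i s * B j s.
Proof.
move=> /sym_spectral[U [V [D [AE UV AU AV n1]]]] psd.
have D0 r : 0 <= D r.
  have quad (W : 'I_n -> R) : (forall i, \sum_j A i j * W j = D r * W i) ->
      \sum_i \sum_j A i j * W i * W j = D r * \sum_i W i ^+ 2.
    move=> WE; rewrite mulr_sumr; apply: eq_bigr => i _.
    rewrite expr2 mulrA -WE mulr_suml; apply: eq_bigr => j _; ring.
  have -> : D r = D r * \sum_i (U r i ^+ 2) + D r * \sum_i (V r i ^+ 2).
    by rewrite -mulrDr -big_split n1 mulr1.
  by rewrite -(quad _ (AU r)) -(quad _ (AV r)) addr_ge0.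
exists (n + n)%N, (fun i s => match fintype.split s with
  inl r => Num.sqrt (D r) * U r i | inr r => Num.sqrt (D r) * V r i end) => i j.
rewrite AE big_split_ord /= -big_split; apply: eq_bigr => r _ /=.
rewrite (unsplitK (inl r)) (unsplitK (inr r)) -[in LHS](sqr_sqrtr (D0 r)); ring.
Qed.

Lemma top_eigenvector n (C : 'M[R]_n) : (0 < n)%N -> C^T = C ->
  exists (m : R) (y : 'I_n -> R), [/\ 0 < \sum_i y i ^+ 2,
     forall i, \sum_j C i j * y j = m * y i &
     forall x : 'I_n -> R, \sum_i \sum_j C i j * x i * x j <= m * \sum_i x i ^+ 2].
Proof.
case: n C => // n C _ /sym_spectral[U [V [D [CE UV CU CV n1]]]].
pose r0 := [arg max_(r > ord0) D r]%O.
have r0P r : D r <= D r0 by rewrite /r0; case: Order.TotalTheory.arg_maxP => // i _; apply.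
have main (x : 'I_n.+1 -> R) : \sum_i \sum_j C i j * x i * x j <= D r0 * \sum_i x i ^+ 2.
  pose S (W : 'I_n.+1 -> R) := \sum_i W i * x i.
  have SS W : \sum_i \sum_j (W i * x i) * (W j * x j) = S W ^+ 2.
    by rewrite expr2 /S mulr_suml; apply: eq_bigr => i _; rewrite mulr_sumr.
  have -> : \sum_i x i ^+ 2 = \sum_r (S (U r) ^+ 2 + S (V r) ^+ 2).
    transitivity (\sum_i \sum_j (\sum_r (U r i * U r j + V r i * V r j)) * x i * x j).
      apply: eq_bigr => i _; rewrite (bigD1 i) //= [X in _ = _ + X]big1 ?addr0 => [|j ji].
        by rewrite UV eqxx mul1r.
      by rewrite UV eq_sym (negbTE ji) !mul0r.
    under eq_bigr do under eq_bigr do rewrite !mulr_suml.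
    under eq_bigr do rewrite exchange_big /=.
    rewrite exchange_big /=; apply: eq_bigr => r _.
    rewrite -!SS -big_split; apply: eq_bigr => i _ /=.
    by rewrite -big_split; apply: eq_bigr => j _ /=; ring.
  have -> : \sum_i \sum_j C i j * x i * x j = \sum_r D r * (S (U r) ^+ 2 + S (V r) ^+ 2).
    under eq_bigr do under eq_bigr do rewrite CE !mulr_suml.
    under eq_bigr do rewrite exchange_big /=.
    rewrite exchange_big /=; apply: eq_bigr => r _.
    rewrite -!SS mulrDr !mulr_sumr -big_split; apply: eq_bigr => i _ /=.
    by rewrite !mulr_sumr -big_split; apply: eq_bigr => j _ /=; ring.
  rewrite mulr_sumr; apply: ler_sum => r _; apply: ler_wpM2r => //.
  by rewrite addr_ge0 ?sqr_ge0.
(* The real part of the unit eigenvector may vanish; then the imaginary part has norm 1 and serves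
   instead. *)
have [U0|U0] := ltP 0 (\sum_i U r0 i ^+ 2).
  by exists (D r0), (U r0); split.
exists (D r0), (V r0); split => //.
have := n1 r0; rewrite big_split /= => E.
have -> : \sum_i V r0 i ^+ 2 = 1 - \sum_i U r0 i ^+ 2 by rewrite -E; ring.
lra.
Qed.

End real_symmetric.

(** The dimension count of the min-max argument; [x] is a nonzero row of the left kernel of [A]. *)
Lemma exists_orthogonal_combination (F : fieldType) (n m : nat) (A : 'M[F]_(n, m)) : (m < n)%N ->
  exists2 x : 'I_n -> F, exists i, x i != 0 & forall j, \sum_i x i * A i j = 0.
Proof.
move=> mn; have : kermx A != 0.
  by rewrite kermx_eq0 /row_free neq_ltn (leq_ltn_trans (rank_leq_col A) mn).
move=> /eqP K0.
have [i [j ij]] : exists i j, kermx A i j != 0.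
  apply: contrapT => H; apply: K0; apply/matrixP => i j; apply/eqP; rewrite [X in _ == X]mxE.
  by apply/negPn/negP => ij; apply: H; exists i, j.
exists (kermx A i); first by exists j.
move=> k; have /matrixP/(_ i k) := mulmx_ker A.
by rewrite mxE [RHS]mxE.
Qed.

(** * Square-integrable functions and Hilbert-Schmidt kernels *)

Lemma abs_mul_le (R : realDomainType) (s t : R) : `|s * t| <= s ^+ 2 + t ^+ 2.
Proof.
have := sqr_ge0 (s + t); have := sqr_ge0 (s - t).
have := sqr_ge0 s; have := sqr_ge0 t.
by rewrite ler_norml; nra.
Qed.

Section integrability.
Context d (T : measurableType d) (R : realType) (mu : {measure set T -> \bar R}).

Implicit Types f g : T -> R.

Definition rintegrable (f : T -> R) := mu.-integrable setT (EFin \o f).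

Lemma rintegrable_measurable f : rintegrable f -> measurable_fun setT f.
Proof. by move=> /measurable_int /measurable_EFinP. Qed.

Lemma rintegrable_le f g : measurable_fun setT f -> (forall x, `|f x| <= g x) ->
  rintegrable g -> rintegrable f.
Proof.
move=> mf fg gi; apply: (le_integrable measurableT _ _ gi); first exact/measurable_EFinP.
by move=> x _ /=; rewrite lee_fin (le_trans (fg x)) // ler_norm.
Qed.

Lemma rintegrableD f g : rintegrable f -> rintegrable g -> rintegrable (fun x => f x + g x).
Proof. by move=> fi gi; exact: (integrableD measurableT fi gi). Qed.

Lemma rintegrableB f g : rintegrable f -> rintegrable g -> rintegrable (fun x => f x - g x).
Proof. by move=> fi gi; exact: (integrableB measurableT fi gi). Qed.

Lemma rintegrableZ k f : rintegrable f -> rintegrable (fun x => k * f x).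
Proof. by move=> fi; exact: (integrableZl measurableT k fi). Qed.

Lemma rintegrable_sum (I : Type) (s : seq I) (f : I -> T -> R) :
  (forall i, rintegrable (f i)) -> rintegrable (fun x => \sum_(i <- s) f i x).
Proof.
move=> fi; elim: s => [|i s ih].
  by apply: eq_integrable (integrable0 _ _) => // x _; rewrite /= big_nil.
by apply: eq_integrable (rintegrableD (fi i) ih) => // x _ /=; rewrite big_cons.
Qed.

Lemma Rintegral_sum (I : Type) (s : seq I) (f : I -> T -> R) :
  (forall i, rintegrable (f i)) ->
  \int[mu]_x (\sum_(i <- s) f i x) = \sum_(i <- s) \int[mu]_x f i x.
Proof.
move=> fi; elim: s => [|i s ih].
  rewrite big_nil; under eq_Rintegral do rewrite big_nil.
  by rewrite Rintegral_cst // mul0r.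
rewrite big_cons -ih; under eq_Rintegral do rewrite big_cons.
by rewrite RintegralD //; [exact: fi|exact: rintegrable_sum].
Qed.

Lemma ge0_rintegrable f : measurable_fun setT f -> (forall x, 0 <= f x) ->
  (\int[mu]_x (f x)%:E < +oo)%E -> rintegrable f.
Proof.
move=> mf f0 foo; apply/integrableP; split; first exact/measurable_EFinP.
by under eq_integral do rewrite /= ger0_norm //.
Qed.

Lemma rintegrable_abs f : rintegrable f -> rintegrable (fun x => `|f x|).
Proof. exact: integrable_norm. Qed.

Lemma EFin_Rintegral f : rintegrable f ->
  (\int[mu]_x f x)%:E = (\int[mu]_x (f x)%:E)%E.
Proof. by move=> fi; rewrite fineK //; exact: integrable_fin_num. Qed.

End integrability.

Section square_integrable.
Context d (T : measurableType d) (R : realType) (mu : {measure set T -> \bar R}).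
Implicit Types f g h : T -> R.
Local Notation rintegrable := (rintegrable mu).

Definition sqint f := measurable_fun setT f /\ rintegrable (fun x => f x ^+ 2).

Definition ip f g := \int[mu]_x (f x * g x).

Lemma sqintM f g : sqint f -> sqint g -> rintegrable (fun x => f x * g x).
Proof.
move=> [mf fi] [mg gi]; apply: rintegrable_le (rintegrableD fi gi).
  exact: measurable_funM.
by move=> x; exact: abs_mul_le.
Qed.

Lemma sqint0 : sqint (fun=> 0).
Proof.
split; first exact: measurable_cst.
by apply: eq_integrable (integrable0 _ _) => // x _ /=; rewrite expr0n.
Qed.

Lemma sqintD f g : sqint f -> sqint g -> sqint (fun x => f x + g x).
Proof.
move=> [mf fi] [mg gi]; split; first exact: measurable_funD.
apply: rintegrable_le (rintegrableD (rintegrableZ 2 fi) (rintegrableZ 2 gi)).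
  by apply: measurable_funX; exact: measurable_funD.
by move=> x; rewrite ger0_norm ?sqr_ge0 //; have := sqr_ge0 (f x - g x); nra.
Qed.

Lemma sqintZ k f : sqint f -> sqint (fun x => k * f x).
Proof.
move=> [mf fi]; split; first by apply: measurable_funM => //; exact: measurable_cst.
by apply: eq_integrable (rintegrableZ (k ^+ 2) fi) => // x _ /=; rewrite exprMn.
Qed.

Lemma sqintB f g : sqint f -> sqint g -> sqint (fun x => f x - g x).
Proof.
move=> fi gi; have := sqintD fi (sqintZ (-1) gi).
by under eq_fun do rewrite mulN1r.
Qed.

Lemma sqint_sum (I : Type) (s : seq I) (f : I -> T -> R) :
  (forall i, sqint (f i)) -> sqint (fun x => \sum_(i <- s) f i x).
Proof.
move=> fi; elim: s => [|i s ih].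
  by under eq_fun do rewrite big_nil; exact: sqint0.
by under eq_fun do rewrite big_cons; exact: sqintD.
Qed.

Lemma sqint_lincomb (I : Type) (s : seq I) (c : I -> R) (f : I -> T -> R) :
  (forall i, sqint (f i)) -> sqint (fun x => \sum_(i <- s) c i * f i x).
Proof. by move=> fi; apply: sqint_sum => i; exact: sqintZ. Qed.

Lemma ipC f g : ip f g = ip g f.
Proof. by apply: eq_Rintegral => x _; rewrite mulrC. Qed.

Lemma ipZl k f h : sqint f -> sqint h -> ip (fun x => k * f x) h = k * ip f h.
Proof.
move=> fi hi; rewrite /ip -RintegralZl //; last exact: sqintM.
by apply: eq_Rintegral => x _; rewrite mulrA.
Qed.

Lemma ipBl f g h : sqint f -> sqint g -> sqint h ->
  ip (fun x => f x - g x) h = ip f h - ip g h.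
Proof.
move=> fi gi hi; rewrite /ip -RintegralB //; [|exact: sqintM..].
by apply: eq_Rintegral => x _; rewrite mulrBl.
Qed.

Lemma ipBr f g h : sqint f -> sqint g -> sqint h ->
  ip h (fun x => f x - g x) = ip h f - ip h g.
Proof. by move=> *; rewrite ipC ipBl // ipC (ipC g). Qed.

Lemma ipZr k f h : sqint f -> sqint h -> ip h (fun x => k * f x) = k * ip h f.
Proof. by move=> fi hi; rewrite ipC ipZl // ipC. Qed.

Lemma ip_suml (I : Type) (s : seq I) (c : I -> R) (f : I -> T -> R) h :
  (forall i, sqint (f i)) -> sqint h ->
  ip (fun x => \sum_(i <- s) c i * f i x) h = \sum_(i <- s) c i * ip (f i) h.
Proof.
move=> fi hi; under [RHS]eq_bigr do rewrite -ipZl //.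
rewrite -Rintegral_sum => [|i]; last by apply: sqintM => //; exact: sqintZ.
by apply: eq_Rintegral => x _; rewrite mulr_suml.
Qed.

Lemma ip_sumr (I : Type) (s : seq I) (c : I -> R) (f : I -> T -> R) h :
  (forall i, sqint (f i)) -> sqint h ->
  ip h (fun x => \sum_(i <- s) c i * f i x) = \sum_(i <- s) c i * ip h (f i).
Proof.
by move=> fi hi; rewrite ipC ip_suml //; apply: eq_bigr => i _; rewrite ipC.
Qed.

Lemma ip_ge0 f : 0 <= ip f f.
Proof. by apply: Rintegral_ge0 => x _; rewrite -expr2 sqr_ge0. Qed.

Lemma ipE2 f : ip f f = \int[mu]_x (f x ^+ 2).
Proof. by apply: eq_Rintegral => x _; rewrite expr2. Qed.

Lemma EFin_ip f : sqint f -> (ip f f)%:E = (\int[mu]_x (f x ^+ 2)%:E)%E.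
Proof. by move=> [_ fi]; rewrite ipE2 EFin_Rintegral. Qed.

(** The right-hand side minus the left-hand side is |2f - g|^2. *)
Lemma ip_triangle f g : sqint f -> sqint g ->
  ip g g <= 2 * ip f f + 2 * ip (fun x => f x - g x) (fun x => f x - g x).
Proof.
move=> fi gi; have := ip_ge0 (fun x => 2 * f x - g x).
have f2 := sqintZ 2 fi; have fg2 := sqintB f2 gi; have fg := sqintB fi gi.
rewrite !(ipBl, ipBr, ipZl, ipZr) // (ipC g f); lra.
Qed.

Lemma ip_CauchySchwarz f g : sqint f -> sqint g -> ip f g ^+ 2 <= ip f f * ip g g.
Proof.
move=> fi gi.
have quad t : 0 <= ip f f - 2 * t * ip f g + t ^+ 2 * ip g g.
  have := ip_ge0 (fun x => f x - t * g x).
  have tg := sqintZ t gi.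
  have fg := sqintB fi tg.
  by rewrite ipBl // !ipBr // ipZr // !ipZl // ipZr // (ipC g f); nra.
have [g0|g0] := eqVneq (ip g g) 0.
  have [->|q0] := eqVneq (ip f g) 0; first by rewrite g0 mulr0 expr0n.
  (* With |g| = 0 the quadratic is affine in t, and this t makes it equal to - |f|^2 - 2. *)
  have := quad ((ip f f + 1) / ip f g).
  rewrite g0 mulr0 addr0 -mulrA divfK // => H; have f0 := ip_ge0 f; lra.
have gp : 0 < ip g g by rewrite lt_neqAle eq_sym g0 ip_ge0.
have /(ler_wpM2r (ltW gp)) := quad (ip f g / ip g g); rewrite mul0r.
suff -> : (ip f f - 2 * (ip f g / ip g g) * ip f g + (ip f g / ip g g) ^+ 2 * ip g g) * ip g g
  = ip f f * ip g g - ip f g ^+ 2 by rewrite subr_ge0.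
field; exact: g0.
Qed.

Lemma ip_null f g : sqint f -> sqint g -> ip f f = 0 -> ip f g = 0.
Proof.
move=> fi gi f0; have := ip_CauchySchwarz fi gi; rewrite f0 mul0r => H.
by apply/eqP; rewrite -sqrf_eq0 eq_le H sqr_ge0.
Qed.

Lemma ip_ae f g h : measurable_fun setT f -> measurable_fun setT g ->
  measurable_fun setT h -> {ae mu, forall x, f x = g x} -> ip f h = ip g h.
Proof.
move=> mf mg mh fg; congr fine; apply: ae_eq_integral => //.
- by apply/measurable_EFinP; exact: measurable_funM.
- by apply/measurable_EFinP; exact: measurable_funM.
by apply: filterS fg => x -> _.
Qed.

End square_integrable.

Section parametric_integrals.
Context d1 d2 (T1 : measurableType d1) (T2 : measurableType d2) (R : realType).
Variables (m1 : {sigma_finite_measure set T1 -> \bar R}).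
Variables (m2 : {sigma_finite_measure set T2 -> \bar R}).

(** Tonelli applies to the positive and to the negative part separately, so sections with a
    divergent integral do no harm. *)
Lemma measurable_integral_param (F : T1 * T2 -> \bar R) : measurable_fun setT F ->
  measurable_fun setT (fun x => \int[m2]_y F (x, y))%E.
Proof.
move=> mF; under eq_fun do rewrite integralE.
have Epos x : (fun y => F (x, y))^\+%E = (fun y => F^\+%E (x, y)).
  by apply/funext => y; rewrite !unlock.
have Eneg x : (fun y => F (x, y))^\-%E = (fun y => F^\-%E (x, y)).
  by apply/funext => y; rewrite !unlock.
apply: emeasurable_funB.
- under eq_fun do rewrite Epos.
  exact: (measurable_fun_fubini_tonelli_F _ (measurable_funepos mF) (funepos_ge0 F)).
- under eq_fun do rewrite Eneg.
  exact: (measurable_fun_fubini_tonelli_F _ (measurable_funeneg mF) (funeneg_ge0 F)).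
Qed.

Lemma measurable_Rintegral_param (F : T1 -> T2 -> R) :
  measurable_fun setT (fun z : T1 * T2 => F z.1 z.2) ->
  measurable_fun setT (fun x => \int[m2]_y F x y).
Proof.
move=> mF; apply: (measurableT_comp (fine_measurable measurableT)).
apply: (measurable_integral_param (F := fun z => (F z.1 z.2)%:E)).
exact/measurable_EFinP.
Qed.

Lemma measurable_section1 d3 (T3 : measurableType d3) (F : T1 -> T2 -> T3) x :
  measurable_fun setT (fun z : T1 * T2 => F z.1 z.2) -> measurable_fun setT (F x).
Proof. by move=> mF; exact: (measurableT_comp mF (measurable_pair1 x)). Qed.

Lemma measurable_section2 d3 (T3 : measurableType d3) (F : T1 -> T2 -> T3) y :
  measurable_fun setT (fun z : T1 * T2 => F z.1 z.2) -> measurable_fun setT (F^~ y).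
Proof. by move=> mF; exact: (measurableT_comp mF (measurable_pair2 y)). Qed.

Lemma Rfubini (F : T1 -> T2 -> R) :
  measurable_fun setT (fun z : T1 * T2 => F z.1 z.2) ->
  (\int[m1]_x \int[m2]_y `|F x y|%:E < +oo)%E ->
  \int[m1]_x \int[m2]_y F x y = \int[m2]_y \int[m1]_x F x y.
Proof.
move=> mF Foo; pose f (z : T1 * T2) := (F z.1 z.2)%:E.
have mf : measurable_fun setT f by exact/measurable_EFinP.
have fi : (m1 \x m2)%E.-integrable setT f by apply/(integrable12ltyP _ _ mf).
congr fine; transitivity (\int[m1]_x \int[m2]_y f (x, y))%E.
  (* [fine] can be removed from the inner integral only where the section is integrable, that is,
     almost everywhere. *)
  apply: ae_eq_integral => //.
  - by apply/measurable_EFinP; exact: measurable_Rintegral_param.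
  - exact: measurable_integral_param.
  have := ae_integrable1 fi; apply: filterS => x fx _.
  exact: (EFin_Rintegral (f := F x) fx).
rewrite (Fubini fi); apply: ae_eq_integral => //.
- exact: (measurable_fubini_G fi).
- apply/measurable_EFinP; apply: (measurableT_comp (fine_measurable measurableT)).
  exact: (measurable_fubini_G fi).
have := ae_integrable2 fi; apply: filterS => y fy _.
exact/esym/(EFin_Rintegral (f := F^~ y) fy).
Qed.

End parametric_integrals.

Section kernels.
Context d (T : measurableType d) (R : realType).
Variable mu : {sigma_finite_measure set T -> \bar R}.
Local Notation sqint := (sqint mu).
Local Notation ip := (ip mu).
Implicit Types (f g h : T -> R) (G H : T -> T -> R).

(** The squared Hilbert-Schmidt norm. *)
Definition HS G : \bar R := (\int[mu]_v \int[mu]_u (G u v ^+ 2)%:E)%E.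

(* [HSkernel] requires every section, not just almost every one, to be in L2 *)
Definition HSkernel G := [/\ measurable_fun setT (fun z : T * T => G z.1 z.2),
  (HS G < +oo)%E, forall u, sqint (G u) & forall v, sqint (G^~ v)].

(** The first argument is integrated out: for [G] = M_k this is the adjoint of the operator with
    kernel M_k, and K is the sum over k of the transposes of these adjoints composed with them. *)
Definition KT G f v := ip (G^~ v) f.

Lemma HS_ge0 G : (0 <= HS G)%E.
Proof. by apply: integral_ge0 => v _; apply: integral_ge0 => u _; rewrite lee_fin sqr_ge0. Qed.

Lemma measurable_swap_args G : measurable_fun setT (fun z : T * T => G z.1 z.2) ->
  measurable_fun setT (fun z : T * T => G z.2 z.1).
Proof. by move=> mG; exact: (measurableT_comp mG (@measurable_swap _ _ T T)). Qed.

Lemma measurable_inner_integral G : measurable_fun setT (fun z : T * T => G z.1 z.2) ->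
  measurable_fun setT (fun v => \int[mu]_u (G u v)%:E)%E.
Proof.
move=> mG; apply: (measurable_integral_param mu (F := fun z : T * T => (G z.2 z.1)%:E)).
by apply/measurable_EFinP; exact: measurable_swap_args.
Qed.

Lemma measurable_HS_section G : measurable_fun setT (fun z : T * T => G z.1 z.2) ->
  measurable_fun setT (fun v => \int[mu]_u (G u v ^+ 2)%:E)%E.
Proof.
move=> mG; apply: (measurable_inner_integral (G := fun u v => G u v ^+ 2)).
exact: measurable_funX.
Qed.

Lemma HS_tr G : measurable_fun setT (fun z : T * T => G z.1 z.2) ->
  HS (fun u v => G v u) = HS G.
Proof.
move=> mG; apply: (fubini_tonelli (m1 := mu) (m2 := mu)
  (fun z : T * T => (G z.1 z.2 ^+ 2)%:E)) => [|z].
  by apply/measurable_EFinP; exact: measurable_funX.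
by rewrite lee_fin sqr_ge0.
Qed.

Lemma HSkernel_tr G : HSkernel G -> HSkernel (fun u v => G v u).
Proof.
move=> [mG Goo G1 G2]; split => //; last by rewrite HS_tr.
exact: (measurable_swap_args (G := G)).
Qed.

Lemma KT_measurable G f : HSkernel G -> measurable_fun setT f ->
  measurable_fun setT (KT G f).
Proof.
move=> [mG _ _ _] mf; apply: measurable_Rintegral_param.
apply: measurable_funM; first exact: (measurable_swap_args (G := G)).
exact: (measurableT_comp mf measurable_snd).
Qed.

Lemma KT_bound G f : HSkernel G -> sqint f ->
  (\int[mu]_v (KT G f v ^+ 2)%:E <= HS G * (ip f f)%:E)%E.
Proof.
move=> GG fi; have [mG Goo G1 G2] := GG; have [mf _] := fi.
rewrite -ge0_integralZr //; last 3 first.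
- exact: measurable_HS_section.
- by move=> v _; apply: integral_ge0 => u _; rewrite lee_fin sqr_ge0.
- by rewrite lee_fin ip_ge0.
apply: ge0_le_integral => //.
- by move=> v _; rewrite lee_fin sqr_ge0.
- by apply/measurable_EFinP; apply: measurable_funX; exact: KT_measurable.
- apply: emeasurable_funM; last exact: measurable_cst.
  exact: measurable_HS_section.
- move=> v _; rewrite -(EFin_ip (G2 v)) -EFinM lee_fin.
  exact: ip_CauchySchwarz.
Qed.

Lemma KT_sqint G f : HSkernel G -> sqint f -> sqint (KT G f).
Proof.
move=> GG fi; have [mf _] := fi; split; first exact: KT_measurable.
apply: ge0_rintegrable => [|v|].
- by apply: measurable_funX; exact: KT_measurable.
- exact: sqr_ge0.
apply: le_lt_trans (KT_bound GG fi) _.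
have [_ Goo _ _] := GG; rewrite -(fineK (_ : HS G \is a fin_num)) ?ltry //.
by rewrite ge0_fin_numE // HS_ge0.
Qed.

Lemma KT_ip_bound G f dl : HSkernel G -> sqint f -> (HS G <= dl%:E)%E ->
  ip (KT G f) (KT G f) <= dl * ip f f.
Proof.
move=> GG fi Gdl; rewrite -lee_fin EFin_ip; last exact: KT_sqint.
apply: le_trans (KT_bound GG fi) _; rewrite EFinM; apply: lee_wpmul2r => //.
by rewrite lee_fin ip_ge0.
Qed.

Lemma KT_adjoint G f h : HSkernel G -> sqint f -> sqint h ->
  ip (KT G f) h = ip f (KT (fun u v => G v u) h).
Proof.
move=> GG fi hi; have [mG Goo G1 G2] := GG.
have [mf f2] := fi; have [mh h2] := hi.
transitivity (\int[mu]_v \int[mu]_u (G u v * f u * h v)).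
  apply: eq_Rintegral => v _; rewrite -RintegralZr //; exact: sqintM.
rewrite Rfubini.
- apply: eq_Rintegral => u _; rewrite -RintegralZl //; last exact: sqintM.
  by apply: eq_Rintegral => v _; ring.
- apply: measurable_funM; last exact: (measurableT_comp mh measurable_fst).
  apply: measurable_funM; first exact: (measurable_swap_args (G := G)).
  exact: (measurableT_comp mf measurable_snd).
have mG2 : measurable_fun setT (fun v => \int[mu]_u (G u v ^+ 2)%:E)%E.
  exact: measurable_HS_section.
(* Absolute convergence for Fubini: |G(u, v) f(u) h(v)| is at most G(u, v)^2 + h(v)^2 f(u)^2. *)
apply: (@le_lt_trans _ _ (\int[mu]_v ((\int[mu]_u (G u v ^+ 2)%:E) + (h v ^+ 2 * ip f f)%:E)))%E.
  apply: ge0_le_integral => //.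
  - by move=> v _; apply: integral_ge0 => u _; rewrite lee_fin.
  - apply: (measurable_inner_integral (G := fun u v => `|G u v * f u * h v|)).
    apply: measurableT_comp => //.
    apply: measurable_funM; last exact: (measurableT_comp mh measurable_snd).
    apply: measurable_funM => //; exact: (measurableT_comp mf measurable_fst).
  - apply: emeasurable_funD => //; apply/measurable_EFinP.
    apply: measurable_funM; last exact: measurable_cst.
    exact: measurable_funX.
  move=> v _; rewrite EFinM (EFin_ip fi) -ge0_integralZl //; first last.
  - by rewrite lee_fin sqr_ge0.
  - by move=> u _; rewrite lee_fin sqr_ge0.
  - by apply/measurable_EFinP; exact: measurable_funX.
  have [mGv _] := G2 v.
  rewrite -ge0_integralD //; first last.
  - by apply: measurable_funeM; apply/measurable_EFinP; exact: measurable_funX.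
  - by move=> u _; rewrite -EFinM lee_fin mulr_ge0 ?sqr_ge0.
  - by apply/measurable_EFinP; exact: measurable_funX.
  - by move=> u _; rewrite lee_fin sqr_ge0.
  apply: ge0_le_integral => //.
  - apply/measurable_EFinP; apply: measurableT_comp => //.
    apply: measurable_funM; last exact: measurable_cst.
    exact: measurable_funM.
  - apply: emeasurable_funD; first by apply/measurable_EFinP; exact: measurable_funX.
    by apply: measurable_funeM; apply/measurable_EFinP; exact: measurable_funX.
  move=> u _; rewrite -EFinM -EFinD lee_fin ler_norml -exprMn.
  have -> : G u v * f u * h v = G u v * (h v * f u) by ring.
  by rewrite -ler_norml; exact: abs_mul_le.
rewrite ge0_integralD //; first last.
- by apply/measurable_EFinP; apply: measurable_funM;
    [exact: measurable_funX|exact: measurable_cst].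
- by move=> v _; rewrite lee_fin mulr_ge0 ?sqr_ge0 ?ip_ge0.
- by move=> v _; apply: integral_ge0 => u _; rewrite lee_fin sqr_ge0.
rewrite lte_add_pinfty //; apply: integrable_lty => //.
by apply: eq_integrable (rintegrableZ (ip f f) h2) => // v _; rewrite /= mulrC.
Qed.

Lemma KT_sum (I : Type) (s : seq I) (c : I -> R) G (f : I -> T -> R) v :
  HSkernel G -> (forall i, sqint (f i)) ->
  KT G (fun u => \sum_(i <- s) c i * f i u) v = \sum_(i <- s) c i * KT G (f i) v.
Proof. by move=> [_ _ _ G2] fi; rewrite /KT ip_sumr. Qed.

Lemma KTBl G H f v : HSkernel G -> HSkernel H -> sqint f ->
  KT (fun u v => H u v - G u v) f v = KT H f v - KT G f v.
Proof. by move=> [_ _ _ G2] [_ _ _ H2] fi; rewrite /KT ipBl. Qed.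

Lemma HSB_le G H : measurable_fun setT (fun z : T * T => G z.1 z.2) ->
  measurable_fun setT (fun z : T * T => H z.1 z.2) ->
  (HS (fun u v => (H u v - G u v)%R) <= 2%:E * HS H + 2%:E * HS G)%E.
Proof.
move=> mG mH.
have S0 (K : T -> T -> R) v : (0 <= \int[mu]_u (K u v ^+ 2)%:E)%E.
  by apply: integral_ge0 => u _; rewrite lee_fin sqr_ge0.
rewrite -!ge0_integralZl //; [|exact: measurable_HS_section..].
rewrite -ge0_integralD //; first last.
- by apply: measurable_funeM; exact: measurable_HS_section.
- by move=> v _; rewrite mule_ge0.
- by apply: measurable_funeM; exact: measurable_HS_section.
- by move=> v _; rewrite mule_ge0.
apply: ge0_le_integral => //.
- by move=> v _; exact: (S0 (fun u v => H u v - G u v)).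
- by apply: (measurable_HS_section (G := fun u v => H u v - G u v)); exact: measurable_funB.
- by apply: emeasurable_funD; apply: measurable_funeM; exact: measurable_HS_section.
move=> v _; have mGv := measurable_section2 v mG; have mHv := measurable_section2 v mH.
rewrite -!ge0_integralZl //; first last.
- by move=> u _; rewrite lee_fin sqr_ge0.
- by apply/measurable_EFinP; exact: measurable_funX.
- by move=> u _; rewrite lee_fin sqr_ge0.
- by apply/measurable_EFinP; exact: measurable_funX.
rewrite -ge0_integralD //; first last.
- by apply: measurable_funeM; apply/measurable_EFinP; exact: measurable_funX.
- by move=> u _; rewrite mule_ge0 ?lee_fin ?sqr_ge0.
- by apply: measurable_funeM; apply/measurable_EFinP; exact: measurable_funX.
- by move=> u _; rewrite mule_ge0 ?lee_fin ?sqr_ge0.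
apply: ge0_le_integral => //.
- by move=> u _; rewrite lee_fin sqr_ge0.
- by apply/measurable_EFinP; apply: measurable_funX; exact: measurable_funB.
- by apply: emeasurable_funD; apply: measurable_funeM; apply/measurable_EFinP;
    exact: measurable_funX.
move=> u _; rewrite -!EFinM -EFinD lee_fin; have := sqr_ge0 (H u v + G u v); nra.
Qed.

Lemma HSkernelB G H : HSkernel G -> HSkernel H -> HSkernel (fun u v => H u v - G u v).
Proof.
move=> [mG Goo G1 G2] [mH Hoo H1 H2].
split; [exact: measurable_funB| |by move=> u; exact: sqintB|by move=> v; exact: sqintB].
apply: le_lt_trans (HSB_le mG mH) _.
by rewrite lte_add_pinfty // lte_mul_pinfty.
Qed.

Lemma HS_prod f g : sqint f -> sqint g ->
  HS (fun u v => f u * g v) = (ip f f * ip g g)%:E.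
Proof.
move=> fi gi; have [mf f2] := fi; have [mg g2] := gi.
transitivity (\int[mu]_v ((ip f f)%:E * (g v ^+ 2)%:E))%E.
  apply: eq_integral => v _; rewrite EFin_ip // -ge0_integralZr //.
  - by apply: eq_integral => u _; rewrite -EFinM exprMn.
  - by apply/measurable_EFinP; exact: measurable_funX.
  - by move=> u _; rewrite lee_fin sqr_ge0.
  - by rewrite lee_fin sqr_ge0.
rewrite ge0_integralZl //; first by rewrite EFinM -(EFin_ip gi).
- by apply/measurable_EFinP; exact: measurable_funX.
- by move=> u _; rewrite lee_fin sqr_ge0.
- by rewrite lee_fin ip_ge0.
Qed.

Lemma HSkernel_prod f g : sqint f -> sqint g -> HSkernel (fun u v => f u * g v).
Proof.
move=> fi gi; have [mf f2] := fi; have [mg g2] := gi; split.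
- apply: measurable_funM; first exact: (measurableT_comp mf measurable_fst).
  exact: (measurableT_comp mg measurable_snd).
- by rewrite HS_prod // ltry.
- by move=> u; exact: sqintZ.
- by move=> v; under eq_fun do rewrite mulrC; exact: sqintZ.
Qed.

Lemma HSkernelD G H : HSkernel G -> HSkernel H -> HSkernel (fun u v => G u v + H u v).
Proof.
move=> GG HH; have H0 := HSkernel_prod (sqint0 mu) (sqint0 mu).
have := HSkernelB (HSkernelB HH H0) GG.
by under eq_fun do under eq_fun do rewrite mul0r sub0r opprK.
Qed.

Lemma HSkernel_sum (I : Type) (s : seq I) (G : I -> T -> T -> R) :
  (forall i, HSkernel (G i)) -> HSkernel (fun u v => \sum_(i <- s) G i u v).
Proof.
move=> GG; elim: s => [|i s ih].
  have := HSkernel_prod (sqint0 mu) (sqint0 mu).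
  by under eq_fun do under eq_fun do rewrite mul0r; under [X in _ -> HSkernel X]eq_fun do under eq_fun do rewrite big_nil.
by under eq_fun do under eq_fun do rewrite big_cons; exact: HSkernelD.
Qed.

(** As a function of u', the composed kernel is the transpose operator applied to the section [G u];
    adjointness moves it onto [f]. Since every section is in L2, this holds at every [u], without a
    null set. *)
Lemma ip_composition G f : HSkernel G -> sqint f -> forall u,
  ip (fun u' => ip (G u) (G u')) f = KT (fun u v => G v u) (KT G f) u.
Proof.
move=> GG fi u; have [_ _ G1 _] := GG.
transitivity (ip (KT (fun u v => G v u) (G u)) f).
  by apply: eq_Rintegral => u' _; rewrite /KT ipC.
by rewrite KT_adjoint //; exact: HSkernel_tr.
Qed.

Lemma sqint_composition G : HSkernel G -> forall u, sqint (fun u' => ip (G u) (G u')).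
Proof.
move=> GG u; have [_ _ G1 _] := GG; have := KT_sqint (HSkernel_tr GG) (G1 u).
by rewrite /KT; under eq_fun do rewrite ipC.
Qed.

End kernels.

(** * Perturbation of the leading eigenspace *)

Section orthonormal_systems.
Context d (T : measurableType d) (R : realType) (mu : {measure set T -> \bar R}).
Local Notation sqint := (sqint mu).
Local Notation ip := (ip mu).
Variables (n : nat) (z : 'I_n -> T -> R).

Definition orthonormal := (forall j, sqint (z j)) /\
  (forall j k, ip (z j) (z k) = (j == k)%:R).

Lemma ip_lincomb_orthonormal (x : 'I_n -> R) j : orthonormal ->
  ip (fun u => \sum_i x i * z i u) (z j) = x j.
Proof.
move=> [zi zo]; rewrite ip_suml // (bigD1 j) //= zo eqxx mulr1.
by rewrite big1 ?addr0 // => i ij; rewrite zo (negbTE ij) mulr0.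
Qed.

Lemma ip_lincomb_self (x : 'I_n -> R) : orthonormal ->
  ip (fun u => \sum_i x i * z i u) (fun u => \sum_i x i * z i u) = \sum_i x i ^+ 2.
Proof.
move=> zz; have [zi _] := zz; rewrite ip_sumr //; last exact: sqint_lincomb.
by apply: eq_bigr => j _; rewrite ip_lincomb_orthonormal // expr2.
Qed.

Definition residual f u := f u - \sum_j ip f (z j) * z j u.

Lemma sqint_residual f : orthonormal -> sqint f -> sqint (residual f).
Proof. by move=> [zi _] fi; apply: sqintB => //; exact: sqint_lincomb. Qed.

Lemma residual_orthogonal f j : orthonormal -> sqint f -> ip (residual f) (z j) = 0.
Proof.
move=> zz fi; have [zi _] := zz; rewrite ipBl //; last exact: sqint_lincomb.
by rewrite ip_lincomb_orthonormal // subrr.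
Qed.

Lemma ip_residual f g : orthonormal -> sqint f -> sqint g ->
  (forall j, ip g (z j) = 0) -> ip (residual f) g = ip f g.
Proof.
move=> zz fi gi g0; have [zi _] := zz; rewrite ipBl //; last exact: sqint_lincomb.
by rewrite ip_suml // big1 ?subr0 // => j _; rewrite (ipC _ (z j)) g0 mulr0.
Qed.

Lemma ip_residual_self f : orthonormal -> sqint f ->
  ip (residual f) (residual f) = ip f f - \sum_j ip f (z j) ^+ 2.
Proof.
move=> zz fi; have [zi _] := zz; have ri := sqint_residual zz fi.
rewrite ip_residual // => [|j]; last exact: residual_orthogonal.
rewrite ipBr //; last exact: sqint_lincomb.
by rewrite ip_sumr //; congr (_ - _); apply: eq_bigr => j _; rewrite expr2.
Qed.

End orthonormal_systems.

Section finite_rank_operators.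
Context d (T : measurableType d) (R : realType) (mu : {measure set T -> \bar R}).
Local Notation sqint := (sqint mu).
Local Notation ip := (ip mu).

(* Writing the operator as f |-> sum_s <b_s, f> b_s, a top eigenvector of the
   Gram matrix of the residuals of the b_s modulo span(z) gives f. *)
Lemma finite_rank_eigenfunction (n N : nat) (A : 'M[R]_N) (c : 'I_N -> T -> R)
    (z : 'I_n -> T -> R) (l : 'I_n -> R) (w : T -> R) (m0 : R) :
  A^T = A -> (forall x : 'I_N -> R, 0 <= \sum_i \sum_j A i j * x i * x j) ->
  (forall i, sqint (c i)) -> orthonormal mu z ->
  (forall j, {ae mu, forall u, \sum_i (\sum_k A i k * ip (c k) (z j)) * c i u = l j * z j u}) ->
  sqint w -> (forall j, ip w (z j) = 0) -> 0 < ip w w -> 0 < m0 ->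
  m0 * ip w w <= \sum_i \sum_k A i k * ip (c i) w * ip (c k) w ->
  exists (m : R) (f : T -> R), [/\ m0 <= m, sqint f, forall j, ip f (z j) = 0, 0 < ip f f &
    forall u, \sum_i (\sum_k A i k * ip (c k) f) * c i u = m * f u].
Proof.
move=> As psd ci zz zeig wi wz w0 m00 wA; have [zi zo] := zz.
have [M [B AB]] := psd_factor As psd.
pose b s u := \sum_i B i s * c i u.
have bi s : sqint (b s) by exact: sqint_lincomb.
have opE f u : sqint f ->
    \sum_i (\sum_k A i k * ip (c k) f) * c i u = \sum_s ip (b s) f * b s u.
  move=> fi; under [RHS]eq_bigr do rewrite mulr_sumr.
  rewrite exchange_big /=; apply: eq_bigr => i _.
  under [RHS]eq_bigr do rewrite ip_suml // mulr_suml.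
  rewrite mulr_suml exchange_big /=; apply: eq_bigr => k _.
  by rewrite AB !mulr_suml; apply: eq_bigr => t _; ring.
have quadE : \sum_i \sum_k A i k * ip (c i) w * ip (c k) w = \sum_s ip (b s) w ^+ 2.
  under [RHS]eq_bigr do rewrite ip_suml // expr2 mulr_suml.
  rewrite [RHS]exchange_big /=; apply: eq_bigr => i _.
  under [RHS]eq_bigr do rewrite mulr_sumr.
  rewrite [RHS]exchange_big /=; apply: eq_bigr => k _.
  by rewrite AB !mulr_suml; apply: eq_bigr => s _; ring.
have M0 : (0 < M)%N.
  rewrite lt0n; apply/eqP => M0; move: wA; rewrite quadE big1.
    by rewrite leNgt mulr_gt0.
  by move=> t _; have := ltn_ord t; rewrite [X in (_ < X)%N]M0.
pose q s := residual mu z (b s).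
have qi s : sqint (q s) by exact: sqint_residual.
pose C : 'M[R]_M := \matrix_(s, t) ip (q s) (q t).
have [|m [y [y0 Cy Cm]]] := top_eigenvector (C := C) M0.
  by apply/matrixP => s t; rewrite !mxE ipC.
have CE (x : 'I_M -> R) : \sum_s \sum_t C s t * x s * x t =
    ip (fun u => \sum_s x s * q s u) (fun u => \sum_s x s * q s u).
  rewrite ip_suml //; last exact: sqint_lincomb.
  apply: eq_bigr => s _; rewrite ip_sumr // mulr_sumr.
  by apply: eq_bigr => t _; rewrite mxE; ring.
pose f u := \sum_s y s * q s u.
have fi : sqint f by exact: sqint_lincomb.
have fz j : ip f (z j) = 0.
  by rewrite ip_suml // big1 // => s _; rewrite residual_orthogonal // mulr0.
have qf s : ip (q s) f = m * y s.
  by rewrite ip_sumr // -Cy; apply: eq_bigr => t _; rewrite mxE mulrC.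
have bf s : ip (b s) f = m * y s by rewrite -qf /q ip_residual.
(* The Gram matrix is tested at x_s = <b_s, w>. With S = |x|^2, S^2 = <g, w>^2 <= |g|^2 |w|^2 <= m S
   |w|^2, so S <= m |w|^2, while S >= m0 |w|^2 by hypothesis. *)
have m0m : m0 <= m.
  pose x s := ip (q s) w.
  have xb s : x s = ip (b s) w by exact: ip_residual.
  have S0 : 0 < \sum_s x s ^+ 2.
    under eq_bigr do rewrite xb.
    by rewrite -quadE (lt_le_trans _ wA) // mulr_gt0.
  pose g u := \sum_s x s * q s u.
  have gi : sqint g by exact: sqint_lincomb.
  have gw : ip g w = \sum_s x s ^+ 2.
    by rewrite ip_suml //; apply: eq_bigr => s _; rewrite expr2.
  have := ip_CauchySchwarz gi wi; rewrite gw => CS.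
  have := Cm x; rewrite CE -/g => gm.
  have {wA} : m0 * ip w w <= \sum_s x s ^+ 2.
    by rewrite (le_trans wA) // quadE; under [leRHS]eq_bigr do rewrite xb.
  move: S0 CS gm; set S := \sum_s _; set W := ip w w in w0 *; set g2 := ip g g.
  move=> S0 CS gm wS.
  have : S ^+ 2 <= m * S * W by rewrite (le_trans CS) // ler_wpM2r // ltW.
  rewrite expr2 mulrAC ler_pM2r // => SW.
  by rewrite -(ler_pM2r w0) (le_trans wS).
exists m, f; split => //.
  rewrite /f -CE (_ : \sum_s _ = m * \sum_s y s ^+ 2).
    by rewrite mulr_gt0 // (lt_le_trans m00).
  rewrite mulr_sumr; apply: eq_bigr => s _; rewrite expr2 mulrA -Cy mulr_suml.
  by apply: eq_bigr => t _; ring.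
move=> u; rewrite opE //.
(* Writing Op for the operator, symmetry gives <Op f, z_j> = <f, Op z_j> = l_j <f, z_j> = 0. Hence
   Op f does not change when each outer b_s is replaced by its residual q_s, and sum_s <b_s, f> q_s
   = m f. *)
have cross j : \sum_s m * y s * ip (b s) (z j) = 0.
  have -> : \sum_s m * y s * ip (b s) (z j) = ip (fun u => \sum_s ip (b s) (z j) * b s u) f.
    by rewrite ip_suml //; apply: eq_bigr => s _; rewrite bf mulrC.
  rewrite (@ip_ae _ _ _ _ _ (fun u => l j * z j u)).
  - by rewrite ipZl // ipC fz mulr0.
  - by have [] := sqint_lincomb (index_enum 'I_M) (fun s => ip (b s) (z j)) bi.
  - by have [] := sqintZ (l j) (zi j).
  - by have [] := fi.
  by apply: filterS (zeig j) => x <-; rewrite opE.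
transitivity (\sum_s m * y s * (q s u + \sum_j ip (b s) (z j) * z j u)).
  by apply: eq_bigr => s _; rewrite bf /q /residual subrK.
under eq_bigr do rewrite mulrDr mulr_sumr.
rewrite big_split /= exchange_big /= [X in _ + X]big1 ?addr0.
  by rewrite mulr_sumr; apply: eq_bigr => s _; rewrite mulrA.
move=> j _; under eq_bigr do rewrite mulrA.
by rewrite -mulr_suml cross mul0r.
Qed.

End finite_rank_operators.

Section subspace_perturbation.
Context d (T : measurableType d) (R : realType).
Variable mu : {sigma_finite_measure set T -> \bar R}.
Local Notation sqint := (sqint mu).
Local Notation ip := (ip mu).
Local Notation KT := (KT mu).
Variables (I : Type) (s : seq I).

(* Integral operator with kernel sum_k int H_k(u, t) H_k(u', t) dt, the form of
   both K and its estimator; in operator terms sum_k KT(H_k)^* KT(H_k). *)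
Definition compop (H : I -> T -> T -> R) f u :=
  ip (fun u' => \sum_(k <- s) ip (H k u) (H k u')) f.

Lemma compopE H f u : (forall k, HSkernel mu (H k)) -> sqint f ->
  compop H f u = \sum_(k <- s) KT (fun u v => H k v u) (KT (H k) f) u.
Proof.
move=> HH fi; transitivity (ip (fun u' => \sum_(k <- s) 1 * ip (H k u) (H k u')) f).
  by apply: eq_Rintegral => u' _; under [in RHS]eq_bigr do rewrite mul1r.
rewrite (ip_suml _ (fun=> 1)) // => [|k]; last exact: sqint_composition.
by apply: eq_bigr => k _; rewrite mul1r ip_composition.
Qed.

Lemma ip_compop H f g : (forall k, HSkernel mu (H k)) -> sqint f -> sqint g ->
  ip (compop H f) g = \sum_(k <- s) ip (KT (H k) f) (KT (H k) g).
Proof.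
move=> HH fi gi.
rewrite (_ : compop H f = fun u => \sum_(k <- s) 1 * KT (fun u v => H k v u) (KT (H k) f) u).
  rewrite ip_suml //; last by move=> k; apply: KT_sqint; [exact: HSkernel_tr|exact: KT_sqint].
  apply: eq_bigr => k _; rewrite mul1r KT_adjoint //; first exact: HSkernel_tr.
  exact: KT_sqint.
by apply/funext => u; rewrite compopE //; apply: eq_bigr => k _; rewrite mul1r.
Qed.

Lemma compop_sqint H f : (forall k, HSkernel mu (H k)) -> sqint f -> sqint (compop H f).
Proof.
move=> HH fi; rewrite (_ : compop H f = fun u => \sum_(k <- s) KT (fun u v => H k v u) (KT (H k) f) u).
  by apply: sqint_sum => k; apply: KT_sqint; [exact: HSkernel_tr|exact: KT_sqint].
by apply/funext => u; rewrite compopE.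
Qed.

Variables (n N : nat) (phi psi z : 'I_n -> T -> R) (lam : 'I_n -> R).
Variables (G H : I -> T -> T -> R) (A : 'M[R]_N) (c : 'I_N -> T -> R).
Variables (th dl : R) (e : I -> R).
Hypotheses (GG : forall k, HSkernel mu (G k)) (HH : forall k, HSkernel mu (H k)).
Hypotheses (phiO : orthonormal mu phi) (psiO : orthonormal mu psi) (zO : orthonormal mu z).
Hypothesis Glow : forall (x : 'I_n -> R) (f := fun u => \sum_i x i * psi i u),
  th * \sum_i x i ^+ 2 <= \sum_(k <- s) ip (KT (G k) f) (KT (G k) f).
Hypothesis Gker : forall f, sqint f -> (forall j, ip f (phi j) = 0) ->
  forall k v, KT (G k) f v = 0.
Hypotheses (Asym : A^T = A)
  (Apsd : forall x : 'I_N -> R, 0 <= \sum_i \sum_j A i j * x i * x j)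
  (ci : forall i, sqint (c i)).
Hypothesis HA : forall f, sqint f -> forall u,
  compop H f u = \sum_i (\sum_k A i k * ip (c k) f) * c i u.
Hypothesis zeig : forall j, {ae mu, forall u, compop H (z j) u = lam j * z j u}.
Hypothesis ztop : forall m g, 0 < m -> sqint g -> (forall u, compop H g u = m * g u) ->
  ip g g != 0 -> (forall j, ip g (z j) = 0) -> forall j, m <= lam j.
Hypotheses (HSe : forall k, (HS mu (fun u v => H k u v - G k u v)%R <= (e k)%:E)%E)
  (e_dl : \sum_(k <- s) e k <= dl) (dl0 : 0 < dl) (th0 : 0 < th) (dl_th : dl <= th / 4).

Let ip_eig f j : sqint f -> ip (compop H (z j)) f = lam j * ip (z j) f.
Proof.
move=> fi; have [zi _] := zO; rewrite -ipZl //; apply: ip_ae (zeig j).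
- by have [] := compop_sqint HH (zi j).
- by have [] := sqintZ (lam j) (zi j).
- by have [] := fi.
Qed.

Let diff_bound f : sqint f ->
  \sum_(k <- s) ip (KT (fun u v => H k u v - G k u v) f) (KT (fun u v => H k u v - G k u v) f)
    <= dl * ip f f.
Proof.
move=> fi; apply: (@le_trans _ _ ((\sum_(k <- s) e k) * ip f f)); last first.
  by rewrite ler_wpM2r // ip_ge0.
rewrite mulr_suml; apply: ler_sum => k _; apply: KT_ip_bound => //.
exact: HSkernelB.
Qed.

(** Summing |G_k f|^2 <= 2 |H_k f|^2 + 2 |(H_k - G_k) f|^2 over k gives th <= 2 h + 2 dl for a unit
    [f], where h is the form of H at [f]; with dl <= th / 4 this leaves h >= th / 4. *)
Let lower_psi (x : 'I_n -> R) (f := fun u => \sum_i x i * psi i u) :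
  th / 4 * ip f f <= \sum_(k <- s) ip (KT (H k) f) (KT (H k) f).
Proof.
have [psii _] := psiO; have fi : sqint f by exact: sqint_lincomb.
have ff : ip f f = \sum_i x i ^+ 2 by exact: ip_lincomb_self.
have ff0 : 0 <= ip f f by exact: ip_ge0.
have low : th * ip f f <= \sum_(k <- s) ip (KT (G k) f) (KT (G k) f).
  by rewrite ff; exact: (Glow x).
have up := diff_bound fi.
have : \sum_(k <- s) ip (KT (G k) f) (KT (G k) f) <=
  2 * \sum_(k <- s) ip (KT (H k) f) (KT (H k) f) + 2 *
  \sum_(k <- s) ip (KT (fun u v => H k u v - G k u v) f) (KT (fun u v => H k u v - G k u v) f).
  rewrite !mulr_sumr -big_split; apply: ler_sum => k _ /=.
  have -> : KT (fun u v => H k u v - G k u v) f = (fun v => KT (H k) f v - KT (G k) f v).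
    by apply/funext => v; exact: KTBl.
  by apply: ip_triangle; exact: KT_sqint.
move: low up (ler_wpM2r ff0 dl_th).
move: (\sum_(k <- s) ip (KT (G k) f) (KT (G k) f)) => b.
move: (\sum_(k <- s) ip (KT (H k) f) (KT (H k) f)) => h.
move: (\sum_(k <- s) _) (ip f f) => a q; lra.
Qed.

Let compopC f g : sqint f -> sqint g -> ip (compop H f) g = ip (compop H g) f.
Proof. by move=> fi gi; rewrite (ip_compop HH fi gi) (ip_compop HH gi fi); apply: eq_bigr => k _; rewrite ipC. Qed.

(* Some v in span(psi) is orthogonal to every z_j with j <> j0. Were lam j0 < th/4,
   the residual of v modulo span(z) would have Rayleigh quotient at least th/4,
   hence there would be an eigenfunction orthogonal to all z_j with eigenvalue at
   least th/4, contradicting the maximality of lam. *)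
Let eigenvalue_lower_bound j0 : th / 4 <= lam j0.
Proof.
have [psii _] := psiO; have [zi zo] := zO.
rewrite leNgt; apply/negP => lt.
pose B : 'M[R]_(n, n.-1) := \matrix_(i, k) ip (psi i) (z (lift j0 k)).
have n0 : (n.-1 < n)%N by rewrite prednK // (leq_ltn_trans _ (ltn_ord j0)).
have [x [i0 x0] xB] := exists_orthogonal_combination B n0.
pose v u := \sum_i x i * psi i u.
have vi : sqint v by exact: sqint_lincomb.
have vv : 0 < ip v v.
  rewrite ip_lincomb_self // (bigD1 i0) //= ltr_pwDl //.
    by rewrite lt_neqAle eq_sym sqrf_eq0 x0 sqr_ge0.
  by apply: sumr_ge0 => i _; exact: sqr_ge0.
have vz j : j != j0 -> ip v (z j) = 0.
  case: (unliftP j0 j) => [k ->|->]; last by rewrite eqxx.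
  move=> _; rewrite ip_suml // -[RHS](xB k); apply: eq_bigr => i _.
  by rewrite mxE.
pose al := ip v (z j0).
pose w := residual mu z v.
have wi : sqint w by exact: sqint_residual.
have wz j : ip w (z j) = 0 by exact: residual_orthogonal.
have wE : w = fun u => v u - al * z j0 u.
  apply/funext => u; rewrite /w /residual (bigD1 j0) //= big1 ?addr0 // => j jj.
  by rewrite vz // mul0r.
have ww : ip w w = ip v v - al ^+ 2.
  rewrite ip_residual_self // (bigD1 j0) //= big1 ?addr0 // => j jj.
  by rewrite vz // expr0n.
have azi := sqintZ al (zi j0).
have Kwi := compop_sqint HH wi; have Kvi := compop_sqint HH vi.
have QwE f : sqint f -> ip f w = ip f v - al * ip f (z j0).
  by move=> fi; rewrite wE ipBr // ipZr.
have Qw : ip (compop H w) w = ip (compop H v) v - al ^+ 2 * lam j0.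
  rewrite QwE // (compopC wi (zi j0)) ip_eig // (ipC _ (z j0)) wz !mulr0 subr0.
  rewrite (compopC wi vi) QwE // (compopC vi (zi j0)) ip_eig // (ipC _ (z j0)) -/al.
  ring.
(* Passing from v to w lowers the form by al^2 lam_j0 and the squared norm by al^2, so with lam_j0 <
   th / 4 the Rayleigh quotient stays at least th / 4. *)
have Qlow : th / 4 * ip w w + al ^+ 2 * (th / 4 - lam j0) <= ip (compop H w) w.
  have low : th / 4 * ip v v <= ip (compop H v) v.
    by rewrite ip_compop //; exact: (lower_psi x).
  rewrite Qw ww; lra.
have al2 : 0 <= al ^+ 2 by exact: sqr_ge0.
(* If w were null, [Qlow] would force al = 0, and then v would be null as well. *)
have w0 : 0 < ip w w.
  rewrite lt_neqAle ip_ge0 andbT eq_sym; apply/eqP => wn.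
  move: Qlow; rewrite ipC (ip_null wi Kwi wn) wn mulr0 add0r => a0.
  have : al ^+ 2 <= 0 by move: a0; rewrite pmulr_lle0 // subr_gt0.
  by move=> a1; move: ww; rewrite wn; lra.
have th4 : 0 < th / 4 by rewrite divr_gt0.
have [j||m [f [m0 fi fz ff fe]]] := finite_rank_eigenfunction (z := z) (l := lam)
    Asym Apsd ci zO _ wi wz w0 th4.
- by apply: filterS (zeig j) => u <-; rewrite HA.
- rewrite (le_trans _ (_ : ip (compop H w) w <= _)) //.
    by rewrite (le_trans _ Qlow) // lerDl mulr_ge0 // subr_ge0 ltW.
  rewrite (_ : compop H w = fun u => \sum_i (\sum_k A i k * ip (c k) w) * c i u); last first.
    by apply/funext => u; rewrite HA.
  rewrite ip_suml //; apply: ler_sum => i _; rewrite mulr_suml.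
  by apply: ler_sum => k _; rewrite mulrAC.
have fall u : compop H f u = m * f u by rewrite HA.
have := ztop (lt_le_trans th4 m0) fi fall (lt0r_neq0 ff) fz j0.
by rewrite leNgt (lt_le_trans lt).
Qed.

(* The residual r of z_j modulo span(phi) is annihilated by the G_k, so
   lam_j |r|^2 = sum_k <H_k z_j, H_k r> <= sqrt(lam_j) sqrt(dl) |r|. *)
Lemma eigenspace_residual_bound j :
  1 - \sum_k ip (phi k) (z j) ^+ 2 <= 4 * dl / th.
Proof.
have [zi zo] := zO; have [phii _] := phiO.
pose r := residual mu phi (z j).
have ri : sqint r by exact: sqint_residual.
have rr : ip r r = 1 - \sum_k ip (phi k) (z j) ^+ 2.
  rewrite ip_residual_self // zo eqxx; congr (_ - _).
  by apply: eq_bigr => k _; rewrite ipC.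
have rz : ip (z j) r = ip r r.
  by rewrite [RHS]ip_residual // => k; exact: residual_orthogonal.
have r0 k : KT (fun u v => H k u v - G k u v) r = KT (H k) r.
  apply/funext => v; rewrite KTBl // Gker ?subr0 // => i.
  exact: residual_orthogonal.
have Qr : \sum_(k <- s) ip (KT (H k) r) (KT (H k) r) <= dl * ip r r.
  by have := diff_bound ri; under eq_bigr do rewrite r0.
have Qz : \sum_(k <- s) ip (KT (H k) (z j)) (KT (H k) (z j)) = lam j.
  by rewrite -ip_compop // ip_eig // zo eqxx mulr1.
have Qzr : \sum_(k <- s) ip (KT (H k) (z j)) (KT (H k) r) = lam j * ip r r.
  by rewrite -ip_compop // ip_eig // rz.
have lamj := eigenvalue_lower_bound j.
have lam0 : 0 < lam j by rewrite (lt_le_trans _ lamj) // divr_gt0.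
(* Cauchy-Schwarz over k in the form sum_k |H_k z_j - t H_k r|^2 >= 0. The choice t = lam_j / dl
   below yields lam_j |r|^2 <= dl at once, without square roots. *)
have quad t : 0 <= lam j - 2 * t * (lam j * ip r r) + t ^+ 2 * (dl * ip r r).
  have : 0 <= \sum_(k <- s) ip (fun v => KT (H k) (z j) v - t * KT (H k) r v)
      (fun v => KT (H k) (z j) v - t * KT (H k) r v).
    by apply: sumr_ge0 => k _; exact: ip_ge0.
  have -> : \sum_(k <- s) ip (fun v => KT (H k) (z j) v - t * KT (H k) r v)
      (fun v => KT (H k) (z j) v - t * KT (H k) r v) =
    lam j - 2 * t * (lam j * ip r r) + t ^+ 2 *
    \sum_(k <- s) ip (KT (H k) r) (KT (H k) r).
    rewrite -Qzr -[in RHS]Qz !mulr_sumr -sumrB -big_split; apply: eq_bigr => k _ /=.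
    have Hz := KT_sqint (HH k) (zi j); have Hr := KT_sqint (HH k) ri.
    have tHr := sqintZ t Hr; have dHi := sqintB Hz tHr.
    rewrite !(ipBl, ipBr, ipZl, ipZr) //.
    by rewrite (ipC _ (KT (H k) r) (KT (H k) (z j))); ring.
  by move=> /le_trans; apply; rewrite lerD2l ler_wpM2l // sqr_ge0.
rewrite -rr.
have := quad (lam j / dl).
have -> : lam j - 2 * (lam j / dl) * (lam j * ip r r) + (lam j / dl) ^+ 2 * (dl * ip r r)
  = lam j * (1 - lam j * ip r r / dl) by field; exact: lt0r_neq0.
rewrite pmulr_rge0 // subr_ge0 ler_pdivrMr // mul1r => lr.
rewrite ler_pdivlMr //; have := ip_ge0 mu r.
have : th / 4 * ip r r <= lam j * ip r r by rewrite ler_wpM2r // ip_ge0.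
lra.
Qed.

End subspace_perturbation.

(** * Covariance inequalities under mixing *)

Section integral_comparison.
Local Open Scope ereal_scope.
Context d (T : measurableType d) (R : realType) (mu : {measure set T -> \bar R}).

Import HBNNSimple.

Lemma integral_nnsfun_comp (f : {nnsfun (measurableTypeR R) >-> R}) (Z W : T -> R) :
  measurable_fun setT Z -> measurable_fun setT W -> (forall w, 0 <= W w)%R ->
  \int[mu]_w (f (Z w) * W w)%:E =
  \sum_(r \in range f) (r%:E * \int[mu]_w (\1_(f @^-1` [set r]) (Z w) * W w)%:E).
Proof.
move=> mZ mW W0.
have m1 r : measurable_fun setT (fun w => (\1_(f @^-1` [set r]) (Z w) * W w)%R%:E).
  apply/measurable_EFinP; apply: measurable_funM => //.
  have mr : measurable (f @^-1` [set r]) by exact: measurable_sfunP.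
  exact: (measurableT_comp (measurable_indic (R := R) mr) mZ).
have i0 r w : 0 <= (r * (\1_(f @^-1` [set r]) (Z w) * W w))%:E.
  rewrite mulrA EFinM mule_ge0 //; last by rewrite lee_fin.
  by rewrite EFinM nnfun_muleindic_ge0.
transitivity (\int[mu]_w (\sum_(r \in range f) (r * (\1_(f @^-1` [set r]) (Z w) * W w))%:E)).
  apply: eq_integral => w _; rewrite fimfunE fsumEFin //; congr EFin.
  rewrite mulrC mulr_fsumr.
  by apply: eq_fsbigr => r _; rewrite mulrCA (mulrC (W w)).
rewrite ge0_integral_fsum //.
- apply: eq_fsbigr => r; rewrite inE => -[x _ <-].
  under eq_integral do rewrite EFinM.
  rewrite ge0_integralZl // ?lee_fin // => w _.
  by rewrite lee_fin mulr_ge0 // indicE.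
- by move=> r; under eq_fun do rewrite EFinM; exact: measurable_funeM.
Qed.

(** Indicators, then simple functions, then monotone convergence. The weights [W] and [W'] allow a
    bilinear inequality to be extended one variable at a time, the other factor being kept as
    weight. *)
Lemma le_integral_of_preimages (Z Z' W W' : T -> R) :
  measurable_fun setT Z -> measurable_fun setT Z' ->
  measurable_fun setT W -> measurable_fun setT W' ->
  (forall w, 0 <= W w)%R -> (forall w, 0 <= W' w)%R ->
  (forall B : set R, measurable B ->
    \int[mu]_w (\1_B (Z w) * W w)%:E <= \int[mu]_w (\1_B (Z' w) * W' w)%:E) ->
  forall f : R -> R, measurable_fun setT f -> (forall x, 0 <= f x)%R ->
    \int[mu]_w (f (Z w) * W w)%:E <= \int[mu]_w (f (Z' w) * W' w)%:E.
Proof.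
move=> mZ mZ' mW mW' W0 W0' H f mf f0.
have mEf : measurable_fun setT (EFin \o f) by exact/measurable_EFinP.
pose g := nnsfun_approx (measurableT : measurable (setT : set (measurableTypeR R))) mEf.
have main (Y V : T -> R) : measurable_fun setT Y ->
    measurable_fun setT V -> (forall w, 0 <= V w)%R ->
    \int[mu]_w (g n (Y w) * V w)%:E @[n --> \oo] --> \int[mu]_w (f (Y w) * V w)%:E.
  move=> mY mV V0.
  have -> : \int[mu]_w (f (Y w) * V w)%:E =
      \int[mu]_w (limn (fun n => (g n (Y w) * V w)%:E)).
    apply: eq_integral => w _; apply/esym/cvg_lim => //.
    under eq_fun do rewrite EFinM; rewrite EFinM; apply: cvgeZr => //.
    by apply: cvg_nnsfun_approx => // x _; rewrite lee_fin.
  apply: cvg_monotone_convergence => //.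
  - move=> n; apply/measurable_EFinP; apply: measurable_funM => //.
    have mg : measurable_fun (setT : set (measurableTypeR R)) (g n) by [].
    exact: (measurableT_comp mg mY).
  - by move=> n w _; rewrite lee_fin mulr_ge0.
  - move=> w _ m n mn; rewrite lee_fin ler_wpM2r //.
    by have /lefP := nd_nnsfun_approx (measurableT : measurable (setT : set (measurableTypeR R))) mEf mn; exact.
apply: lee_cvg_to (main _ _ mZ mW W0) (main _ _ mZ' mW' W0') _.
apply: nearW => n; rewrite !integral_nnsfun_comp //.
apply: lee_fsum => //.
move=> r [x _ <-]; apply: lee_wpmul2l; rewrite ?lee_fin //.
have mr : measurable (g n @^-1` [set g n x]) by exact: measurable_sfunP.
exact: H.
Qed.

End integral_comparison.

Section mixing_covariance.
Context d (T : measurableType d) (R : realType) (P : probability T R).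
Local Notation rintegrable := (rintegrable P).
Local Notation ip := (ip P).
Local Notation sqint := (sqint P).

Definition prb (A : set T) : R := fine (P A).

Lemma EFin_prb A : measurable A -> (prb A)%:E = P A.
Proof. by move=> mA; rewrite fineK // fin_num_measure. Qed.

(* The psi-mixing inequality multiplied out, so that null events need no exception. *)
Definition mixpair (c : R) (xi eta : T -> R) := forall A B : set R,
  measurable A -> measurable B ->
  `|prb (xi @^-1` A `&` eta @^-1` B) - prb (xi @^-1` A) * prb (eta @^-1` B)|
    <= c * (prb (xi @^-1` A) * prb (eta @^-1` B)).

Lemma integral_indic_comp (xi eta : T -> R) (A B : set R) : measurable_fun setT xi ->
  measurable_fun setT eta -> measurable A -> measurable B ->
  (\int[P]_w (\1_A (xi w) * \1_B (eta w))%:E = (prb (xi @^-1` A `&` eta @^-1` B))%:E)%E.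
Proof.
move=> mx me mA mB.
have mAB : measurable (xi @^-1` A `&` eta @^-1` B).
  apply: measurableI; first by rewrite -[X in measurable X]setTI; exact: mx.
  by rewrite -[X in measurable X]setTI; exact: me.
rewrite EFin_prb // -[in RHS](setIT (_ `&` _)) -(integral_indic P measurableT) //.
by apply: eq_integral => w _; rewrite !indicE in_setI -natrM mulnb.
Qed.

Lemma integral_indic_comp1 (eta : T -> R) (B : set R) : 
  measurable_fun setT eta -> measurable B ->
  (\int[P]_w (\1_B (eta w))%:E = (prb (eta @^-1` B))%:E)%E.
Proof.
move=> me mB; rewrite -[X in prb X]setIT.
rewrite -[X in prb (_ `&` X)](preimage_setT eta) -integral_indic_comp //.
by apply: eq_integral => w _; rewrite [in RHS]indicT mulr1.
Qed.

Variables (c : R) (xi eta : T -> R).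
Hypotheses (c0 : 0 <= c) (mx : measurable_fun setT xi) (me : measurable_fun setT eta).
Hypothesis mix : mixpair c xi eta.

(** [mix] is extended from events to functions in two passes, first in xi with the event for eta
    fixed, then in eta. The lower estimate is rearranged as F G <= E[f g] + c F G, so that both
    sides are integrals of nonnegative functions. The upper one also provides the integrability of
    the product. *)
Let ge0_covariance_mixing (f g : R -> R) : measurable_fun setT f -> measurable_fun setT g ->
  (forall x, 0 <= f x) -> (forall x, 0 <= g x) ->
  rintegrable (f \o xi) -> rintegrable (g \o eta) ->
  rintegrable (fun w => f (xi w) * g (eta w)) /\
  `|\int[P]_w (f (xi w) * g (eta w)) - (\int[P]_w f (xi w)) * \int[P]_w g (eta w)|
   <= c * ((\int[P]_w f (xi w)) * \int[P]_w g (eta w)).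
Proof.
move=> mf mg f0 g0 fi gi.
set F := \int[P]_w f (xi w); set G := \int[P]_w g (eta w).
have mfx := measurableT_comp mf mx; have mge := measurableT_comp mg me.
have F0 : 0 <= F by apply: Rintegral_ge0 => w _.
have G0 : 0 <= G by apply: Rintegral_ge0 => w _.
have EF : (\int[P]_w (f (xi w))%:E = F%:E)%E by rewrite (EFin_Rintegral fi).
have EG : (\int[P]_w (g (eta w))%:E = G%:E)%E by rewrite (EFin_Rintegral gi).
have ind0 (B : set R) x : 0 <= (\1_B x : R) by rewrite indicE.
have mI (B : set R) (mB : measurable B) : measurable_fun setT (fun w => \1_B (eta w) : R).
  exact: (measurableT_comp (measurable_indic mB) me).
have mIx (B : set R) (mB : measurable B) : measurable_fun setT (fun w => \1_B (xi w) : R).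
  exact: (measurableT_comp (measurable_indic mB) mx).
have intZ (h : T -> R) (k : R) : measurable_fun setT h -> (forall w, 0 <= h w) -> 0 <= k ->
    (\int[P]_w (h w * k)%:E = \int[P]_w (h w)%:E * k%:E)%E.
  move=> mh h0 k0; under eq_integral do rewrite EFinM.
  rewrite ge0_integralZr // ?lee_fin //; first exact/measurable_EFinP.
  by move=> w _; rewrite lee_fin.
have intMD (h a b : T -> R) : measurable_fun setT h -> measurable_fun setT a ->
    measurable_fun setT b -> (forall w, 0 <= h w) -> (forall w, 0 <= a w) -> (forall w, 0 <= b w) ->
    (\int[P]_w (h w * (a w + b w))%:E = \int[P]_w (h w * a w)%:E + \int[P]_w (h w * b w)%:E)%E.
  move=> mh ma mb h0 a0 b0; under eq_integral do rewrite mulrDr EFinD.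
  rewrite ge0_integralD // => [w _||w _|]; try by rewrite lee_fin mulr_ge0.
    by apply/measurable_EFinP; exact: measurable_funM.
  by apply/measurable_EFinP; exact: measurable_funM.
have p0 (A : set T) : 0 <= prb A by rewrite fine_ge0.
have upper : (\int[P]_w (f (xi w) * g (eta w))%:E <= ((1 + c) * (F * G))%:E)%E.
  have step1 B : measurable B ->
      (\int[P]_w (f (xi w) * \1_B (eta w))%:E <=
       \int[P]_w (f (xi w) * ((1 + c) * prb (eta @^-1` B)))%:E)%E.
    move=> mB; apply: le_integral_of_preimages => //; first exact: mI.
      by move=> _; rewrite mulr_ge0 // addr_ge0.
    move=> A mA; rewrite integral_indic_comp // intZ //; last 2 first.
    - exact: mIx.
    - by rewrite mulr_ge0 // addr_ge0.
    rewrite integral_indic_comp1 // -EFinM lee_fin.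
    have := mix mA mB; rewrite ler_norml => /andP[_]; lra.
  have step2 : (\int[P]_w (g (eta w) * f (xi w))%:E <=
      \int[P]_w (g (eta w) * ((1 + c) * F))%:E)%E.
    apply: le_integral_of_preimages => //.
      by move=> _; rewrite mulr_ge0 // addr_ge0.
    move=> B mB; under eq_integral do rewrite mulrC.
    apply: le_trans (step1 _ mB) _.
    have cp : 0 <= (1 + c) * prb (eta @^-1` B) by rewrite mulr_ge0 // addr_ge0.
    have cF : 0 <= (1 + c) * F by rewrite mulr_ge0 // addr_ge0.
    rewrite !intZ //; last exact: mI.
    by rewrite integral_indic_comp1 // EF -!EFinM lee_fin; lra.
  under eq_integral do rewrite mulrC.
  apply: le_trans step2 _; rewrite intZ //; last by rewrite mulr_ge0 // addr_ge0.
  by rewrite EG -EFinM lee_fin; lra.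
have fgi : rintegrable (fun w => f (xi w) * g (eta w)).
  apply: ge0_rintegrable => [|w|]; [exact: measurable_funM|exact: mulr_ge0|].
  by rewrite (le_lt_trans upper) // ltry.
split => //; set FG := \int[P]_w _.
have lower : F * G <= FG + c * F * G.
  have step1 B : measurable B ->
      (\int[P]_w (f (xi w) * prb (eta @^-1` B))%:E <=
       \int[P]_w (f (xi w) * (\1_B (eta w) + c * prb (eta @^-1` B)))%:E)%E.
    move=> mB; apply: le_integral_of_preimages => //.
    - by apply: measurable_funD => //; exact: mI.
    - by move=> w; rewrite addr_ge0 // mulr_ge0.
    move=> A mA; rewrite intZ //; last exact: mIx.
    rewrite intMD => //; [|exact: mIx|exact: mI|by move=> _; exact: mulr_ge0].
    rewrite integral_indic_comp // intZ //; last 2 first.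
    - exact: mIx.
    - by rewrite mulr_ge0.
    rewrite integral_indic_comp1 // -!EFinM -EFinD lee_fin.
    have := mix mA mB; rewrite ler_norml => /andP[+ _]; lra.
  have step2 : (\int[P]_w (g (eta w) * F)%:E <=
      \int[P]_w (g (eta w) * (f (xi w) + c * F))%:E)%E.
    apply: le_integral_of_preimages => //.
    - by apply: measurable_funD.
    - by move=> w; rewrite addr_ge0 // mulr_ge0.
    move=> B mB; rewrite intZ //; last exact: mI.
    rewrite integral_indic_comp1 // -EFinM.
    have := step1 _ mB; rewrite intZ // EF -EFinM [in X in X -> _]mulrC => /le_trans; apply.
    have cp : 0 <= c * prb (eta @^-1` B) by rewrite mulr_ge0.
    have cF : 0 <= c * F by rewrite mulr_ge0.
    rewrite intMD => //; last exact: mI.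
    rewrite [leRHS]intMD => //; last exact: mI.
    rewrite leeD //; first by under eq_integral do rewrite mulrC.
    rewrite !intZ //; last exact: mI.
    by rewrite EF integral_indic_comp1 // -!EFinM lee_fin; lra.
  move: step2; rewrite intZ // EG.
  have cF : 0 <= c * F by rewrite mulr_ge0.
  rewrite intMD //.
  under [X in (_ <= X + _)%E -> _]eq_integral do rewrite mulrC.
  by rewrite -(EFin_Rintegral fgi) -/FG intZ // EG -!EFinM -EFinD lee_fin; lra.
rewrite ler_norml; apply/andP; split; first by lra.
by move: upper; rewrite -(EFin_Rintegral fgi) -/FG lee_fin; lra.
Qed.

(** Positive and negative parts give four bounds, which add up to c E|xi| E|eta| because E|xi| is
    the sum of the expectations of the two parts. *)
Lemma covariance_mixing : rintegrable xi -> rintegrable eta ->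
  rintegrable (fun w => xi w * eta w) ->
  `|\int[P]_w (xi w * eta w) - (\int[P]_w xi w) * \int[P]_w eta w|
   <= c * ((\int[P]_w `|xi w|) * \int[P]_w `|eta w|).
Proof.
move=> xii ei xei.
pose p (x : R) := Num.max x 0; pose n (x : R) := Num.max (- x) 0.
have mp : measurable_fun setT p by exact: measurable_maxr.
have mn : measurable_fun setT n.
  by apply: measurable_maxr => //; exact: measurable_funN.
have p0 x : 0 <= p x by rewrite le_max lexx orbT.
have n0 x : 0 <= n x by rewrite le_max lexx orbT.
have pnB x : x = p x - n x.
  by rewrite /p /n; case: (leP x 0); case: (leP (- x) 0); lra.
have pnD x : `|x| = p x + n x.
  rewrite /p /n; case: (ger0P x) => x0; case: (leP x 0); case: (leP (- x) 0); lra.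
have pi z : rintegrable z -> rintegrable (p \o z).
  move=> zi; apply: rintegrable_le (rintegrable_abs zi).
    exact: (measurableT_comp mp (rintegrable_measurable zi)).
  by move=> x; rewrite ger0_norm //= pnD lerDl.
have ni z : rintegrable z -> rintegrable (n \o z).
  move=> zi; apply: rintegrable_le (rintegrable_abs zi).
    exact: (measurableT_comp mn (rintegrable_measurable zi)).
  by move=> x; rewrite ger0_norm //= pnD lerDr.
have [i1 b1] := ge0_covariance_mixing mp mp p0 p0 (pi _ xii) (pi _ ei).
have [i2 b2] := ge0_covariance_mixing mp mn p0 n0 (pi _ xii) (ni _ ei).
have [i3 b3] := ge0_covariance_mixing mn mp n0 p0 (ni _ xii) (pi _ ei).
have [i4 b4] := ge0_covariance_mixing mn mn n0 n0 (ni _ xii) (ni _ ei).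
have E1 z : rintegrable z -> \int[P]_w z w = \int[P]_w p (z w) - \int[P]_w n (z w).
  move=> zi; rewrite -RintegralB //; [|exact: pi|exact: ni].
  by apply: eq_Rintegral => w _; exact: pnB.
have E2 z : rintegrable z -> \int[P]_w `|z w| = \int[P]_w p (z w) + \int[P]_w n (z w).
  move=> zi; rewrite -RintegralD //; [|exact: pi|exact: ni].
  by apply: eq_Rintegral => w _; exact: pnD.
have E4 : \int[P]_w (xi w * eta w) = \int[P]_w (p (xi w) * p (eta w))
    - \int[P]_w (p (xi w) * n (eta w)) - \int[P]_w (n (xi w) * p (eta w))
    + \int[P]_w (n (xi w) * n (eta w)).
  rewrite -RintegralB // -RintegralB //; last exact: rintegrableB.
  rewrite -RintegralD //; last by apply: rintegrableB => //; exact: rintegrableB.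
  by apply: eq_Rintegral => w _; rewrite {1}[xi w]pnB {1}[eta w]pnB; ring.
rewrite (E1 _ xii) (E1 _ ei) (E2 _ xii) (E2 _ ei) E4.
move: b1 b2 b3 b4; rewrite !ler_norml.
do 4 move: (\int[P]_w (_ * _)) => ?.
move=> /andP[? ?] /andP[? ?] /andP[? ?] /andP[? ?].
by apply/andP; split; lra.
Qed.

End mixing_covariance.

(** For a fixed [i], each distance l is attained at most twice, at i + l and at i - l. *)
Lemma sum_distance_le (R : realDomainType) (m i : nat) (b : nat -> R) :
  (i < m)%N -> (forall l, 0 <= b l) ->
  \sum_(j < m) b (maxn i j - minn i j)%N <= 2 * \sum_(l < m) b l.
Proof.
move=> im b0.
apply: (@le_trans _ _ (\sum_(j < m) \sum_(l < m)
    b l * (((j == i + l :> nat)%N + (i == j + l :> nat)%N)%N)%:R)).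
  apply: ler_sum => j _.
  have lm : (maxn i j - minn i j < m)%N.
    by rewrite ltn_subLR; have := ltn_ord j; case: (leqP i j); lia.
  rewrite (bigD1 (Ordinal lm)) //= -[leLHS]addr0 lerD //; last first.
    by apply: sumr_ge0 => l _; rewrite mulr_ge0 // ler0n.
  rewrite -[leLHS]mulr1 ler_wpM2l // ler1n.
  by have [ij|ij] := leqP i j; rewrite ?(subnKC ij) ?eqxx // (subnKC (ltnW ij)) eqxx addn1.
rewrite exchange_big mulr_sumr /=; apply: ler_sum => l _.
rewrite -mulr_sumr mulrC ler_wpM2r // -natr_sum ler_nat big_split /=.
have one (Q : pred nat) : (forall x y, Q x -> Q y -> x = y) -> (\sum_(j < m) Q j <= 1)%N.
  move=> Qu; have [/existsP[j0 Qj]|/existsPn Qn] := boolP [exists j : 'I_m, Q j].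
    rewrite (bigD1 j0) //= big1 ?addn0 ?leq_b1 // => j jj.
    by case Qj' : (Q j) => //; move: jj; rewrite -val_eqE /= (Qu _ _ Qj' Qj) eqxx.
  by rewrite big1 // => j _; rewrite (negbTE (Qn j)).
apply: (@leq_add _ _ 1 1); first by apply: (one (fun j => j == i + l)%N) => x y /eqP-> /eqP->.
by apply: (one (fun j => i == j + l)%N) => x y /eqP xE /eqP yE; lia.
Qed.

Section variance_of_sums.
Context d (T : measurableType d) (R : realType) (P : probability T R).
Local Notation ip := (ip P).
Local Notation sqint := (sqint P).

Lemma sqint_cst (r : R) : sqint (fun=> r).
Proof.
split; first exact: measurable_cst.
by apply: finite_measure_integrable_cst.
Qed.

Lemma sqint_rintegrable (f : T -> R) : sqint f -> rintegrable P f.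
Proof.
move=> fi; apply: eq_integrable (sqintM fi (sqint_cst 1)) => // x _.
by rewrite /= mulr1.
Qed.

Lemma ip_cst (f : T -> R) (r : R) : sqint f -> ip f (fun=> r) = r * \int[P]_w f w.
Proof.
move=> fi; rewrite -RintegralZl //; last exact: sqint_rintegrable.
by apply: eq_Rintegral => w _; rewrite mulrC.
Qed.

Lemma ip_cst_cst (r : R) : ip (fun=> r) (fun=> r) = r ^+ 2.
Proof.
rewrite /ip Rintegral_cst // (_ : fine _ = 1) ?mulr1 //.
exact: (congr1 fine (probability_setT P)).
Qed.

(* Pairs at distance at most k are bounded by Cauchy-Schwarz, the others by mixing. *)
Lemma variance_sum_mixing (xi : nat -> T -> R) (k m : nat) (c : nat -> R) (g q S : R) :
  (forall i, sqint (xi i)) -> (forall i, \int[P]_w xi i w = g) ->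
  (forall i, ip (xi i) (xi i) = q) -> (forall l, 0 <= c l) ->
  (forall i j, (i + k < j)%N -> mixpair P (c (j - i - k)%N) (xi i) (xi j)) ->
  (forall N, \sum_(1 <= l < N) c l <= S) ->
  let s w := \sum_(i < m) (xi i w - g) in
  ip s s <= m%:R * (2 * (k.+1%:R + S)) * q.
Proof.
move=> xii xig xiq c0 mixc cS /=.
pose z i w := xi i w - g.
have zi i : sqint (z i) by apply: sqintB => //; exact: sqint_cst.
have zz i j : ip (z i) (z j) = ip (xi i) (xi j) - g ^+ 2.
  have gi := sqint_cst g; rewrite ipBl // !ipBr // (ipC _ (fun=> g) (xi j)) ip_cst_cst !ip_cst // !xig.
  ring.
have q0 : 0 <= q by rewrite -(xiq 0%N) ip_ge0.
have zq i : ip (z i) (z i) <= q by rewrite zz xiq lerBlDr lerDl sqr_ge0.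
(* In the application xi_i depends on times i and i + k, so at lag l > k the two time windows are l
   - k apart. *)
pose b l := if (l <= k)%N then 1 else c (l - k)%N.
have b0 l : 0 <= b l by rewrite /b; case: ifP.
have far i j : (i + k < j)%N -> `|ip (z i) (z j)| <= c (j - i - k)%N * q.
  move=> ikj; rewrite zz.
  have := covariance_mixing (c0 _) (proj1 (xii i)) (proj1 (xii j)) (mixc _ _ ikj)
    (sqint_rintegrable (xii i)) (sqint_rintegrable (xii j)) (sqintM (xii i) (xii j)).
  rewrite !xig -expr2 => /le_trans; apply; rewrite ler_wpM2l //.
  have A l : 0 <= \int[P]_w `|xi l w| by apply: Rintegral_ge0.
  have B l : (\int[P]_w `|xi l w|) ^+ 2 <= q.
    have ai : sqint (fun w => `|xi l w|).
      split; first by apply: measurableT_comp => //; have [] := xii l.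
      by have [_] := xii l; apply: eq_integrable => // w _; rewrite /= real_normK ?num_real.
    have := ip_CauchySchwarz ai (sqint_cst 1).
    rewrite ip_cst // mul1r ip_cst_cst expr1n mulr1 => /le_trans; apply.
    rewrite -(xiq l) !ipE2; apply: le_Rintegral => //.
    - by have [] := ai.
    - by have [] := xii l.
    - by move=> w _; rewrite real_normK ?num_real.
  have := B i; have := B j; have := sqr_ge0 (\int[P]_w `|xi i w| - \int[P]_w `|xi j w|).
  by rewrite sqrrB; lra.
have near i j : `|ip (z i) (z j)| <= q.
  rewrite -(ler_pXn2r (ltn0Sn 1)) ?nnegrE // real_normK ?num_real //.
  rewrite (le_trans (ip_CauchySchwarz (zi i) (zi j))) // expr2.
  by apply: ler_pM => //; exact: ip_ge0.
have bound (i j : nat) : ip (z i) (z j) <= b (maxn i j - minn i j)%N * q.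
  rewrite (le_trans (ler_norm _)) // /b; case: ifP => [_|]; first by rewrite mul1r.
  by have [ij|ij] := leqP i j; move=> /negbT kij; [|rewrite ipC]; apply: far; lia.
have -> : ip (fun w => \sum_(i < m) z i w) (fun w => \sum_(i < m) z i w) =
    \sum_(i < m) \sum_(j < m) ip (z i) (z j).
  have H1 : (fun w => \sum_(i < m) z i w) = (fun w => \sum_(i < m) 1 * z i w).
    by apply/funext => w; apply: eq_bigr => i _; rewrite mul1r.
  rewrite {1}H1 (ip_suml _ (fun=> 1)) // => [|]; last by apply: sqint_sum.
  apply: eq_bigr => i _; rewrite mul1r H1 (ip_sumr _ (fun=> 1)) //.
  by apply: eq_bigr => j _; rewrite mul1r.
have bS : \sum_(l < m) b l <= k.+1%:R + S.
  have S0 : 0 <= S by have := cS 0%N; rewrite big_geq.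
  rewrite -(big_mkord xpredT).
  have [mk|km] := leqP m k.+1.
    rewrite -[leLHS]addr0 lerD //.
    apply: (@le_trans _ _ (\sum_(0 <= l < m) 1)).
      rewrite big_seq [leRHS]big_seq; apply: ler_sum => l; rewrite mem_index_iota => /andP[_ lm].
      by rewrite /b ifT //; lia.
    by rewrite big_const_nat subn0 iter_addr_0 ler_nat.
  rewrite (big_cat_nat (n := k.+1)) //=; last exact: ltnW.
  apply: lerD.
    rewrite -[leRHS]mulr1 mulrC -[k.+1 in leRHS]subn0 mulr_natr -sumr_const_nat.
    rewrite big_seq [leRHS]big_seq; apply: ler_sum => l; rewrite mem_index_iota => /andP[_ lm].
    by rewrite /b ifT.
  rewrite (le_trans _ (cS (m - k)%N)) // -{1}[k.+1]add1n big_addn.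
  rewrite big_seq [leRHS]big_seq; apply: ler_sum => l; rewrite mem_index_iota => /andP[l1 lm].
  by rewrite /b ifF ?addnK //; lia.
apply: (@le_trans _ _ (\sum_(i < m) 2 * (k.+1%:R + S) * q)); last first.
  by rewrite sumr_const card_ord -[leLHS]mulr_natl mulrA.
apply: ler_sum => i _.
apply: (@le_trans _ _ (\sum_(j < m) b (maxn i j - minn i j)%N * q)).
  by apply: ler_sum => j _; exact: bound.
rewrite -mulr_suml ler_wpM2r // (le_trans (sum_distance_le (ltn_ord i) b0)) //.
by rewrite ler_wpM2l.
Qed.

End variance_of_sums.

(** Uniqueness of measures on the pi-system of rectangles, for the laws of the two pairs under P
    restricted to [E] and to [E']. Keeping an event [E] in the statement makes it possible to treat
    two pairs one after the other. *)
Lemma eq_probability_pair d (T : measurableType d) (R : realType) (P : probability T R)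
    (X1 X2 X1' X2' : T -> R) (E E' : set T) :
  measurable_fun setT X1 -> measurable_fun setT X2 ->
  measurable_fun setT X1' -> measurable_fun setT X2' -> measurable E -> measurable E' ->
  (forall A B : set R, measurable A -> measurable B ->
    P (X1 @^-1` A `&` X2 @^-1` B `&` E) = P (X1' @^-1` A `&` X2' @^-1` B `&` E')) ->
  forall S : set (R * R), measurable S ->
    P ([set w | S (X1 w, X2 w)] `&` E) = P ([set w | S (X1' w, X2' w)] `&` E').
Proof.
move=> m1 m2 m1' m2' mE mE' H S mS.
have mp := measurable_fun_pair m1 m2; have mp' := measurable_fun_pair m1' m2'.
pose k1 : {measure set (R * R) -> \bar R} :=
  measure_function_pushforward__canonical__measure_function_Measure (mrestr P mE) mp.
pose k2 : {measure set (R * R) -> \bar R} :=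
  measure_function_pushforward__canonical__measure_function_Measure (mrestr P mE') mp'.
pose C : set (set (R * R)) :=
  [set C | exists A, measurable A /\ exists B, measurable B /\ C = A `*` B].
apply: (g_sigma_algebra_measure_unique C _ (fun=> setT) _ _ k1 k2).
- by move=> _ [A [mA [B [mB ->]]]]; exact: measurableX.
- by move=> _; exists setT; split => //; exists setT; split => //; rewrite setXTT.
- by rewrite bigcup_const //; exists 0%N.
- move=> _ _ [X [mX [Y [mY ->]]]] [X' [mX' [Y' [mY' ->]]]].
  rewrite -setXI; exists (X `&` X'); split; first exact: measurableI.
  by exists (Y `&` Y'); split => //; exact: measurableI.
- by move=> _ [A [mA [B [mB ->]]]]; exact: H.
- move=> _; rewrite /k1 /= /pushforward /mrestr preimage_setT setTI.
  by rewrite (le_lt_trans (probability_le1 P mE)) // ltry.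
have := mS; rewrite {1}measurable_prod_measurableType; apply: sub_smallest2r.
  exact: smallest_sigma_algebra.
by move=> _ [A mA [B mB <-]]; exists A; split => //; exists B.
Qed.

(** * Stationarity and mixing for functions of lagged pairs *)

Section process.
Context (R : realType) (d0 : measure_display) (Omega : measurableType d0).
Variables (P : probability Omega R) (a b : R) (Y : int -> Omega -> R -> R).
Hypothesis mY : forall t u, Iab a b u -> measurable_fun setT (fun w => Y t w u).
Hypothesis stat : strictly_stationary P a b Y.

Lemma stationary_rectangle4 (u v : R) (t1 t2 t3 t4 h : int) (B1 B2 B3 B4 : set R) :
  Iab a b u -> Iab a b v ->
  measurable B1 -> measurable B2 -> measurable B3 -> measurable B4 ->
  P ((fun w => Y t1 w u) @^-1` B1 `&` (fun w => Y t2 w v) @^-1` B2 `&`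
     ((fun w => Y t3 w u) @^-1` B3 `&` (fun w => Y t4 w v) @^-1` B4)) =
  P ((fun w => Y (t1 + h) w u) @^-1` B1 `&` (fun w => Y (t2 + h) w v) @^-1` B2 `&`
     ((fun w => Y (t3 + h) w u) @^-1` B3 `&` (fun w => Y (t4 + h) w v) @^-1` B4)).
Proof.
move=> Iu Iv mB1 mB2 mB3 mB4.
pose ts (i : 'I_4) := nth 0 [:: t1; t2; t3; t4] i.
pose us (i : 'I_4) := nth 0 [:: u; v; u; v] i.
pose Bs (i : 'I_4) := nth set0 [:: B1; B2; B3; B4] i.
have := @stat 4 ts us Bs h.
have E s : [set w | forall i, Bs i (Y (ts i + s) w (us i))] =
    (fun w => Y (t1 + s) w u) @^-1` B1 `&` (fun w => Y (t2 + s) w v) @^-1` B2 `&`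
     ((fun w => Y (t3 + s) w u) @^-1` B3 `&` (fun w => Y (t4 + s) w v) @^-1` B4).
  apply/seteqP; split => w /=.
    move=> H; have H0 := H (@Ordinal 4 0 isT); have H1 := H (@Ordinal 4 1 isT).
    by have H2 := H (@Ordinal 4 2 isT); have H3 := H (@Ordinal 4 3 isT).
  by move=> [[H0 H1] [H2 H3]] [[|[|[|[|]]]] i4].
have E0 : [set w | forall i, Bs i (Y (ts i) w (us i))] =
    (fun w => Y t1 w u) @^-1` B1 `&` (fun w => Y t2 w v) @^-1` B2 `&`
     ((fun w => Y t3 w u) @^-1` B3 `&` (fun w => Y t4 w v) @^-1` B4).
  by have := E 0; rewrite !addr0 => <-; apply/seteqP; split => w /= H i; have := H i; rewrite addr0.
rewrite E E0; apply.
  by case=> [[|[|[|[|]]]] i4].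
by case=> [[|[|[|[|]]]] i4].
Qed.

(** Stationarity is given on rectangles. [eq_probability_pair] is used twice, first for (t1, t2)
    with the other event frozen, then for (t3, t4) with a rectangle frozen. *)
Lemma stationary_pairs (u v : R) (t1 t2 t3 t4 h : int) (S S' : set (R * R)) :
  Iab a b u -> Iab a b v -> measurable S -> measurable S' ->
  P ([set w | S (Y t1 w u, Y t2 w v)] `&` [set w | S' (Y t3 w u, Y t4 w v)]) =
  P ([set w | S (Y (t1 + h) w u, Y (t2 + h) w v)] `&`
     [set w | S' (Y (t3 + h) w u, Y (t4 + h) w v)]).
Proof.
move=> Iu Iv mS mS'.
have pre t w' (B : set R) : Iab a b w' -> measurable B -> measurable ((fun w => Y t w w') @^-1` B).
  by move=> Iw mB; rewrite -[X in measurable X]setTI; exact: mY.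
have prep t t' (B : set (R * R)) : measurable B ->
    measurable [set w | B (Y t w u, Y t' w v)].
  move=> mB; rewrite -[X in measurable X]setTI.
  exact: (measurable_fun_pair (mY t Iu) (mY t' Iv)).
apply: eq_probability_pair => //; [exact: mY|exact: mY|exact: mY|exact: mY|exact: prep|exact: prep|].
move=> A B mA mB; rewrite setIC [in RHS]setIC.
apply: (eq_probability_pair (E := _ `&` _)) => //;
  [exact: mY|exact: mY|exact: mY|exact: mY|exact: measurableI (pre _ _ _ Iu mA) (pre _ _ _ Iv mB)
  |exact: measurableI (pre _ _ _ Iu mA) (pre _ _ _ Iv mB)|].
by move=> A' B' mA' mB'; exact: stationary_rectangle4.
Qed.

(** With the generated sigma-algebra as measurable structure on [Omega], both coordinates are
    measurable, hence so is the pair. *)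
Lemma gen_sigma_pair (Ti : set int) (u v : R) (t t' : int) (S : set (R * R)) :
  Iab a b u -> Iab a b v -> Ti t -> Ti t' -> measurable S ->
  gen_sigma a b Y Ti [set w | S (Y t w u, Y t' w v)].
Proof.
move=> Iu Iv Tt Tt' mS; rewrite /gen_sigma; set G := (X in <<s X >>).
have mG s x : Ti s -> Iab a b x ->
    measurable_fun setT (fun w : g_sigma_algebraType G => Y s w x).
  move=> Ts Ix _ B mB; rewrite setTI; apply: sub_sigma_algebra.
  by exists s, x, B.
have := measurable_fun_pair (mG _ _ Tt Iu) (mG _ _ Tt' Iv).
by move=> /(_ measurableT _ mS); rewrite setTI.
Qed.

Variables (f : R * R -> R) (u v : R) (k : nat).
Hypotheses (mf : measurable_fun setT f) (Iu : Iab a b u) (Iv : Iab a b v).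
(** Both kinds of summand have this form: centred values with [k] = 0 and centred lagged products
    with k >= 1. *)
Let xi (t : int) w := f (Y t w u, Y (t + k%:Z) w v).

Lemma measurable_pair_process t : measurable_fun setT (xi t).
Proof. exact: (measurableT_comp mf (measurable_fun_pair (mY t Iu) (mY _ Iv))). Qed.

Let prb_shift t t' h (A B : set R) : measurable A -> measurable B ->
  prb P (xi t @^-1` A `&` xi t' @^-1` B) = prb P (xi (t + h) @^-1` A `&` xi (t' + h) @^-1` B).
Proof.
move=> mA mB; rewrite /prb.
have mfA (D : set R) : measurable D -> measurable (f @^-1` D).
  by move=> mD; rewrite -[X in measurable X]setTI; exact: mf.
have := stationary_pairs t (t + k%:Z) t' (t' + k%:Z) h Iu Iv (mfA _ mA) (mfA _ mB).
rewrite /xi ![_ + h + k%:Z]addrAC => H; congr fine; exact: H.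
Qed.

Let prb_shift1 t h (A : set R) : measurable A ->
  prb P (xi t @^-1` A) = prb P (xi (t + h) @^-1` A).
Proof.
by move=> mA; have := prb_shift t t h mA (@measurableT _ R); rewrite !preimage_setT !setIT.
Qed.

(** The first variable looks at times up to t + k, the second at times from t + k + l on, so the gap
    is [l]. *)
Lemma mixpair_process (c : nat -> R) :
  (forall (l : nat) (A B : set Omega), (0 < l)%N ->
     gen_sigma a b Y [set t | t <= 0] A -> gen_sigma a b Y [set t | l%:Z <= t] B ->
     (0 < P A)%E -> (0 < P B)%E ->
     `|1 - fine (P (A `&` B)) / (fine (P A) * fine (P B))| <= c l) ->
  forall (t : int) (l : nat), (0 < l)%N -> mixpair P (c l) (xi t) (xi (t + k%:Z + l%:Z)).
Proof.
move=> mix t l l0 A B mA mB.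
(* Shift time so that the first event lies in F_{-oo}^0 and the second in F_l^oo. *)
rewrite (prb_shift _ _ (- t - k%:Z) mA mB) (prb_shift1 t (- t - k%:Z) mA).
rewrite (prb_shift1 (t + k%:Z + l%:Z) (- t - k%:Z) mB).
rewrite (_ : t + (- t - k%:Z) = - k%:Z); last by ring.
rewrite (_ : t + k%:Z + l%:Z + (- t - k%:Z) = l%:Z); last by ring.
have mpre s (D : set R) : measurable D -> measurable (xi s @^-1` D).
  by move=> mD; rewrite -[X in measurable X]setTI; exact: measurable_pair_process.
have mfA (D : set R) : measurable D -> measurable (f @^-1` D).
  by move=> mD; rewrite -[X in measurable X]setTI; exact: mf.
have p0 (D : set Omega) : 0 <= prb P D by rewrite fine_ge0.
set EA := xi (- k%:Z) @^-1` A; set EB := xi l%:Z @^-1` B.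
have mEA : measurable EA by exact: mpre. have mEB : measurable EB by exact: mpre.
have mEAB : measurable (EA `&` EB) by exact: measurableI.
have le1 : prb P (EA `&` EB) <= prb P EA.
  by rewrite -lee_fin !EFin_prb // le_measure // inE //; exact: subIsetl.
have le2 : prb P (EA `&` EB) <= prb P EB.
  by rewrite -lee_fin !EFin_prb // le_measure // inE //; exact: subIsetr.
have [A0|A0] := eqVneq (prb P EA) 0.
  have -> : prb P (EA `&` EB) = 0 by apply/eqP; rewrite eq_le -{1}A0 le1 p0.
  by rewrite A0 !mul0r subr0 normr0 mulr0.
have [B0|B0] := eqVneq (prb P EB) 0.
  have -> : prb P (EA `&` EB) = 0 by apply/eqP; rewrite eq_le -{1}B0 le2 p0.
  by rewrite B0 !mulr0 subr0 normr0.
have Ap : 0 < prb P EA by rewrite lt_neqAle eq_sym A0 p0.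
have Bp : 0 < prb P EB by rewrite lt_neqAle eq_sym B0 p0.
have GA : gen_sigma a b Y [set t | t <= 0] EA.
  apply: gen_sigma_pair (mfA _ mA) => //=; lia.
have GB : gen_sigma a b Y [set t | l%:Z <= t] EB.
  by apply: gen_sigma_pair (mfA _ mB) => //=; lia.
have := mix l EA EB l0 GA GB.
rewrite -!EFin_prb // !lte_fin -/(prb P _) -/(prb P EA) -/(prb P EB) => /(_ Ap Bp) H.
have AB0 : 0 < prb P EA * prb P EB by rewrite mulr_gt0.
rewrite -ler_pdivrMr // -[X in _ / X](gtr0_norm AB0) -normf_div.
rewrite mulrBl divff ?lt0r_neq0 // distrC; exact: H.
Qed.

(** Equality of laws gives an inequality for every shift; the shifts t and -t give both directions.
    The common value may be +oo. *)
Lemma integral_sq_process t : (\int[P]_w (xi t w ^+ 2)%:E = \int[P]_w (xi 0 w ^+ 2)%:E)%E.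
Proof.
have msq : measurable_fun setT (fun x : R => x ^+ 2) by exact: measurable_funX.
have cmp s h : (\int[P]_w (xi s w ^+ 2)%:E <= \int[P]_w (xi (s + h) w ^+ 2)%:E)%E.
  have m1 := measurable_pair_process.
  have H : (\int[P]_w (xi s w ^+ 2 * 1)%:E <= \int[P]_w (xi (s + h) w ^+ 2 * 1)%:E)%E.
    apply: (le_integral_of_preimages (m1 s) (m1 (s + h))) msq _ => //.
    - move=> B mB; under eq_integral do rewrite mulr1.
      under [leRHS]eq_integral do rewrite mulr1.
      by rewrite !integral_indic_comp1 // (prb_shift1 s h).
    - by move=> x; exact: sqr_ge0.
  by move: H; under eq_integral do rewrite mulr1; under [leRHS]eq_integral do rewrite mulr1.
apply/eqP; rewrite eq_le; have := cmp 0 t; rewrite add0r => ->.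
by have := cmp t (- t); rewrite subrr => ->.
Qed.

(** At some points (u, v) the second moment may be infinite. In \bar R that case is trivial, and the
    bound can be integrated over u and v. *)
Lemma variance_sum_process (c : nat -> R) (S g : R) (m : nat) (t0 : int) : (0 < m)%N ->
  (forall l, 0 <= c l) -> (forall N, \sum_(1 <= l < N) c l <= S) ->
  (forall (l : nat) (A B : set Omega), (0 < l)%N ->
     gen_sigma a b Y [set t | t <= 0] A -> gen_sigma a b Y [set t | l%:Z <= t] B ->
     (0 < P A)%E -> (0 < P B)%E ->
     `|1 - fine (P (A `&` B)) / (fine (P A) * fine (P B))| <= c l) ->
  (forall t, \int[P]_w xi t w = g) ->
  (\int[P]_w ((\sum_(i < m) (xi (t0 + i%:Z) w - g)) ^+ 2)%:E <=
   (m%:R * (2 * (k.+1%:R + S)))%:E * \int[P]_w (xi 0 w ^+ 2)%:E)%E.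
Proof.
move=> m0 c0 cS mix xig.
have S0 : 0 <= S by have := cS 0%N; rewrite big_geq.
have K0 : 0 < m%:R * (2 * (k.+1%:R + S)) :> R.
  by rewrite mulr_gt0 ?ltr0n // mulr_gt0 // ltr_wpDr.
have q0 : (0 <= \int[P]_w (xi 0 w ^+ 2)%:E)%E.
  by apply: integral_ge0 => w _; rewrite lee_fin sqr_ge0.
have [qoo|qoo] := ltP (\int[P]_w (xi 0 w ^+ 2)%:E)%E +oo%E; last first.
  have -> : (\int[P]_w (xi 0 w ^+ 2)%:E)%E = +oo%E by apply/eqP; rewrite eq_le leey.
  by rewrite gt0_muley ?lte_fin // leey.
have xii t : sqint P (xi t).
  split; first exact: measurable_pair_process.
  apply: ge0_rintegrable => [|w|]; [|exact: sqr_ge0|by rewrite integral_sq_process].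
  by apply: measurable_funX; exact: measurable_pair_process.
have xiq t : ip P (xi t) (xi t) = ip P (xi 0) (xi 0).
  by rewrite !ipE2 /Rintegral integral_sq_process.
have mixn i j : (i + k < j)%N ->
    mixpair P (c (j - i - k)%N) (xi (t0 + i%:Z)) (xi (t0 + j%:Z)).
  move=> ikj; rewrite (_ : t0 + j%:Z = t0 + i%:Z + k%:Z + (j - i - k)%N%:Z); last by lia.
  by apply: mixpair_process => //; lia.
pose s w := \sum_(i < m) (xi (t0 + i%:Z) w - g).
have si : sqint P s by apply: sqint_sum => i; apply: sqintB => //; exact: sqint_cst.
have : ip P s s <= m%:R * (2 * (k.+1%:R + S)) * ip P (xi 0) (xi 0).
  exact: (variance_sum_mixing m (xi := fun i => xi (t0 + i%:Z)) (fun i => xii _)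
    (fun i => xig _) (fun i => xiq _) c0 mixn cS).
by rewrite -lee_fin EFinM !EFin_ip.
Qed.

End process.

(** * Random fields of second order *)

Section second_order_fields.
Context d d' (T : measurableType d) (Omega : measurableType d') (R : realType).
Variables (mu : {sigma_finite_measure set T -> \bar R}) (P : probability Omega R).
Implicit Types x y : Omega -> T -> R.

(* the sections [x ^~ u] are required to be in L2(P) for every [u] *)
Definition field2 x := [/\ measurable_fun setT (fun q : Omega * T => x q.1 q.2),
  forall u, sqint P (x ^~ u) & (\int[mu]_u (ip P (x ^~ u) (x ^~ u))%:E < +oo)%E].

(** No means are subtracted, as the fields to which it is applied are already centred. *)
Definition crosscov x y u v := ip P (x ^~ u) (y ^~ v).

Definition score x (f : T -> R) w := ip mu (x w) f.

Lemma measurable_crosscov x y :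
  measurable_fun setT (fun q : Omega * T => x q.1 q.2) ->
  measurable_fun setT (fun q : Omega * T => y q.1 q.2) ->
  measurable_fun setT (fun q : T * T => crosscov x y q.1 q.2).
Proof.
move=> mx my.
apply: (measurable_Rintegral_param P (F := fun (q : T * T) w => x w q.1 * y w q.2)).
apply: measurable_funM.
- have m1 : measurable_fun setT (fun z : (T * T) * Omega => (z.2, z.1.1)).
    apply: measurable_fun_pair => //.
    exact: (measurableT_comp measurable_fst measurable_fst).
  exact: (measurableT_comp mx m1).
- have m2 : measurable_fun setT (fun z : (T * T) * Omega => (z.2, z.1.2)).
    apply: measurable_fun_pair => //.
    exact: (measurableT_comp measurable_snd measurable_fst).
  exact: (measurableT_comp my m2).
Qed.

Lemma measurable_variance x : measurable_fun setT (fun q : Omega * T => x q.1 q.2) ->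
  measurable_fun setT (fun u => ip P (x ^~ u) (x ^~ u)).
Proof.
move=> mx; have mdiag : measurable_fun setT (fun u : T => (u, u)) by exact: measurable_fun_pair.
exact: (measurableT_comp (measurable_crosscov mx mx) mdiag).
Qed.

(** By Cauchy-Schwarz the squared kernel is dominated by the product of the two variance functions,
    each of which is integrable. *)
Lemma HSkernel_crosscov x y : field2 x -> field2 y -> HSkernel mu (crosscov x y).
Proof.
move=> [mx xi xoo] [my yi yoo].
have mC := measurable_crosscov mx my.
have mvx := measurable_variance mx; have mvy := measurable_variance my.
have vx0 u : 0 <= ip P (x ^~ u) (x ^~ u) by exact: ip_ge0.
have vy0 u : 0 <= ip P (y ^~ u) (y ^~ u) by exact: ip_ge0.
have ix : rintegrable mu (fun u => ip P (x ^~ u) (x ^~ u)) by exact: ge0_rintegrable.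
have iy : rintegrable mu (fun u => ip P (y ^~ u) (y ^~ u)) by exact: ge0_rintegrable.
have CS u v : crosscov x y u v ^+ 2 <= ip P (x ^~ u) (x ^~ u) * ip P (y ^~ v) (y ^~ v).
  exact: ip_CauchySchwarz.
split => //.
- apply: (@le_lt_trans _ _ (\int[mu]_v \int[mu]_u
     (ip P (x ^~ u) (x ^~ u) * ip P (y ^~ v) (y ^~ v))%:E)%E).
    apply: ge0_le_integral => //.
    + by move=> v _; apply: integral_ge0 => u _; rewrite lee_fin sqr_ge0.
    + exact: measurable_HS_section.
    + apply: (measurable_inner_integral mu
         (G := fun u v => ip P (x ^~ u) (x ^~ u) * ip P (y ^~ v) (y ^~ v))).
      by apply: measurable_funM; [exact: (measurableT_comp mvx measurable_fst)
        |exact: (measurableT_comp mvy measurable_snd)].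
    move=> v _; apply: ge0_le_integral => //.
    + by move=> u _; rewrite lee_fin sqr_ge0.
    + by apply/measurable_EFinP; apply: measurable_funX; exact: (measurable_section2 v mC).
    + by apply/measurable_EFinP; apply: measurable_funM => //; exact: measurable_cst.
    + by move=> u _; rewrite lee_fin.
  under eq_integral => v _.
    under eq_integral => u _ do rewrite EFinM.
    rewrite ge0_integralZr //; first last.
    + by rewrite lee_fin.
    + by move=> u _; rewrite lee_fin.
    + exact/measurable_EFinP.
    rewrite -(EFin_Rintegral ix) -EFinM.
    over.
  have -> : (\int[mu]_v ((\int[mu]_u ip P (x ^~ u) (x ^~ u)) * ip P (y ^~ v) (y ^~ v))%:E =
     ((\int[mu]_u ip P (x ^~ u) (x ^~ u)) * (\int[mu]_v ip P (y ^~ v) (y ^~ v)))%:E)%E.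
    by rewrite -RintegralZl // EFin_Rintegral //; exact: rintegrableZ.
  exact: ltry.
- move=> u; split; first exact: (measurable_section1 u mC).
  apply: rintegrable_le (rintegrableZ (ip P (x ^~ u) (x ^~ u)) iy).
    by apply: measurable_funX; exact: (measurable_section1 u mC).
  by move=> v; rewrite ger0_norm ?sqr_ge0.
- move=> v; split; first exact: (measurable_section2 v mC).
  apply: rintegrable_le (rintegrableZ (ip P (y ^~ v) (y ^~ v)) ix).
    by apply: measurable_funX; exact: (measurable_section2 v mC).
  by move=> u; rewrite ger0_norm ?sqr_ge0 // mulrC.
Qed.

Lemma total_variance x : field2 x -> (\int[P]_w \int[mu]_u (x w u ^+ 2)%:E)%E =
  (\int[mu]_u (ip P (x ^~ u) (x ^~ u))%:E)%E.
Proof.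
move=> [mx xi _].
rewrite (fubini_tonelli (m1 := P) (m2 := mu) (fun z => (x z.1 z.2 ^+ 2)%:E)).
- by apply: eq_integral => u _; rewrite EFin_ip.
- by apply/measurable_EFinP; exact: measurable_funX.
- by move=> z; rewrite lee_fin sqr_ge0.
Qed.

Lemma ae_sqint_of_total x : measurable_fun setT (fun q : Omega * T => x q.1 q.2) ->
  (\int[P]_w \int[mu]_u (x w u ^+ 2)%:E < +oo)%E -> {ae P, forall w, sqint mu (x w)}.
Proof.
move=> mx xoo.
have mN : measurable_fun setT (fun w => \int[mu]_u (x w u ^+ 2)%:E)%E.
  apply: (measurable_integral_param mu (F := fun z => (x z.1 z.2 ^+ 2)%:E)).
  by apply/measurable_EFinP; exact: measurable_funX.
have N0 w : (0 <= \int[mu]_u (x w u ^+ 2)%:E)%E.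
  by apply: integral_ge0 => u _; rewrite lee_fin sqr_ge0.
have Ni : P.-integrable setT (fun w => \int[mu]_u (x w u ^+ 2)%:E)%E.
  by apply/integrableP; split => //; under eq_integral do rewrite gee0_abs //.
have := integrable_ae measurableT Ni; apply: filterS => w /(_ I) woo.
split; first exact: (measurable_section1 w mx).
apply: ge0_rintegrable => [|u|]; [|exact: sqr_ge0|by rewrite -ge0_fin_numE].
by apply: measurable_funX; exact: (measurable_section1 w mx).
Qed.

Lemma ae_sqint_section x : field2 x -> {ae P, forall w, sqint mu (x w)}.
Proof.
move=> xf; have [mx _ xoo] := xf; apply: ae_sqint_of_total => //.
by rewrite total_variance.
Qed.

Section projection.
Variables (x : Omega -> T -> R) (f : T -> R).
Hypotheses (xf : field2 x) (fi : sqint mu f).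

Let measurable_score : measurable_fun setT (score x f).
Proof.
have [mx _ _] := xf; have [mf _] := fi.
apply: (measurable_Rintegral_param mu (F := fun w u => x w u * f u)).
by apply: measurable_funM => //; exact: (measurableT_comp mf measurable_snd).
Qed.

Lemma sqint_score : sqint P (score x f).
Proof.
have [mx xi xoo] := xf; split => //.
have mN : measurable_fun setT (fun w => \int[mu]_u (x w u ^+ 2)%:E)%E.
  apply: (measurable_integral_param mu (F := fun z => (x z.1 z.2 ^+ 2)%:E)).
  by apply/measurable_EFinP; exact: measurable_funX.
have N0 w : (0 <= \int[mu]_u (x w u ^+ 2)%:E)%E.
  by apply: integral_ge0 => u _; rewrite lee_fin sqr_ge0.
(* The added 1 keeps the factor positive, so that the bound below is +oo, hence true, on paths
   outside L2. *)
have f1 : 0 < ip mu f f + 1 by rewrite ltr_wpDl // ip_ge0.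
apply: ge0_rintegrable => [|w|]; [exact: measurable_funX|exact: sqr_ge0|].
apply: (@le_lt_trans _ _ (\int[P]_w ((ip mu f f + 1)%:E * \int[mu]_u (x w u ^+ 2)%:E))%E).
  apply: ge0_le_integral => //.
  - by move=> w _; rewrite lee_fin sqr_ge0.
  - by apply/measurable_EFinP; exact: measurable_funX.
  - exact: measurable_funeM.
  move=> w _; have [woo|woo] := ltP (\int[mu]_u (x w u ^+ 2)%:E)%E +oo%E; last first.
    have -> : (\int[mu]_u (x w u ^+ 2)%:E)%E = +oo%E by apply/eqP; rewrite eq_le leey.
    by rewrite gt0_muley ?lte_fin // leey.
  have xw : sqint mu (x w).
    split; first exact: (measurable_section1 w mx).
    apply: ge0_rintegrable => // [|u]; last exact: sqr_ge0.
    by apply: measurable_funX; exact: (measurable_section1 w mx).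
  rewrite -EFin_ip // -EFinM lee_fin (le_trans (ip_CauchySchwarz xw fi)) //.
  by rewrite mulrC ler_wpM2r ?ip_ge0 // lerDl.
by rewrite ge0_integralZl // ?lee_fin ?ltW // lte_mul_pinfty ?lee_fin ?ltW // total_variance.
Qed.

(** Fubini, with |x y f| dominated by x^2 + f^2 y^2. The factor y can be taken out of the inner
    integral when the path of x is in L2, hence almost surely. *)
Lemma KT_crosscov y v : field2 y -> KT mu (crosscov x y) f v = ip P (score x f) (y ^~ v).
Proof.
move=> [my yi _]; have [mx xi xoo] := xf; have [mf f2] := fi.
have mvx := measurable_variance mx.
transitivity (\int[mu]_u \int[P]_w (x w u * y w v * f u)).
  by apply: eq_Rintegral => u _; rewrite -RintegralZr //; exact: sqintM.
have mF : measurable_fun setT (fun z : T * Omega => x z.2 z.1 * y z.2 v * f z.1).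
  apply: measurable_funM; last exact: (measurableT_comp mf measurable_fst).
  apply: measurable_funM.
    exact: (measurableT_comp mx (measurable_fun_pair measurable_snd measurable_fst)).
  by have [myv _] := yi v; exact: (measurableT_comp myv measurable_snd).
rewrite (Rfubini (m1 := mu) (m2 := P) (F := fun u w => x w u * y w v * f u)) //; last first.
  have b0 := ip_ge0 P (y ^~ v).
  apply: (@le_lt_trans _ _ (\int[mu]_u (ip P (x ^~ u) (x ^~ u) +
      ip P (y ^~ v) (y ^~ v) * f u ^+ 2)%:E)%E); last first.
    apply: integrable_lty => //; apply: rintegrableD; last exact: rintegrableZ.
    by apply: ge0_rintegrable => // u; exact: ip_ge0.
  apply: ge0_le_integral => //.
  - by move=> u _; apply: integral_ge0 => w _; rewrite lee_fin.
  - apply: (measurable_integral_param P (F := fun z => `|x z.2 z.1 * y z.2 v * f z.1|%:E)).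
    by apply/measurable_EFinP; exact: measurableT_comp.
  - apply/measurable_EFinP; apply: measurable_funD => //.
    by apply: measurable_funM; [exact: measurable_cst|exact: measurable_funX].
  move=> u _; have yfi := sqintZ (f u) (yi v).
  have xyi : rintegrable P (fun w => x w u ^+ 2 + (f u * y w v) ^+ 2).
    by apply: rintegrableD; [have [] := xi u|have [] := yfi].
  apply: (@le_trans _ _ (\int[P]_w (x w u ^+ 2 + (f u * y w v) ^+ 2)%:E)%E).
    apply: ge0_le_integral => //.
    + apply/measurable_EFinP; apply: measurableT_comp => //.
      apply: measurable_funM; last exact: measurable_cst.
      by apply: measurable_funM; [have [] := xi u|have [] := yi v].
    + exact/measurable_EFinP/(rintegrable_measurable xyi).
    move=> w _; rewrite lee_fin.
    have -> : x w u * y w v * f u = x w u * (f u * y w v) by ring.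
    exact: abs_mul_le.
  rewrite -EFin_Rintegral // RintegralD //; [|by have [] := xi u|by have [] := yfi].
  rewrite lee_fin -!ipE2 ipZl ?ipZr //.
  by rewrite mulrA -expr2 [f u ^+ 2 * _]mulrC.
congr fine; apply: ae_eq_integral => //.
- apply/measurable_EFinP.
  apply: (measurable_Rintegral_param mu (F := fun w u => x w u * y w v * f u)).
  have mswap : measurable_fun setT (fun z : Omega * T => (z.2, z.1)) by exact: measurable_fun_pair.
  exact: (measurableT_comp mF mswap).
- by apply/measurable_EFinP; apply: measurable_funM => //; have [] := yi v.
apply: filterS (ae_sqint_section xf) => w xw _; congr EFin.
rewrite /score /ip -RintegralZr //; last exact: sqintM.
by apply: eq_Rintegral => u _; ring.
Qed.

Lemma ip_KT_autocov : ip mu (KT mu (crosscov x x) f) f = ip P (score x f) (score x f).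
Proof.
have [mx xi xoo] := xf; have [mf f2] := fi; have [_ sc2] := sqint_score.
have mvx := measurable_variance mx.
transitivity (\int[mu]_u \int[P]_w (score x f w * x w u * f u)).
  apply: eq_Rintegral => u _; rewrite KT_crosscov // -RintegralZr //.
  by apply: sqintM => //; exact: sqint_score.
have mF : measurable_fun setT (fun z : T * Omega => score x f z.2 * x z.2 z.1 * f z.1).
  apply: measurable_funM; last exact: (measurableT_comp mf measurable_fst).
  apply: measurable_funM; first exact: (measurableT_comp measurable_score measurable_snd).
  exact: (measurableT_comp mx (measurable_fun_pair measurable_snd measurable_fst)).
rewrite (Rfubini (m1 := mu) (m2 := P) (F := fun u w => score x f w * x w u * f u)) //; last first.
  apply: (@le_lt_trans _ _ (\int[mu]_u (ip P (x ^~ u) (x ^~ u) +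
      ip P (score x f) (score x f) * f u ^+ 2)%:E)%E); last first.
    apply: integrable_lty => //; apply: rintegrableD; last exact: rintegrableZ.
    by apply: ge0_rintegrable => // u; exact: ip_ge0.
  apply: ge0_le_integral => //.
  - by move=> u _; apply: integral_ge0 => w _; rewrite lee_fin.
  - apply: (measurable_integral_param P (F := fun z => `|score x f z.2 * x z.2 z.1 * f z.1|%:E)).
    by apply/measurable_EFinP; exact: measurableT_comp.
  - apply/measurable_EFinP; apply: measurable_funD => //.
    by apply: measurable_funM; [exact: measurable_cst|exact: measurable_funX].
  move=> u _; have yfi := sqintZ (f u) sqint_score.
  have xyi : rintegrable P (fun w => x w u ^+ 2 + (f u * score x f w) ^+ 2).
    by apply: rintegrableD; [have [] := xi u|have [] := yfi].
  apply: (@le_trans _ _ (\int[P]_w (x w u ^+ 2 + (f u * score x f w) ^+ 2)%:E)%E).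
    apply: ge0_le_integral => //.
    + apply/measurable_EFinP; apply: measurableT_comp => //.
      apply: measurable_funM; last exact: measurable_cst.
      by apply: measurable_funM => //; have [] := xi u.
    + exact/measurable_EFinP/(rintegrable_measurable xyi).
    move=> w _; rewrite lee_fin.
    have -> : score x f w * x w u * f u = x w u * (f u * score x f w) by ring.
    exact: abs_mul_le.
  rewrite -EFin_Rintegral // RintegralD //; [|by have [] := xi u|by have [] := yfi].
  rewrite lee_fin -!ipE2 ipZl ?ipZr //; [|exact: sqint_score..].
  by rewrite mulrA -expr2 [f u ^+ 2 * _]mulrC.
congr fine; apply: ae_eq_integral => //.
- apply/measurable_EFinP.
  apply: (measurable_Rintegral_param mu (F := fun w u => score x f w * x w u * f u)).
  have mswap : measurable_fun setT (fun z : Omega * T => (z.2, z.1)) by exact: measurable_fun_pair.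
  exact: (measurableT_comp mF mswap).
- by apply/measurable_EFinP; exact: measurable_funM.
apply: filterS (ae_sqint_section xf) => w xw _; congr EFin.
transitivity (\int[mu]_u (score x f w * (x w u * f u))).
  by apply: eq_Rintegral => u _; rewrite mulrA.
by rewrite RintegralZl //; exact: sqintM.
Qed.

(* <Cov(x, x) f, f> = E <x, f>^2, so the hypothesis says that <x, f> = 0 almost surely. *)
Lemma KT_crosscov_eq0 y v : field2 y -> ip mu (KT mu (crosscov x x) f) f = 0 ->
  KT mu (crosscov x y) f v = 0.
Proof.
move=> yf; have [_ yi _] := yf; rewrite ip_KT_autocov => n0.
by rewrite KT_crosscov //; apply: ip_null => //; exact: sqint_score.
Qed.

End projection.
End second_order_fields.

(** * Empirical autocovariance kernels *)

Section empirical_autocovariance.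
Context d (T : measurableType d) (R : realType).
Variable mu : {sigma_finite_measure set T -> \bar R}.
Local Notation sqint := (sqint mu).
Local Notation ip := (ip mu).
Variables (z : nat -> T -> R) (m : nat).
Hypotheses (zi : forall j, sqint (z j)) (m0 : (0 < m)%N).

Definition lagmean k u := m%:R^-1 * \sum_(i < m) z (i.+1 + k)%N u.

Definition lagprod k u v := m%:R^-1 * \sum_(i < m) z i.+1 u * z (i.+1 + k)%N v.

Variables (zb : T -> R).
Hypothesis zbi : sqint zb.

(** [zb] is a parameter because the estimator sums over m = n - p terms but centres by the mean of
    all n curves. *)
Definition empcov k u v :=
  m%:R^-1 * \sum_(i < m) (z i.+1 u - zb u) * (z (i.+1 + k)%N v - zb v).

Lemma sqint_lagmean k : sqint (lagmean k).
Proof. by apply: sqintZ; exact: sqint_sum. Qed.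

Lemma HSkernel_lagprod k : HSkernel mu (lagprod k).
Proof.
have -> : lagprod k = fun u v => \sum_(i < m) (m%:R^-1 * z i.+1 u) * z (i.+1 + k)%N v.
  by apply/funext => u; apply/funext => v; rewrite /lagprod mulr_sumr; apply: eq_bigr => i _; rewrite mulrA.
by apply: HSkernel_sum => i; apply: HSkernel_prod => //; exact: sqintZ.
Qed.

Lemma HSkernel_empcov k : HSkernel mu (empcov k).
Proof.
have -> : empcov k = fun u v => \sum_(i < m) (m%:R^-1 * (z i.+1 u - zb u)) * (z (i.+1 + k)%N v - zb v).
  by apply/funext => u; apply/funext => v; rewrite /empcov mulr_sumr; apply: eq_bigr => i _; rewrite mulrA.
by apply: HSkernel_sum => i; apply: HSkernel_prod => //; [apply: sqintZ|]; exact: sqintB.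
Qed.

(** Apart from [lagprod], every term of the expansion is a product of two sample means, so its
    squared Hilbert-Schmidt norm is a product of two small factors. *)
Lemma empcovE k u v : empcov k u v =
  lagprod k u v - zb u * lagmean k v - (lagmean 0 u * zb v - zb u * zb v).
Proof.
rewrite /empcov /lagprod /lagmean.
have mN : m%:R != 0 :> R by rewrite pnatr_eq0 -lt0n.
have -> : \sum_(i < m) (z i.+1 u - zb u) * (z (i.+1 + k)%N v - zb v) =
  \sum_(i < m) z i.+1 u * z (i.+1 + k)%N v - zb u * (\sum_(i < m) z (i.+1 + k)%N v)
  - (\sum_(i < m) z (i.+1 + 0)%N u) * zb v + m%:R * (zb u * zb v).
  rewrite mulr_sumr mulr_suml -[m in m%:R]card_ord -sumr_const mulr_suml -!sumrB -big_split /=.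
  by apply: eq_bigr => i _; rewrite addn0; ring.
by field.
Qed.

(** Three uses of |A - B|^2 <= 2 |A|^2 + 2 |B|^2 give 2 (2 l + 2 l^2) + 2 (4 l^2) = 4 (l + 3
    l^2). *)
Lemma HS_empcov_error k (G : T -> T -> R) (l : R) : 0 <= l ->
  measurable_fun setT (fun q : T * T => G q.1 q.2) ->
  (HS mu (fun u v => (lagprod k u v - G u v)%R) <= l%:E)%E ->
  ip (lagmean k) (lagmean k) <= l -> ip (lagmean 0) (lagmean 0) <= l -> ip zb zb <= l ->
  (HS mu (fun u v => (empcov k u v - G u v)%R) <= (4 * (l + 3 * l ^+ 2))%:E)%E.
Proof.
move=> l0 mG Sl Rk R0 Zb.
have [mS _ _ _] := HSkernel_lagprod k.
have ki := sqint_lagmean k; have li := sqint_lagmean 0.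
have [m1 _ _ _] := HSkernel_prod zbi ki.
have [m2 _ _ _] := HSkernel_prod li zbi.
have [m3 _ _ _] := HSkernel_prod zbi zbi.
have -> : (fun u v => empcov k u v - G u v) = fun u v =>
    ((lagprod k u v - G u v) - zb u * lagmean k v) - (lagmean 0 u * zb v - zb u * zb v).
  by apply/funext => u; apply/funext => v; rewrite empcovE; ring.
have mSG := measurable_funB mS mG.
pose SG u v := lagprod k u v - G u v.
have e1 := HSB_le mu (G := fun u v => zb u * lagmean k v) (H := SG) m1 mSG.
have e2 := HSB_le mu (G := fun u v => zb u * zb v) (H := fun u v => lagmean 0 u * zb v) m3 m2.
have e3 := HSB_le mu (G := fun u v => lagmean 0 u * zb v - zb u * zb v)
  (H := fun u v => SG u v - zb u * lagmean k v) (measurable_funB m2 m3) (measurable_funB mSG m1).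
apply: le_trans e3 _.
have b a c : 0 <= a -> 0 <= c -> a <= l -> c <= l -> a * c <= l ^+ 2.
  by move=> *; rewrite expr2 ler_pM.
have {}e1 : (HS mu (fun u v => ((lagprod k u v - G u v) - zb u * lagmean k v)%R) <=
    (2 * l + 2 * l ^+ 2)%:E)%E.
  apply: le_trans e1 _; apply: (@le_trans _ _ (2%:E * l%:E + 2%:E * (l ^+ 2)%:E)%E).
    apply: leeD; apply: lee_wpmul2l => //.
    by rewrite HS_prod // lee_fin b // ip_ge0.
  by rewrite -!EFinM -EFinD.
have {}e2 : (HS mu (fun u v => (lagmean 0 u * zb v - zb u * zb v)%R) <=
    (4 * l ^+ 2)%:E)%E.
  apply: le_trans e2 _; rewrite !HS_prod // -!EFinM -EFinD lee_fin.
  have := b _ _ (ip_ge0 mu (lagmean 0)) (ip_ge0 mu zb) R0 Zb.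
  have := b _ _ (ip_ge0 mu zb) (ip_ge0 mu zb) Zb Zb; lra.
apply: (@le_trans _ _ (2%:E * (2 * l + 2 * l ^+ 2)%:E + 2%:E * (4 * l ^+ 2)%:E)%E).
  by apply: leeD; apply: lee_wpmul2l.
by rewrite -!EFinM -EFinD lee_fin; lra.
Qed.

(** The finite-rank form required by [finite_rank_eigenfunction]. [A] is a multiple of a sum over k
    of Gram matrices of the lagged centred curves, hence positive semidefinite. *)
Lemma compop_empcov (I : Type) (s : seq I) (kap : I -> nat) : exists A : 'M[R]_m,
  [/\ A^T = A, forall x : 'I_m -> R, 0 <= \sum_i \sum_j A i j * x i * x j &
    forall f, sqint f -> forall u, compop mu s (fun k => empcov (kap k)) f u =
      \sum_i (\sum_j A i j * ip (fun t => z j.+1 t - zb t) f) * (z i.+1 u - zb u)].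
Proof.
pose e k i v := z (i.+1 + k)%N v - zb v.
have ei k i : sqint (e k i) by exact: sqintB.
pose c i u := z i.+1 u - zb u.
have ci i : sqint (c i) by exact: sqintB.
pose A : 'M[R]_m := \matrix_(i, j) (m%:R ^- 2 * \sum_(k <- s) ip (e (kap k) i) (e (kap k) j)).
exists A; split.
- by apply/matrixP => i j; rewrite !mxE; congr (_ * _); apply: eq_bigr => k _; rewrite ipC.
- move=> x; have -> : \sum_i \sum_j A i j * x i * x j = m%:R ^- 2 * \sum_(k <- s)
      ip (fun v => \sum_(i < m) x i * e (kap k) i v) (fun v => \sum_(i < m) x i * e (kap k) i v).
    rewrite mulr_sumr.
    transitivity (\sum_(i < m) \sum_(k <- s) m%:R ^- 2 * (\sum_(j < m) x i * (x j * ip (e (kap k) i) (e (kap k) j)))).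
      apply: eq_bigr => i _; rewrite -mulr_sumr exchange_big mulr_sumr; apply: eq_bigr => j _ /=.
      by rewrite mxE -!mulrA; congr (_ * _); rewrite !mulr_suml; apply: eq_bigr => k _; ring.
    rewrite exchange_big; apply: eq_bigr => k _ /=; rewrite -mulr_sumr; congr (_ * _).
    rewrite ip_suml //; last exact: sqint_lincomb.
    by apply: eq_bigr => i _; rewrite ip_sumr // mulr_sumr.
  apply: mulr_ge0; first by rewrite invr_ge0 exprn_ge0.
  by apply: sumr_ge0 => k _; exact: ip_ge0.
move=> f fi u; rewrite /compop.
have rowi k v : sqint (empcov k v) by have [_ _ H _] := HSkernel_empcov k.
have E u' : \sum_(k <- s) ip (empcov (kap k) u) (empcov (kap k) u') =
    \sum_(j < m) (\sum_(i < m) A i j * c i u) * c j u'.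
  transitivity (\sum_(k <- s) \sum_(j < m) \sum_(i < m)
      m%:R ^- 2 * ip (e (kap k) i) (e (kap k) j) * c i u * c j u').
    apply: eq_bigr => k _.
    have H w : empcov (kap k) w = fun v => \sum_(i < m) (m%:R^-1 * c i w) * e (kap k) i v.
      by apply/funext => v; rewrite /empcov mulr_sumr; apply: eq_bigr => i _; rewrite mulrA.
    rewrite !H ip_sumr //; last exact: sqint_lincomb.
    apply: eq_bigr => j _; rewrite ip_suml // mulr_sumr; apply: eq_bigr => i _.
    by rewrite -exprVn expr2; ring.
  rewrite exchange_big; apply: eq_bigr => j _ /=; rewrite exchange_big mulr_suml.
  by apply: eq_bigr => i _ /=; rewrite mxE mulr_sumr !mulr_suml.
transitivity (ip (fun u' => \sum_(j < m) (\sum_(i < m) A i j * c i u) * c j u') f).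
  by apply: eq_Rintegral => u' _; rewrite E.
rewrite ip_suml //; under eq_bigr do rewrite mulr_suml.
rewrite exchange_big; apply: eq_bigr => i _ /=; rewrite mulr_suml.
by apply: eq_bigr => j _; rewrite /c; ring.
Qed.

End empirical_autocovariance.

(** * The functional time series model *)

Section restriction_to_interval.
Variables (R : realType) (a b : R).
Local Notation lebm := (@lebesgue_measure R).
Implicit Types f g h : R -> R.

(* Extension by zero, which turns every integral over [a, b] into one over the line. *)
Definition cut f : R -> R := fun u => if a <= u <= b then f u else 0.

Lemma cutE f u : Iab a b u -> cut f u = f u.
Proof. by rewrite /cut => ->. Qed.

Lemma cutN f u : ~ Iab a b u -> cut f u = 0.
Proof. by rewrite /cut /Iab /=; case: ifP => // h []. Qed.

Lemma IabP u : Iab a b u \/ ~ Iab a b u.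
Proof. by rewrite /Iab /=; case: (_ && _); [left|right]. Qed.

Lemma cut_patch f : cut f = f \_ (Iab a b).
Proof.
apply/funext => u; rewrite patchE; case: (IabP u) => Iu.
  by rewrite cutE // mem_set.
by rewrite cutN // memNset.
Qed.

Lemma measurable_Iab : measurable (Iab a b).
Proof. by rewrite /Iab -set_itvcc; exact: measurable_itv. Qed.

Lemma Rintegral_Iab f : \int[lebm]_(u in Iab a b) f u = \int[lebm]_u cut f u.
Proof. by rewrite Rintegral_mkcond cut_patch. Qed.

Lemma integral_Iab f : (\int[lebm]_(u in Iab a b) (f u)%:E = \int[lebm]_u (cut f u)%:E)%E.
Proof.
rewrite integral_mkcond; apply: eq_integral => u _.
by rewrite (restrict_EFin f) /= cut_patch.
Qed.

Lemma cutM f g u : cut (fun u => f u * g u) u = cut f u * cut g u.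
Proof. by rewrite /cut; case: ifP => // _; rewrite mulr0. Qed.

Lemma cut_sq f u : cut (fun u => f u ^+ 2) u = cut f u ^+ 2.
Proof. by rewrite /cut; case: ifP => // _; rewrite expr0n. Qed.

Lemma cut_measurable f : measurable_fun (Iab a b) f -> measurable_fun setT (cut f).
Proof. by rewrite cut_patch => mf; apply/(measurable_restrictT _ measurable_Iab). Qed.

Lemma innerI_ip f g : innerI a b f g = ip lebm (cut f) (cut g).
Proof. by rewrite /innerI Rintegral_Iab; apply: eq_Rintegral => u _; rewrite cutM. Qed.

Lemma sqint_cut f : L2I a b f -> sqint lebm (cut f).
Proof.
move=> [mf foo]; have mc := cut_measurable mf; split => //.
apply: ge0_rintegrable => [|u|]; [exact: measurable_funX|exact: sqr_ge0|].
move: foo; rewrite integral_Iab; congr (_ < _)%E.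
by apply: eq_integral => u _; congr EFin; exact: cut_sq.
Qed.

Lemma L2I_sqint f : sqint lebm f -> L2I a b f.
Proof.
move=> [mf fi]; have mfI : measurable_fun (Iab a b) f by exact: measurable_funTS.
split => //.
apply: (@le_lt_trans _ _ (\int[lebm]_u (f u ^+ 2)%:E)%E); last exact: integrable_lty.
rewrite integral_Iab; apply: ge0_le_integral => //.
- by move=> u _; rewrite lee_fin (cut_sq f) sqr_ge0.
- apply/measurable_EFinP; apply: cut_measurable.
  exact: (measurable_funX 2 mfI).
- by apply/measurable_EFinP; exact: measurable_funX.
move=> u _; rewrite lee_fin (cut_sq f) /cut; case: ifP => // _.
by rewrite expr0n sqr_ge0.
Qed.

Lemma orthonormal_cut n (z : 'I_n -> R -> R) :
  orthonormalI a b z -> orthonormal lebm (fun j => cut (z j)).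
Proof.
move=> [zi zo]; split=> [j|j k]; first exact: sqint_cut.
by rewrite -innerI_ip.
Qed.

Lemma measurable_cut_joint d (T : measurableType d) (X : T -> R -> R) :
  measurable_fun (setT `*` Iab a b) (fun q : T * R => X q.1 q.2) ->
  measurable_fun setT (fun q : T * R => cut (X q.1) q.2).
Proof.
move=> mX; have mD : measurable (setT `*` Iab a b : set (T * R)).
  by apply: measurableX => //; exact: measurable_Iab.
have -> : (fun q : T * R => cut (X q.1) q.2) = (fun q => X q.1 q.2) \_ (setT `*` Iab a b).
  apply/funext => q; rewrite cut_patch !patchE; congr (if _ then _ else _).
  by apply/idP/idP; rewrite !inE => //= -[].
by apply/(measurable_restrictT _ mD).
Qed.

Lemma kerop_cut (K K' : R -> R -> R) f u : Iab a b u ->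
  (forall u', Iab a b u' -> K u u' = K' u u') -> (forall u', ~ Iab a b u' -> K' u u' = 0) ->
  kerop a b K f u = ip lebm (K' u) (cut f).
Proof.
move=> Iu KK K0; rewrite /kerop Rintegral_Iab; apply: eq_Rintegral => u' _.
rewrite cutM; case: (IabP u') => Iu'; first by rewrite cutE // KK.
by rewrite !cutN // !mulr0.
Qed.

Lemma ip_kernel_cut (K1 K2 K1' K2' : R -> R) :
  (forall u, Iab a b u -> K1 u = K1' u) -> (forall u, Iab a b u -> K2 u = K2' u) ->
  (forall u, ~ Iab a b u -> K1' u = 0) ->
  \int[lebm]_(u in Iab a b) (K1 u * K2 u) = ip lebm K1' K2'.
Proof.
move=> E1 E2 N1; rewrite Rintegral_Iab; apply: eq_Rintegral => u _.
rewrite cutM; case: (IabP u) => Iu; first by rewrite !cutE // E1 // E2.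
by rewrite !cutN // N1 // !mul0r.
Qed.

End restriction_to_interval.

Section model.
Variables (R : realType) (d0 : measure_display) (Omega : measurableType d0).
Variables (P : probability Omega R) (a b : R).
Variables (X eps Y : int -> Omega -> R -> R) (mu : R -> R) (M : nat -> R -> R -> R).
Local Notation lebm := (@lebesgue_measure R).
Local Notation cut := (cut a b).
Hypothesis YE : forall t w u, Y t w u = X t w u + eps t w u.
Hypothesis mX : forall t, measurable_fun (setT `*` Iab a b) (fun q : Omega * R => X t q.1 q.2).
Hypothesis meps : forall t, measurable_fun (setT `*` Iab a b) (fun q : Omega * R => eps t q.1 q.2).
Hypothesis eps_mean : forall t u, Iab a b u ->
  P.-integrable setT (fun w => (eps t w u)%:E) /\ Ex P (fun w => eps t w u) = 0%E.
Hypothesis eps_white : forall t s u v, t != s -> Iab a b u -> Iab a b v ->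
  P.-integrable setT (fun w => (eps t w u * eps s w v)%:E) /\
  Ex P (fun w => eps t w u * eps s w v) = 0%E.
Hypothesis sq_fin : forall t, (\int[lebm]_(u in Iab a b)
  Ex P (fun w => (X t w u ^+ 2 + eps t w u ^+ 2)%R) < +oo)%E.
Hypothesis X_mean : forall t u, Iab a b u ->
  P.-integrable setT (fun w => (X t w u)%:E) /\ Ex P (fun w => X t w u) = (mu u)%:E.
Hypothesis X_cov : forall t (k : nat) u v, Iab a b u -> Iab a b v ->
  P.-integrable setT (fun w => (X t w u * X (t + k%:Z) w v)%:E) /\
  Ex P (fun w => X t w u * X (t + k%:Z) w v) = (M k u v + mu u * mu v)%:E.
Hypothesis X_eps : forall s t u v, Iab a b u -> Iab a b v ->
  P.-integrable setT (fun w => (X s w u * eps t w v)%:E) /\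
  Ex P (fun w => X s w u * eps t w v) = 0%E.
Hypothesis Y_four : forall t, (\int[P]_w ((\int[lebm]_(u in Iab a b) ((Y t w u) ^+ 2)%R%:E) *
  (\int[lebm]_(u in Iab a b) ((Y t w u) ^+ 2)%R%:E)) < +oo)%E.

Definition xc t w := cut (fun u => X t w u - mu u).
Definition noise t w := cut (eps t w).
(** The empirical kernels subtract the sample mean, so on the interval they do not change when Y is
    replaced by Y - mu. *)
Definition yc t w := cut (fun u => Y t w u - mu u).

Lemma ycE t w u : yc t w u = xc t w u + noise t w u.
Proof.
by rewrite /yc /xc /noise /cut; case: ifP => _; rewrite ?YE ?addr0 // addrAC.
Qed.

(** [mu] is measurable as the parametric integral of X_0 over [Omega]. *)
Lemma measurable_cut_mean : measurable_fun setT (cut mu).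
Proof.
have -> : cut mu = fun u => \int[P]_w cut (X 0 w) u.
  apply/funext => u; case: (IabP a b u) => Iu.
    under eq_Rintegral do rewrite cutE //.
    have [_ E] := X_mean 0 Iu; rewrite cutE // /Rintegral.
    by move: E; rewrite /Ex => ->.
  by rewrite cutN //; under eq_Rintegral do rewrite cutN //; rewrite Rintegral_cst // mul0r.
apply: (measurable_Rintegral_param P (F := fun u w => cut (X 0 w) u)).
have mswap : measurable_fun setT (fun z : R * Omega => (z.2, z.1)) by exact: measurable_fun_pair.
exact: (measurableT_comp (measurable_cut_joint (mX 0)) mswap).
Qed.

Lemma measurable_xc t : measurable_fun setT (fun q : Omega * R => xc t q.1 q.2).
Proof.
have -> : (fun q : Omega * R => xc t q.1 q.2) = fun q => cut (X t q.1) q.2 - cut mu q.2.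
  by apply/funext => q; rewrite /xc /cut; case: ifP; rewrite ?subr0.
apply: measurable_funB; first exact: measurable_cut_joint.
exact: (measurableT_comp measurable_cut_mean measurable_snd).
Qed.

Lemma measurable_noise t : measurable_fun setT (fun q : Omega * R => noise t q.1 q.2).
Proof. exact: measurable_cut_joint. Qed.

Lemma measurable_yc t : measurable_fun setT (fun q : Omega * R => yc t q.1 q.2).
Proof.
under eq_fun do rewrite ycE.
by apply: measurable_funD; [exact: measurable_xc|exact: measurable_noise].
Qed.

Let Ex_Rintegral (f : Omega -> R) (r : R) : Ex P f = r%:E -> \int[P]_w f w = r.
Proof. by rewrite /Ex /Rintegral => ->. Qed.

Lemma sqint_X t u : Iab a b u -> sqint P (fun w => X t w u).
Proof.
move=> Iu; have [/rintegrable_measurable mXu _] := X_mean t Iu.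
split => //; have [+ _] := X_cov t 0 Iu Iu.
by rewrite addr0; apply: eq_integrable => // w _; rewrite /= expr2.
Qed.

Lemma sqint_xc t u : sqint P (fun w => xc t w u).
Proof.
rewrite /xc; case: (IabP a b u) => Iu; last by under eq_fun do rewrite cutN //; exact: sqint0.
by under eq_fun do rewrite cutE //; apply: sqintB; [exact: sqint_X|exact: sqint_cst].
Qed.

Lemma cov_xc t (k : nat) u v : Iab a b u -> Iab a b v ->
  crosscov P (xc t) (xc (t + k%:Z)) u v = M k u v.
Proof.
move=> Iu Iv; rewrite /crosscov.
transitivity (ip P (fun w => X t w u - mu u) (fun w => X (t + k%:Z) w v - mu v)).
  by apply: eq_Rintegral => w _; rewrite /xc !cutE.
have Xu := sqint_X t Iu; have Xv := sqint_X (t + k%:Z) Iv.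
have cu := sqint_cst P (mu u); have cv := sqint_cst P (mu v).
have Xvc := sqintB Xv cv.
rewrite ipBl // !ipBr // (ipC _ (fun=> mu u) (fun w => X _ w v)).
have -> : ip P (fun=> mu u) (fun=> mu v) = mu u * mu v.
  rewrite /ip Rintegral_cst // (_ : fine _ = 1) ?mulr1 //.
  exact: (congr1 fine (probability_setT P)).
rewrite !ip_cst //.
have [_ /Ex_Rintegral ->] := X_mean t Iu.
have [_ /Ex_Rintegral ->] := X_mean (t + k%:Z) Iv.
have [_ /Ex_Rintegral E] := X_cov t k Iu Iv.
by rewrite /ip E; ring.
Qed.

Lemma cov_xc_out x y u v : ~ Iab a b u \/ ~ Iab a b v -> crosscov P (xc x) (xc y) u v = 0.
Proof.
move=> H; transitivity (\int[P]_w (0 : R)); last by rewrite Rintegral_cst // mul0r.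
by apply: eq_Rintegral => w _; rewrite /xc; case: H => I; rewrite (cutN _ I) ?mul0r ?mulr0.
Qed.

Lemma cov_xc_shift t (k : nat) u v :
  crosscov P (xc t) (xc (t + k%:Z)) u v = crosscov P (xc 0) (xc k%:Z) u v.
Proof.
case: (IabP a b u) => Iu; last by rewrite !cov_xc_out; auto.
case: (IabP a b v) => Iv; last by rewrite !cov_xc_out; auto.
by rewrite cov_xc // -[k%:Z in RHS]add0r cov_xc.
Qed.

Lemma second_moment_lty t :
  (\int[lebm]_u \int[P]_w (cut (X t w) u ^+ 2 + noise t w u ^+ 2)%:E < +oo)%E.
Proof.
apply: le_lt_trans (sq_fin t); rewrite [leRHS]integral_mkcond le_eqVlt; apply/orP; left; apply/eqP.
apply: eq_integral => u _; rewrite patchE; case: (IabP a b u) => Iu.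
  by rewrite mem_set //; apply: eq_integral => w _; rewrite /noise !cutE.
rewrite memNset //; under eq_integral do rewrite /noise !cutN // expr0n addr0.
exact: integral0.
Qed.

Let m_joint_sq (F : Omega -> R -> R) : measurable_fun setT (fun q : Omega * R => F q.1 q.2) ->
  measurable_fun setT (fun u => \int[P]_w (F w u ^+ 2)%:E)%E.
Proof.
move=> mF; apply: (measurable_integral_param P (F := fun q : R * Omega => (F q.2 q.1 ^+ 2)%:E)).
apply/measurable_EFinP; apply: measurable_funX.
have mswap : measurable_fun setT (fun z : R * Omega => (z.2, z.1)) by exact: measurable_fun_pair.
exact: (measurableT_comp mF mswap).
Qed.

Let m_second_moment t : measurable_fun setT
  (fun u => \int[P]_w (cut (X t w) u ^+ 2 + noise t w u ^+ 2)%:E)%E.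
Proof.
apply: (measurable_integral_param P
  (F := fun q : R * Omega => (cut (X t q.2) q.1 ^+ 2 + noise t q.2 q.1 ^+ 2)%:E)).
have mswap : measurable_fun setT (fun z : R * Omega => (z.2, z.1)) by exact: measurable_fun_pair.
apply/measurable_EFinP; apply: measurable_funD; apply: measurable_funX.
  exact: (measurableT_comp (measurable_cut_joint (mX t)) mswap).
exact: (measurableT_comp (measurable_noise t) mswap).
Qed.

Let m_section (F : Omega -> R -> R) u : measurable_fun setT (fun q : Omega * R => F q.1 q.2) ->
  measurable_fun setT (fun w => F w u).
Proof. exact: measurable_section2. Qed.

Lemma field2_xc t : field2 lebm P (xc t).
Proof.
split; [exact: measurable_xc|exact: sqint_xc|].
apply: le_lt_trans (second_moment_lty t); apply: ge0_le_integral => //.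
- by move=> u _; rewrite lee_fin ip_ge0.
- by apply/measurable_EFinP; apply: measurable_variance; exact: measurable_xc.
- exact: m_second_moment.
move=> u _; apply: (@le_trans _ _ (\int[P]_w (cut (X t w) u ^+ 2)%:E)%E); last first.
  apply: ge0_le_integral => //.
  - by move=> w _; rewrite lee_fin sqr_ge0.
  - apply/measurable_EFinP; apply: measurable_funX.
    exact: (m_section (F := fun w => cut (X t w)) u (measurable_cut_joint (mX t))).
  - apply/measurable_EFinP; apply: measurable_funD; apply: measurable_funX.
      exact: (m_section (F := fun w => cut (X t w)) u (measurable_cut_joint (mX t))).
    exact: (m_section (F := noise t) u (measurable_noise t)).
  - by move=> w _; rewrite lee_fin lerDl sqr_ge0.
case: (IabP a b u) => Iu; last first.
  rewrite (_ : ip _ _ _ = 0); first by apply: integral_ge0 => w _; rewrite lee_fin sqr_ge0.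
  transitivity (\int[P]_w (0 : R)); last by rewrite Rintegral_cst // mul0r.
  by apply: eq_Rintegral => w _; rewrite /xc cutN // mul0r.
have -> : (\int[P]_w (cut (X t w) u ^+ 2)%:E)%E = (ip P (fun w => X t w u) (fun w => X t w u))%:E.
  by rewrite EFin_ip; [apply: eq_integral => w _; rewrite cutE|exact: sqint_X].
have := cov_xc t 0 Iu Iu; rewrite addr0 /crosscov => ->.
have [_ /Ex_Rintegral] := X_cov t 0 Iu Iu.
rewrite addr0 lee_fin /ip => ->; rewrite lerDl -expr2; exact: sqr_ge0.
Qed.

(** The noise is known to have a finite second moment at almost every u only, so (x + e)^2 <= 2 x^2
    + 2 e^2 is integrated in \bar R. *)
Lemma total_variance_yc t : (\int[lebm]_u \int[P]_w (yc t w u ^+ 2)%:E < +oo)%E.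
Proof.
have [_ xi xoo] := field2_xc t.
apply: (@le_lt_trans _ _ (\int[lebm]_u (2%:E * (ip P (xc t ^~ u) (xc t ^~ u))%:E +
   2%:E * \int[P]_w (cut (X t w) u ^+ 2 + noise t w u ^+ 2)%:E))%E); last first.
  have mv := measurable_variance P (measurable_xc t).
  have msm := m_second_moment t.
  have I0 u : (0 <= \int[P]_w (cut (X t w) u ^+ 2 + noise t w u ^+ 2)%:E)%E.
    by apply: integral_ge0 => w _; rewrite lee_fin addr_ge0 ?sqr_ge0.
  have V0 u : (0 <= (ip P (xc t ^~ u) (xc t ^~ u))%:E)%E by rewrite lee_fin ip_ge0.
  rewrite ge0_integralD //; first last.
  - exact: measurable_funeM.
  - by move=> u _; rewrite mule_ge0.
  - by apply: measurable_funeM; exact/measurable_EFinP.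
  - by move=> u _; rewrite mule_ge0.
  rewrite !ge0_integralZl //; last exact/measurable_EFinP.
  by rewrite lte_add_pinfty // lte_mul_pinfty // second_moment_lty.
apply: ge0_le_integral => //.
- by move=> u _; apply: integral_ge0 => w _; rewrite lee_fin sqr_ge0.
- by apply: m_joint_sq; exact: measurable_yc.
- apply: emeasurable_funD; last by apply: measurable_funeM; exact: m_second_moment.
  apply: measurable_funeM; apply/measurable_EFinP; apply: measurable_variance.
  exact: measurable_xc.
move=> u _; rewrite EFin_ip //.
have mxu := m_section (F := xc t) u (measurable_xc t).
have mnu := m_section (F := noise t) u (measurable_noise t).
have mXu := m_section (F := fun w => cut (X t w)) u (measurable_cut_joint (mX t)).
have myu := m_section (F := yc t) u (measurable_yc t).
have msum : measurable_fun setT (fun w => (cut (X t w) u ^+ 2 + noise t w u ^+ 2)%:E).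
  by apply/measurable_EFinP; apply: measurable_funD; exact: measurable_funX.
have mxsq : measurable_fun setT (fun w => (xc t w u ^+ 2)%:E).
  by apply/measurable_EFinP; exact: measurable_funX.
have s0 w : (0 <= (cut (X t w) u ^+ 2 + noise t w u ^+ 2)%:E)%E.
  by rewrite lee_fin addr_ge0 ?sqr_ge0.
have x0 w : (0 <= (xc t w u ^+ 2)%:E)%E by rewrite lee_fin sqr_ge0.
rewrite -!ge0_integralZl // -ge0_integralD //; first last.
- exact: measurable_funeM.
- by move=> w _; rewrite mule_ge0.
- exact: measurable_funeM.
- by move=> w _; rewrite mule_ge0.
apply: ge0_le_integral => //.
- by move=> w _; rewrite lee_fin sqr_ge0.
- by apply/measurable_EFinP; exact: measurable_funX.
- by apply: emeasurable_funD; exact: measurable_funeM.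
move=> w _; rewrite -!EFinM -EFinD lee_fin ycE.
have := sqr_ge0 (xc t w u - noise t w u); have := sqr_ge0 (cut (X t w) u); nra.
Qed.

Lemma mean_yc t u : rintegrable P (fun w => yc t w u) /\ \int[P]_w yc t w u = 0.
Proof.
case: (IabP a b u) => Iu; last first.
  have -> : (fun w => yc t w u) = (fun=> 0) by apply/funext => w; rewrite /yc cutN.
  split; last by rewrite Rintegral_cst // mul0r.
  by apply: eq_integrable (integrable0 _ _) => // w _.
have [Xi /Ex_Rintegral XE] := X_mean t Iu; have [ei /Ex_Rintegral eE] := eps_mean t Iu.
have ci := sqint_rintegrable (sqint_cst P (mu u)).
have E : (fun w => yc t w u) = fun w => (X t w u - mu u) + eps t w u.
  by apply/funext => w; rewrite ycE /xc /noise !cutE.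
have Xci := rintegrableB Xi ci.
rewrite E; split; first exact: rintegrableD.
rewrite RintegralD // RintegralB // XE eE Rintegral_cst // (_ : fine _ = 1).
  by rewrite mulr1 subrr addr0.
exact: (congr1 fine (probability_setT P)).
Qed.

(** The mixed terms vanish by C4 and the zero mean of the noise, the product of noises by whiteness,
    as t and t + k differ. Integrability is collected term by term, since the noise need not be
    square integrable at every u. *)
Lemma autocov_yc t (k : nat) u v : (0 < k)%N ->
  \int[P]_w (yc t w u * yc (t + k%:Z) w v) = crosscov P (xc 0) (xc k%:Z) u v.
Proof.
move=> k0; rewrite -(cov_xc_shift t).
case: (IabP a b u) => Iu; last first.
  rewrite cov_xc_out; last by left.
  transitivity (\int[P]_w (0 : R)); last by rewrite Rintegral_cst // mul0r.
  by apply: eq_Rintegral => w _; rewrite /yc cutN // mul0r.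
case: (IabP a b v) => Iv; last first.
  rewrite cov_xc_out; last by right.
  transitivity (\int[P]_w (0 : R)); last by rewrite Rintegral_cst // mul0r.
  by apply: eq_Rintegral => w _; rewrite /yc [X in _ * X]cutN // mulr0.
have tk : t != t + k%:Z by lia.
have tk' : t + k%:Z != t by lia.
have [eei /Ex_Rintegral eeE] := eps_white tk Iu Iv.
have [ui /Ex_Rintegral uE] := eps_mean t Iu; have [vi /Ex_Rintegral vE] := eps_mean (t + k%:Z) Iv.
have [xei /Ex_Rintegral xeE] := X_eps t (t + k%:Z) Iu Iv.
have [exi /Ex_Rintegral exE] := X_eps (t + k%:Z) t Iv Iu.
have xxi := sqintM (sqint_xc t u) (sqint_xc (t + k%:Z) v).
have i1 := rintegrableZ (mu u) vi; have i2 := rintegrableZ (mu v) ui.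
have j1 := rintegrableB xei i1; have j2 := rintegrableB exi i2.
have k1 := rintegrableD xxi j1; have k2 := rintegrableD k1 j2.
transitivity (\int[P]_w (xc t w u * xc (t + k%:Z) w v +
   (X t w u * eps (t + k%:Z) w v - mu u * eps (t + k%:Z) w v) +
   (X (t + k%:Z) w v * eps t w u - mu v * eps t w u) + eps t w u * eps (t + k%:Z) w v)).
  by apply: eq_Rintegral => w _; rewrite !ycE /xc /noise !cutE //; ring.
rewrite RintegralD // RintegralD // RintegralD // RintegralB // RintegralB //.
by rewrite !RintegralZl // eeE uE vE xeE exE !mulr0 !subr0 !addr0.
Qed.

(** Since [M 0 u u] is a variance, mu(u)^2 <= E X_0(u)^2, and the latter is integrable in u. *)
Lemma sqint_cut_mean : sqint lebm (cut mu).
Proof.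
have mm := measurable_cut_mean.
split => //; apply: ge0_rintegrable => [|u|]; [exact: measurable_funX|exact: sqr_ge0|].
apply: le_lt_trans (second_moment_lty 0); apply: ge0_le_integral => //.
- by move=> u _; rewrite lee_fin sqr_ge0.
- by apply/measurable_EFinP; exact: measurable_funX.
- exact: m_second_moment.
move=> u _; case: (IabP a b u) => Iu; last first.
  rewrite cutN // expr0n; apply: integral_ge0 => w _.
  by rewrite lee_fin addr_ge0 ?sqr_ge0.
apply: (@le_trans _ _ (\int[P]_w (cut (X 0 w) u ^+ 2)%:E)%E); last first.
  have mXu := m_section (F := fun w => cut (X 0 w)) u (measurable_cut_joint (mX 0)).
  have mnu := m_section (F := noise 0) u (measurable_noise 0).
  apply: ge0_le_integral => //.
  - by move=> w _; rewrite lee_fin sqr_ge0.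
  - by apply/measurable_EFinP; exact: measurable_funX.
  - by apply/measurable_EFinP; apply: measurable_funD; exact: measurable_funX.
  - by move=> w _; rewrite lee_fin lerDl sqr_ge0.
have -> : (\int[P]_w (cut (X 0 w) u ^+ 2)%:E)%E = (ip P (fun w => X 0 w u) (fun w => X 0 w u))%:E.
  by rewrite EFin_ip; [apply: eq_integral => w _; rewrite cutE|exact: sqint_X].
have := ip_ge0 P (fun w => xc 0 w u); have := cov_xc 0 0 Iu Iu.
rewrite addr0 /crosscov => ->.
have [_ /Ex_Rintegral] := X_cov 0 0 Iu Iu.
by rewrite addr0 lee_fin cutE // /ip => ->; rewrite -expr2 lerDr.
Qed.

Let sqnorm t w := (\int[lebm]_u (yc t w u ^+ 2)%:E)%E.

Let sqnorm_ge0 t w : (0 <= sqnorm t w)%E.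
Proof. by apply: integral_ge0 => u _; rewrite lee_fin sqr_ge0. Qed.

Let measurable_sqnorm t : measurable_fun setT (sqnorm t).
Proof.
apply: (measurable_integral_param lebm (F := fun q : Omega * R => (yc t q.1 q.2 ^+ 2)%:E)).
by apply/measurable_EFinP; apply: measurable_funX; exact: measurable_yc.
Qed.

Let sqnorm_le t w : (sqnorm t w <= 2%:E * \int[lebm]_(u in Iab a b) (Y t w u ^+ 2)%:E
  + (2 * ip lebm (cut mu) (cut mu))%:E)%E.
Proof.
have mY : measurable_fun setT (cut (Y t w)).
  have -> : cut (Y t w) = fun u => yc t w u + cut mu u.
    by apply/funext => u; rewrite /yc /cut; case: ifP; rewrite ?subrK ?addr0.
  apply: measurable_funD; last exact: measurable_cut_mean.
  exact: (measurable_section1 w (measurable_yc t)).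
have [mm _] := sqint_cut_mean.
rewrite integral_Iab EFinM (EFin_ip sqint_cut_mean).
under [X in (_ <= _ * X + _)%E]eq_integral do rewrite (cut_sq _ _ (Y t w)).
have msY : measurable_fun setT (fun u => (cut (Y t w) u ^+ 2)%:E).
  by apply/measurable_EFinP; exact: measurable_funX.
have msm : measurable_fun setT (fun u => (cut mu u ^+ 2)%:E).
  by apply/measurable_EFinP; exact: measurable_funX.
have sY u : (0 <= (cut (Y t w) u ^+ 2)%:E)%E by rewrite lee_fin sqr_ge0.
have sm u : (0 <= (cut mu u ^+ 2)%:E)%E by rewrite lee_fin sqr_ge0.
rewrite -!ge0_integralZl // -ge0_integralD //; first last.
- exact: measurable_funeM.
- by move=> u _; rewrite mule_ge0.
- exact: measurable_funeM.
- by move=> u _; rewrite mule_ge0.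
apply: ge0_le_integral => //.
- by move=> u _; rewrite lee_fin sqr_ge0.
- apply/measurable_EFinP; apply: measurable_funX.
  exact: (measurable_section1 w (measurable_yc t)).
- by apply: emeasurable_funD; exact: measurable_funeM.
move=> u _; rewrite -!EFinM -EFinD lee_fin /yc /cut; case: ifP => _; last by rewrite expr0n /= mulr0 addr0.
have := sqr_ge0 (Y t w u + mu u); nra.
Qed.

(** From (2 B + 2 c)^2 <= 8 B^2 + 8 c^2, where B is the squared norm of the uncentred path; B = +oo
    is a separate, trivial case. *)
Let sqnorm_sq_lty t : (\int[P]_w (sqnorm t w * sqnorm t w) < +oo)%E.
Proof.
set c := ip lebm (cut mu) (cut mu).
have c0 : 0 <= c by exact: ip_ge0.
pose B w := (\int[lebm]_(u in Iab a b) (Y t w u ^+ 2)%:E)%E.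
have B0 w : (0 <= B w)%E by apply: integral_ge0 => u _; rewrite lee_fin sqr_ge0.
have mB : measurable_fun setT B.
  have -> : B = fun w => (\int[lebm]_u ((yc t w u + cut mu u) ^+ 2)%:E)%E.
    apply/funext => w; rewrite /B integral_Iab; apply: eq_integral => u _.
    by congr EFin; rewrite /yc /cut; case: ifP; rewrite ?subrK ?addr0 ?expr0n.
  apply: (measurable_integral_param lebm
    (F := fun q : Omega * R => ((yc t q.1 q.2 + cut mu q.2) ^+ 2)%:E)).
  apply/measurable_EFinP; apply: measurable_funX; apply: measurable_funD.
    exact: measurable_yc.
  exact: (measurableT_comp measurable_cut_mean measurable_snd).
have mBB : measurable_fun setT (fun w => (B w * B w)%E) by exact: emeasurable_funM.
apply: (@le_lt_trans _ _ (\int[P]_w (8%:E * (B w * B w) + (8 * c ^+ 2)%:E))%E); last first.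
  rewrite ge0_integralD //; first last.
  - by move=> w _; rewrite lee_fin mulr_ge0 // sqr_ge0.
  - exact: measurable_funeM.
  - by move=> w _; rewrite !mule_ge0.
  rewrite lte_add_pinfty //.
    rewrite ge0_integralZl //; last by move=> w _; rewrite mule_ge0.
    by rewrite lte_mul_pinfty // Y_four.
  by apply: integrable_lty => //; exact: (finite_measure_integrable_cst P (8 * c ^+ 2)).
apply: ge0_le_integral => //.
- by move=> w _; rewrite mule_ge0.
- by apply: emeasurable_funM; exact: measurable_sqnorm.
- by apply: emeasurable_funD => //; exact: measurable_funeM.
move=> w _; have := sqnorm_le t w; rewrite -/(B w) -/c.
have := sqnorm_ge0 t w; have := B0 w.
case: (B w) => [r| |] // r0.
  case: (sqnorm t w) => [q| |] // q0.
  rewrite -!EFinM -!EFinD !lee_fin in r0 q0 * => qr.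
  have := ler_pM q0 q0 qr qr; have := sqr_ge0 (r - c); nra.
by move=> _ _; rewrite mulyy gt0_muley ?lte_fin // addye // leey.
Qed.

(** By Tonelli the triple integral is the expected product of the squared norms of two paths, and x
    y <= x^2 + y^2 reduces it to C2. *)
Lemma fourth_moment_yc s t :
  (\int[lebm]_v \int[lebm]_u \int[P]_w ((yc s w u * yc t w v) ^+ 2)%:E < +oo)%E.
Proof.
have m2 (F : Omega -> R -> R) : measurable_fun setT (fun q : Omega * R => F q.1 q.2) ->
    measurable_fun setT (fun q : R * Omega => F q.2 q.1).
  move=> mF; have mswap : measurable_fun setT (fun z : R * Omega => (z.2, z.1)).
    exact: measurable_fun_pair.
  exact: (measurableT_comp mF mswap).
have mysq r w : measurable_fun setT (fun u => (yc r w u ^+ 2)%:E).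
  apply/measurable_EFinP; apply: measurable_funX.
  exact: (measurable_section1 w (measurable_yc r)).
have myu r u := m_section (F := yc r) u (measurable_yc r).
have sq0 r w u : (0 <= (yc r w u ^+ 2)%:E)%E by rewrite lee_fin sqr_ge0.
have -> : (\int[lebm]_v \int[lebm]_u \int[P]_w ((yc s w u * yc t w v) ^+ 2)%:E =
    \int[P]_w (sqnorm s w * sqnorm t w))%E.
  transitivity (\int[lebm]_v \int[P]_w (sqnorm s w * (yc t w v ^+ 2)%:E))%E.
    apply: eq_integral => v _.
    rewrite (fubini_tonelli (m1 := lebm) (m2 := P)
      (fun q => ((yc s q.2 q.1 * yc t q.2 v) ^+ 2)%:E)) /=; first last.
    - by move=> q; rewrite lee_fin sqr_ge0.
    - apply/measurable_EFinP; apply: measurable_funX; apply: measurable_funM.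
        by apply: m2; exact: measurable_yc.
      exact: (measurableT_comp (myu t v) measurable_snd).
    apply: eq_integral => w _; rewrite -ge0_integralZr //.
      by apply: eq_integral => u _; rewrite -EFinM exprMn.
    exact: mysq.
  transitivity (\int[P]_w \int[lebm]_v (sqnorm s w * (yc t w v ^+ 2)%:E))%E.
    apply: (fubini_tonelli (m1 := lebm) (m2 := P)
      (fun q => (sqnorm s q.2 * (yc t q.2 q.1 ^+ 2)%:E)%E)) => [|q]; last by rewrite mule_ge0.
    apply: emeasurable_funM; first exact: (measurableT_comp (measurable_sqnorm s) measurable_snd).
    by apply/measurable_EFinP; apply: measurable_funX; apply: m2; exact: measurable_yc.
  by apply: eq_integral => w _; rewrite ge0_integralZl //; exact: mysq.
have mss r : measurable_fun setT (fun w => (sqnorm r w * sqnorm r w)%E).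
  by apply: emeasurable_funM; exact: measurable_sqnorm.
apply: (@le_lt_trans _ _ (\int[P]_w (sqnorm s w * sqnorm s w + sqnorm t w * sqnorm t w))%E).
  apply: ge0_le_integral => //.
  - by move=> w _; rewrite mule_ge0.
  - by apply: emeasurable_funM; exact: measurable_sqnorm.
  - exact: emeasurable_funD.
  move=> w _; have [st|/ltW ts] := leP (sqnorm s w) (sqnorm t w).
    apply: (@le_trans _ _ (sqnorm t w * sqnorm t w)%E); first exact: lee_wpmul2r.
    by rewrite leeDr // mule_ge0.
  apply: (@le_trans _ _ (sqnorm s w * sqnorm s w)%E); first exact: lee_wpmul2l.
  by rewrite leeDl // mule_ge0.
have sn0 r w : (0 <= sqnorm r w * sqnorm r w)%E by rewrite mule_ge0.
by rewrite ge0_integralD //; apply: lte_add_pinfty; exact: sqnorm_sq_lty.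
Qed.

End model.

(** * Stochastic bounds for the empirical autocovariances *)

Section moment_bounds.
Variables (R : realType) (d0 : measure_display) (Omega : measurableType d0).
Variables (P : probability Omega R).

Lemma markov_ge0 (g : Omega -> \bar R) (c r : R) : measurable_fun setT g ->
  (forall w, 0 <= g w)%E -> 0 < r -> (\int[P]_w g w <= c%:E)%E ->
  (P [set w | r%:E <= g w] <= (c / r)%:E)%E.
Proof.
move=> mg g0 r0 gc.
have := @le_integral_comp_abse _ _ _ P setT measurableT g r id (@measurable_id _ _ _)
  (fun _ h => h) (fun _ _ _ _ h => h) mg r0.
rewrite setTI /=.
have -> : [set w | (r%:E <= `|g w|)%E] = [set w | (r%:E <= g w)%E].
  by apply/seteqP; split => w /=; rewrite gee0_abs.
under eq_integral do rewrite gee0_abs //.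
move=> /le_trans /(_ gc) H.
by rewrite EFinM muleC lee_pdivlMl.
Qed.

(** Markov's inequality for sum_i s g_i yields a single exceptional event for the whole family. [L]
    = S / e + 1 depends neither on [g] nor on [s], hence not on the sample size; the added 1 ensures
    L >= 1, so that L <= L^2 later. *)
Lemma tight_family (I : finType) (K : I -> R) (e : R) : (forall i, 0 <= K i) -> 0 < e ->
  exists L, 1 <= L /\ forall (g : I -> Omega -> \bar R) (s : R),
    (forall i, measurable_fun setT (g i)) -> (forall i w, 0 <= g i w)%E -> 0 < s ->
    (forall i, \int[P]_w g i w <= (K i / s)%:E)%E ->
    exists A, [/\ measurable A, (P A <= e%:E)%E &
      forall w, ~ A w -> forall i, (g i w <= (L / s)%:E)%E].
Proof.
move=> K0 e0; set S := \sum_i K i; have S0 : 0 <= S by exact: sumr_ge0.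
have L1 : 1 <= S / e + 1 by rewrite lerDr divr_ge0 // ltW.
have L0 : 0 < S / e + 1 by rewrite (lt_le_trans _ L1).
exists (S / e + 1); split => // g s mg g0 s0 gK.
pose h w := (\sum_(i <- index_enum I) s%:E * g i w)%E.
have t0 i w : (0 <= s%:E * g i w)%E by rewrite mule_ge0 // lee_fin ltW.
have mt i : measurable_fun setT (fun w => s%:E * g i w)%E by exact: measurable_funeM.
have mh : measurable_fun setT h by exact: emeasurable_sum.
have h0 w : (0 <= h w)%E by exact: sume_ge0.
have hS : (\int[P]_w h w <= S%:E)%E.
  rewrite ge0_integral_sum // /S -sumEFin; apply: lee_sum => i _.
  rewrite ge0_integralZl ?lee_fin ?(ltW s0) //.
  have -> : (K i)%:E = (s%:E * (K i / s)%:E)%E by rewrite -EFinM mulrC divfK ?lt0r_neq0.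
  by rewrite lee_wpmul2l // lee_fin ltW.
exists [set w | ((S / e + 1)%:E <= h w)%E]; split.
- by rewrite -[X in measurable X]setTI; exact: emeasurable_fun_c_infty.
- apply: le_trans (markov_ge0 mh h0 L0 hS) _; rewrite lee_fin ler_pdivrMr // mulrDr mulr1.
  by rewrite mulrC divfK ?lt0r_neq0 // lerDl ltW.
move=> w /= /negP; rewrite -ltNge => hw i.
rewrite EFinM muleC lee_pdivlMl //; apply: le_trans (ltW hw).
by rewrite /h (bigD1_seq i) ?mem_index_enum ?index_enum_uniq //= leeDl // sume_ge0.
Qed.

Variable lebm : {sigma_finite_measure set (measurableTypeR R) -> \bar R}.

Lemma total_square_bound (F : Omega -> R -> R) (q : R -> \bar R) (K : R) :
  measurable_fun setT (fun z : Omega * R => F z.1 z.2) -> measurable_fun setT q ->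
  (forall u, 0 <= q u)%E -> 0 <= K ->
  (forall u, \int[P]_w (F w u ^+ 2)%:E <= K%:E * q u)%E ->
  (\int[P]_w \int[lebm]_u (F w u ^+ 2)%:E <= K%:E * \int[lebm]_u q u)%E.
Proof.
move=> mF mq q0 K0 Fq.
have msq : measurable_fun setT (fun z : Omega * R => (F z.1 z.2 ^+ 2)%:E).
  by apply/measurable_EFinP; exact: measurable_funX.
rewrite (fubini_tonelli (m1 := P) (m2 := lebm) (fun z => (F z.1 z.2 ^+ 2)%:E)) //=; last first.
  by move=> z; rewrite lee_fin sqr_ge0.
rewrite -ge0_integralZl // ?lee_fin //; apply: ge0_le_integral => //.
- by move=> u _; apply: integral_ge0 => w _; rewrite lee_fin sqr_ge0.
- apply: (measurable_integral_param P (F := fun z : R * Omega => (F z.2 z.1 ^+ 2)%:E)).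
  have mswap : measurable_fun setT (fun z : R * Omega => (z.2, z.1)) by exact: measurable_fun_pair.
  exact: (measurableT_comp msq mswap).
- exact: measurable_funeM.
Qed.

Lemma total_square_bound2 (F : Omega -> R -> R -> R) (q : R -> R -> \bar R) (K : R) :
  measurable_fun setT (fun z : (Omega * R) * R => F z.1.1 z.1.2 z.2) ->
  measurable_fun setT (fun z : R * R => q z.1 z.2) ->
  (forall u v, 0 <= q u v)%E -> 0 <= K ->
  (forall u v, \int[P]_w (F w u v ^+ 2)%:E <= K%:E * q u v)%E ->
  (\int[P]_w \int[lebm]_v \int[lebm]_u (F w u v ^+ 2)%:E <=
     K%:E * \int[lebm]_v \int[lebm]_u q u v)%E.
Proof.
move=> mF mq q0 K0 Fq.
have mqs : measurable_fun setT (fun z : R * R => q z.2 z.1).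
  have mswap : measurable_fun setT (fun z : R * R => (z.2, z.1)) by exact: measurable_fun_pair.
  exact: (measurableT_comp mq mswap).
have mIq : measurable_fun setT (fun v => \int[lebm]_u q u v)%E.
  exact: (measurable_integral_param lebm (F := fun z : R * R => q z.2 z.1)).
have mFv : measurable_fun setT (fun z : (Omega * R) * R => (F z.1.1 z.2 z.1.2 ^+ 2)%:E).
  apply/measurable_EFinP; apply: measurable_funX.
  have mperm : measurable_fun setT (fun z : (Omega * R) * R => ((z.1.1, z.2), z.1.2)).
    apply: measurable_fun_pair; last exact: (measurableT_comp measurable_snd measurable_fst).
    apply: measurable_fun_pair; last exact: measurable_snd.
    exact: (measurableT_comp measurable_fst measurable_fst).
  exact: (measurableT_comp mF mperm).
have mFi := measurable_integral_param lebm mFv.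
rewrite (fubini_tonelli (m1 := P) (m2 := lebm)
    (fun z => \int[lebm]_u (F z.1 u z.2 ^+ 2)%:E)%E) //=; last first.
  by move=> z; apply: integral_ge0 => u _; rewrite lee_fin sqr_ge0.
rewrite -ge0_integralZl // ?lee_fin //; last by move=> v _; apply: integral_ge0.
apply: ge0_le_integral => //.
- by move=> v _; apply: integral_ge0 => w _; apply: integral_ge0 => u _; rewrite lee_fin sqr_ge0.
- apply: (measurable_integral_param P
    (F := fun z : R * Omega => (\int[lebm]_u (F z.2 u z.1 ^+ 2)%:E)%E)).
  have mswap : measurable_fun setT (fun z : R * Omega => (z.2, z.1)) by exact: measurable_fun_pair.
  exact: (measurableT_comp mFi mswap).
- exact: measurable_funeM.
move=> v _; apply: (total_square_bound (F := fun w u => F w u v) (q := q ^~ v)) => //.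
- have mpair : measurable_fun setT (fun z : Omega * R => (z, v)) by exact: measurable_pair2.
  exact: (measurableT_comp mF mpair).
- exact: (measurable_section2 v mq).
Qed.

End moment_bounds.

Section error_bounds.
Variables (R : realType) (d0 : measure_display) (Omega : measurableType d0).
Variables (P : probability Omega R) (a b : R).
Variables (X eps Y : int -> Omega -> R -> R) (mu : R -> R) (M : nat -> R -> R -> R).
Local Notation lebm := (@lebesgue_measure R).
Local Notation cut := (cut a b).
Hypothesis YE : forall t w u, Y t w u = X t w u + eps t w u.
Hypothesis mX : forall t, measurable_fun (setT `*` Iab a b) (fun q : Omega * R => X t q.1 q.2).
Hypothesis meps : forall t, measurable_fun (setT `*` Iab a b) (fun q : Omega * R => eps t q.1 q.2).
Hypothesis eps_mean : forall t u, Iab a b u ->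
  P.-integrable setT (fun w => (eps t w u)%:E) /\ Ex P (fun w => eps t w u) = 0%E.
Hypothesis eps_white : forall t s u v, t != s -> Iab a b u -> Iab a b v ->
  P.-integrable setT (fun w => (eps t w u * eps s w v)%:E) /\
  Ex P (fun w => eps t w u * eps s w v) = 0%E.
Hypothesis sq_fin : forall t, (\int[lebm]_(u in Iab a b)
  Ex P (fun w => (X t w u ^+ 2 + eps t w u ^+ 2)%R) < +oo)%E.
Hypothesis X_mean : forall t u, Iab a b u ->
  P.-integrable setT (fun w => (X t w u)%:E) /\ Ex P (fun w => X t w u) = (mu u)%:E.
Hypothesis X_cov : forall t (k : nat) u v, Iab a b u -> Iab a b v ->
  P.-integrable setT (fun w => (X t w u * X (t + k%:Z) w v)%:E) /\
  Ex P (fun w => X t w u * X (t + k%:Z) w v) = (M k u v + mu u * mu v)%:E.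
Hypothesis X_eps : forall s t u v, Iab a b u -> Iab a b v ->
  P.-integrable setT (fun w => (X s w u * eps t w v)%:E) /\
  Ex P (fun w => X s w u * eps t w v) = 0%E.
Hypothesis Y_four : forall t, (\int[P]_w ((\int[lebm]_(u in Iab a b) ((Y t w u) ^+ 2)%R%:E) *
  (\int[lebm]_(u in Iab a b) ((Y t w u) ^+ 2)%R%:E)) < +oo)%E.

Hypothesis stat : strictly_stationary P a b Y.
Variables (c : nat -> R) (S : R).
Hypotheses (c0 : forall l, 0 <= c l) (cS : forall N, \sum_(1 <= l < N) c l <= S).
Hypothesis mix : forall (l : nat) (A B : set Omega), (0 < l)%N ->
  gen_sigma a b Y [set t | t <= 0] A -> gen_sigma a b Y [set t | l%:Z <= t] B ->
  (0 < P A)%E -> (0 < P B)%E ->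
  `|1 - fine (P (A `&` B)) / (fine (P A) * fine (P B))| <= c l.
Local Notation yc := (yc a b Y mu).
Local Notation xc := (xc a b X mu).
Local Notation G k := (crosscov P (xc 0) (xc k%:Z)).

Let measurable_Y t u : Iab a b u -> measurable_fun setT (fun w => Y t w u).
Proof.
move=> Iu; under eq_fun do rewrite YE; apply: measurable_funD.
  by have [/rintegrable_measurable] := X_mean t Iu.
by have [/rintegrable_measurable] := eps_mean t Iu.
Qed.

Let S0 : 0 <= S.
Proof. by have := cS 0%N; rewrite big_geq. Qed.

Let variance_sum_yc u (m : nat) (t0 : int) : (0 < m)%N ->
  (\int[P]_w ((\sum_(i < m) yc (t0 + i%:Z) w u) ^+ 2)%:E <=
   (m%:R * (2 * (1 + S)))%:E * \int[P]_w (yc 0 w u ^+ 2)%:E)%E.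
Proof.
move=> m0; case: (IabP a b u) => Iu; last first.
  rewrite (eq_integral (fun=> 0%E)) => [|w _]; last first.
    by rewrite big1 ?expr0n // => i _; exact: cutN.
  rewrite integral0; apply: mule_ge0; last first.
    by apply: integral_ge0 => w _; rewrite lee_fin sqr_ge0.
  by rewrite lee_fin !mulr_ge0 // addr_ge0.
pose f (y : R * R) := y.1 - mu u.
have mf : measurable_fun setT f by apply: measurable_funB => //; exact: measurable_cst.
have fE t w : f (Y t w u, Y (t + 0%:Z) w u) = yc t w u by rewrite [RHS]cutE.
have H := variance_sum_process measurable_Y stat mf Iu Iu (k := 0) (g := 0) t0 m0 c0 cS mix.
have /H {H} : forall t, \int[P]_w f (Y t w u, Y (t + 0%:Z) w u) = 0.
  move=> t; under eq_Rintegral do rewrite fE.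
  by have [] := mean_yc YE eps_mean X_mean t u.
under eq_integral do under eq_bigr do rewrite fE subr0.
by under [X in (_ <= _ * X)%E -> _]eq_integral do rewrite fE.
Qed.

Let variance_sum_product u v (k m : nat) (t0 : int) : (0 < k)%N -> (0 < m)%N ->
  (\int[P]_w ((\sum_(i < m) (yc (t0 + i%:Z) w u * yc (t0 + i%:Z + k%:Z) w v - G k u v)) ^+ 2)%:E <=
   (m%:R * (2 * (k.+1%:R + S)))%:E * \int[P]_w ((yc 0 w u * yc k%:Z w v) ^+ 2)%:E)%E.
Proof.
move=> k0 m0; case: (pselect (Iab a b u /\ Iab a b v)) => [[Iu Iv]|H]; last first.
  have {}H : ~ Iab a b u \/ ~ Iab a b v by apply/not_andP.
  rewrite cov_xc_out //.
  have z t s w : yc t w u * yc s w v = 0.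
    by case: H => H; [rewrite [yc _ _ u]cutN // mul0r|rewrite [yc _ _ v]cutN // mulr0].
  rewrite (eq_integral (fun=> 0%E)) => [|w _]; last first.
    by rewrite big1 ?expr0n // => i _; rewrite z subr0.
  rewrite integral0; apply: mule_ge0; last first.
    by apply: integral_ge0 => w _; rewrite lee_fin sqr_ge0.
  by rewrite lee_fin !mulr_ge0 // addr_ge0.
pose f (y : R * R) := (y.1 - mu u) * (y.2 - mu v).
have mf : measurable_fun setT f.
  by apply: measurable_funM; apply: measurable_funB => //; exact: measurable_cst.
have fE t w : f (Y t w u, Y (t + k%:Z) w v) = yc t w u * yc (t + k%:Z) w v.
  by rewrite [yc _ _ u]cutE // [yc _ _ v]cutE.
have H := variance_sum_process measurable_Y stat mf Iu Iv (k := k) (g := G k u v) t0 m0 c0 cS mix.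
have /H {H} : forall t, \int[P]_w f (Y t w u, Y (t + k%:Z) w v) = G k u v.
  move=> t; under eq_Rintegral do rewrite fE.
  exact: (autocov_yc YE eps_mean eps_white X_mean X_cov X_eps).
under eq_integral do under eq_bigr do rewrite fE.
by under [X in (_ <= _ * X)%E -> _]eq_integral do rewrite fE add0r.
Qed.

Let m_yc := measurable_yc YE mX meps X_mean.

Lemma lagmean_bound : exists K : R, 0 <= K /\ forall k m : nat, (0 < m)%N ->
  (\int[P]_w \int[lebm]_u (lagmean (fun j => yc j%:Z w) m k u ^+ 2)%:E <= (K / m%:R)%:E)%E.
Proof.
pose Q := (\int[lebm]_u \int[P]_w (yc 0 w u ^+ 2)%:E)%E.
have Q0 : (0 <= Q)%E.
  by apply: integral_ge0 => u _; apply: integral_ge0 => w _; rewrite lee_fin sqr_ge0.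
have Qoo : (Q < +oo)%E := total_variance_yc YE mX meps sq_fin X_mean X_cov 0.
have QE : Q = (fine Q)%:E by rewrite fineK // ge0_fin_numE.
exists (2 * (1 + S) * fine Q); split.
  by rewrite !mulr_ge0 ?addr_ge0 ?fine_ge0.
move=> k m m0.
have mR : 0 < m%:R :> R by rewrite ltr0n.
have mswap : measurable_fun setT (fun z : R * Omega => (z.2, z.1)) by exact: measurable_fun_pair.
apply: (@le_trans _ _ ((2 * (1 + S) / m%:R)%:E * Q)%E); last first.
  by rewrite QE -EFinM mulrAC.
apply: (total_square_bound lebm (F := fun w u => lagmean (fun j => yc j%:Z w) m k u)).
- apply: measurable_funM; first exact: measurable_cst.
  by apply: measurable_sum => i; exact: m_yc.
- apply: (measurable_integral_param P (F := fun z : R * Omega => (yc 0 z.2 z.1 ^+ 2)%:E)).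
  apply/measurable_EFinP; apply: measurable_funX; exact: (measurableT_comp (m_yc 0) mswap).
- by move=> u; apply: integral_ge0 => w _; rewrite lee_fin sqr_ge0.
- by rewrite !mulr_ge0 ?addr_ge0 ?invr_ge0.
move=> u; have H := variance_sum_yc u (1 + k%:Z) m0.
have E w : (lagmean (fun j => yc j%:Z w) m k u ^+ 2)%:E =
    ((m%:R ^- 2)%:E * ((\sum_(i < m) yc (1 + k%:Z + i%:Z) w u) ^+ 2)%:E)%E.
  rewrite -EFinM -exprVn -exprMn; congr (((_ * _) ^+ _)%:E); apply: eq_bigr => i _.
  by congr (yc _ w u); lia.
under eq_integral do rewrite E.
have c2 : (0 <= (m%:R ^- 2 : R)%:E)%E by rewrite lee_fin invr_ge0 exprn_ge0.
have mS : measurable_fun setT (fun w => ((\sum_(i < m) yc (1 + k%:Z + i%:Z) w u) ^+ 2)%:E).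
  apply/measurable_EFinP; apply: measurable_funX; apply: measurable_sum => i.
  exact: (measurable_section2 u (m_yc _)).
rewrite ge0_integralZl //; last by move=> w _; rewrite lee_fin sqr_ge0.
have -> : (2 * (1 + S) / m%:R)%:E = ((m%:R ^- 2)%:E * (m%:R * (2 * (1 + S)))%:E)%E.
  by rewrite -EFinM; congr EFin; field; rewrite lt0r_neq0.
by rewrite -muleA; exact: lee_wpmul2l.
Qed.

Lemma lagprod_bound (k : nat) : (0 < k)%N -> exists K : R, 0 <= K /\ forall m : nat, (0 < m)%N ->
  (\int[P]_w HS lebm (fun u v => lagprod (fun j => yc j%:Z w) m k u v - G k u v)%R
    <= (K / m%:R)%:E)%E.
Proof.
move=> k0.
pose Q := (\int[lebm]_v \int[lebm]_u \int[P]_w ((yc 0 w u * yc k%:Z w v) ^+ 2)%:E)%E.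
have Q0 : (0 <= Q)%E.
  apply: integral_ge0 => v _; apply: integral_ge0 => u _; apply: integral_ge0 => w _.
  by rewrite lee_fin sqr_ge0.
have Qoo : (Q < +oo)%E := fourth_moment_yc YE mX meps sq_fin X_mean X_cov Y_four 0 k%:Z.
have QE : Q = (fine Q)%:E by rewrite fineK // ge0_fin_numE.
exists (2 * (k.+1%:R + S) * fine Q); split.
  by rewrite !mulr_ge0 ?addr_ge0 ?fine_ge0.
move=> m m0.
have mR : 0 < m%:R :> R by rewrite ltr0n.
have my1 t : measurable_fun setT (fun z : (Omega * R) * R => yc t z.1.1 z.1.2).
  exact: (measurableT_comp (m_yc t) measurable_fst).
have my2 t : measurable_fun setT (fun z : (Omega * R) * R => yc t z.1.1 z.2).
  have mpr : measurable_fun setT (fun z : (Omega * R) * R => (z.1.1, z.2)).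
    by apply: measurable_fun_pair => //; exact: (measurableT_comp measurable_fst measurable_fst).
  exact: (measurableT_comp (m_yc t) mpr).
have mG : measurable_fun setT (fun z : R * R => G k z.1 z.2).
  by apply: measurable_crosscov; exact: (measurable_xc mX X_mean).
apply: (@le_trans _ _ ((2 * (k.+1%:R + S) / m%:R)%:E * Q)%E); last first.
  by rewrite QE -EFinM mulrAC.
rewrite /HS /Q; apply: (total_square_bound2 (P := P) lebm (K := 2 * (k.+1%:R + S) / m%:R)
  (F := fun w u v => (lagprod (fun j => yc j%:Z w) m k u v - G k u v)%R)
  (q := fun u v => \int[P]_w ((yc 0 w u * yc k%:Z w v) ^+ 2)%:E)%E).
- apply: measurable_funB.
    apply: measurable_funM; first exact: measurable_cst.
    by apply: measurable_sum => i; apply: measurable_funM; [exact: my1|exact: my2].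
  have mpr : measurable_fun setT (fun z : (Omega * R) * R => (z.1.2, z.2)).
    by apply: measurable_fun_pair => //; exact: (measurableT_comp measurable_snd measurable_fst).
  exact: (measurableT_comp mG mpr).
- apply: (measurable_integral_param P
    (F := fun z : (R * R) * Omega => ((yc 0 z.2 z.1.1 * yc k%:Z z.2 z.1.2) ^+ 2)%:E)).
  apply/measurable_EFinP; apply: measurable_funX; apply: measurable_funM.
    have mpr : measurable_fun setT (fun z : (R * R) * Omega => (z.2, z.1.1)).
      by apply: measurable_fun_pair => //; exact: (measurableT_comp measurable_fst measurable_fst).
    exact: (measurableT_comp (m_yc 0) mpr).
  have mpr : measurable_fun setT (fun z : (R * R) * Omega => (z.2, z.1.2)).
    by apply: measurable_fun_pair => //; exact: (measurableT_comp measurable_snd measurable_fst).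
  exact: (measurableT_comp (m_yc k%:Z) mpr).
- by move=> u v; apply: integral_ge0 => w _; rewrite lee_fin sqr_ge0.
- by rewrite !mulr_ge0 ?addr_ge0 ?invr_ge0.
move=> u v; have H := variance_sum_product u v 1 k0 m0.
have E w : ((lagprod (fun j => yc j%:Z w) m k u v - G k u v) ^+ 2)%:E =
    ((m%:R ^- 2)%:E * ((\sum_(i < m) (yc (1 + i%:Z) w u * yc (1 + i%:Z + k%:Z) w v
       - G k u v)) ^+ 2)%:E)%E.
  rewrite -EFinM -exprVn -exprMn; congr ((_ ^+ _)%:E).
  rewrite sumrB sumr_const card_ord mulrBr -[G k u v *+ m]mulr_natl mulKf ?lt0r_neq0 //.
under eq_integral do rewrite E.
have c2 : (0 <= (m%:R ^- 2 : R)%:E)%E by rewrite lee_fin invr_ge0 exprn_ge0.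
have mS : measurable_fun setT (fun w => ((\sum_(i < m) (yc (1 + i%:Z) w u *
    yc (1 + i%:Z + k%:Z) w v - G k u v)) ^+ 2)%:E).
  apply/measurable_EFinP; apply: measurable_funX; apply: measurable_sum => i.
  apply: measurable_funB; last exact: measurable_cst.
  by apply: measurable_funM; exact: (measurable_section2 _ (m_yc _)).
rewrite ge0_integralZl //; last by move=> w _; rewrite lee_fin sqr_ge0.
have -> : (2 * (k.+1%:R + S) / m%:R)%:E = ((m%:R ^- 2)%:E * (m%:R * (2 * (k.+1%:R + S)))%:E)%E.
  by rewrite -EFinM; congr EFin; field; rewrite lt0r_neq0.
by rewrite -muleA; exact: lee_wpmul2l.
Qed.

Lemma measurable_lagmean_norm (k m : nat) : measurable_fun setT
  (fun w => \int[lebm]_u (lagmean (fun j => yc j%:Z w) m k u ^+ 2)%:E)%E.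
Proof.
apply: (measurable_integral_param lebm
  (F := fun z : Omega * R => (lagmean (fun j => yc j%:Z z.1) m k z.2 ^+ 2)%:E)).
apply/measurable_EFinP; apply: measurable_funX; apply: measurable_funM.
  exact: measurable_cst.
by apply: measurable_sum => i; exact: m_yc.
Qed.

Lemma measurable_lagprod_HS (k m : nat) : measurable_fun setT
  (fun w => HS lebm (fun u v => lagprod (fun j => yc j%:Z w) m k u v - G k u v)%R).
Proof.
apply: (measurable_integral_param lebm (F := fun z : Omega * R =>
  (\int[lebm]_u ((lagprod (fun j => yc j%:Z z.1) m k u z.2 - G k u z.2) ^+ 2)%:E)%E)).
apply: (measurable_integral_param lebm (F := fun z : (Omega * R) * R =>
  ((lagprod (fun j => yc j%:Z z.1.1) m k z.2 z.1.2 - G k z.2 z.1.2) ^+ 2)%:E)).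
have mG : measurable_fun setT (fun z : R * R => G k z.1 z.2).
  by apply: measurable_crosscov; exact: (measurable_xc mX X_mean).
have mp1 : measurable_fun setT (fun z : (Omega * R) * R => (z.1.1, z.2)).
  by apply: measurable_fun_pair => //; exact: (measurableT_comp measurable_fst measurable_fst).
have mp2 : measurable_fun setT (fun z : (Omega * R) * R => (z.2, z.1.2)).
  by apply: measurable_fun_pair => //; exact: (measurableT_comp measurable_snd measurable_fst).
apply/measurable_EFinP; apply: measurable_funX; apply: measurable_funB.
  apply: measurable_funM; first exact: measurable_cst.
  apply: measurable_sum => i; apply: measurable_funM.
    exact: (measurableT_comp (m_yc _) mp1).
  exact: (measurableT_comp (m_yc _) measurable_fst).
exact: (measurableT_comp mG mp2).
Qed.

Lemma ae_sqint_yc : {ae P, forall w, forall j : nat, sqint lebm (yc j%:Z w)}.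
Proof.
apply: ae_foralln => j; have H := @ae_sqint_of_total _ _ (measurableTypeR R) _ _ lebm P (yc j%:Z) (m_yc _).
apply: H; apply: le_lt_trans (total_variance_yc YE mX meps sq_fin X_mean X_cov j%:Z).
rewrite (fubini_tonelli (m1 := P) (m2 := lebm) (fun z => (yc j%:Z z.1 z.2 ^+ 2)%:E)) //=.
  by apply/measurable_EFinP; apply: measurable_funX; exact: m_yc.
by move=> z; rewrite lee_fin sqr_ge0.
Qed.

Lemma lag_errors_tight (p : nat) (e : R) : 0 < e -> exists L, 1 <= L /\
  forall m n : nat, (0 < m)%N -> (m <= n)%N -> exists A, [/\ measurable A, (P A <= e%:E)%E &
    forall w, ~ A w -> let z j := yc (j : nat)%:Z w in
    [/\ forall k, (k <= p)%N -> (\int[lebm]_u (lagmean z m k u ^+ 2)%:E <= (L / m%:R)%:E)%E,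
        (\int[lebm]_u (lagmean z n 0 u ^+ 2)%:E <= (L / m%:R)%:E)%E &
        forall k : 'I_p, (HS lebm (fun u v => lagprod z m k.+1 u v - G k.+1 u v)%R
           <= (L / m%:R)%:E)%E]].
Proof.
move=> e0; have [KV [KV0 boundV]] := lagmean_bound.
have /choice[KU boundU] : forall k : 'I_p, exists K, 0 <= K /\ forall m, (0 < m)%N ->
    (\int[P]_w HS lebm (fun u v => (lagprod (fun j => yc j%:Z w) m k.+1 u v - G k.+1 u v)%R)
      <= (K / m%:R)%:E)%E.
  by move=> k; exact: lagprod_bound.
(* The family consists of p + 1 lagged means, p lagged products and, under [None], the mean of all n
   curves, whose bound K / n is at most K / m. *)
pose K (i : option ('I_p.+1 + 'I_p)) := if i is Some (inr k) then KU k else KV.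
have K0 i : 0 <= K i by case: i => [[//|k]|//]; case: (boundU k).
have [L [L1 tight]] := tight_family P K0 e0.
exists L; split => // m n m0 mn.
have mR : 0 < m%:R :> R by rewrite ltr0n.
have n0 : (0 < n)%N by exact: leq_trans mn.
pose g (i : option ('I_p.+1 + 'I_p)) w : \bar R := let z j := yc (j : nat)%:Z w in
  match i with
  | Some (inl k) => \int[lebm]_u (lagmean z m k u ^+ 2)%:E
  | Some (inr k) => HS lebm (fun u v => lagprod z m k.+1 u v - G k.+1 u v)%R
  | None => \int[lebm]_u (lagmean z n 0 u ^+ 2)%:E
  end%E.
have mg i : measurable_fun setT (g i).
  case: i => [[k|k]|]; [exact: measurable_lagmean_norm|exact: measurable_lagprod_HS|].
  exact: measurable_lagmean_norm.
have g0 i w : (0 <= g i w)%E.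
  have sq0 (f : R -> R) : (0 <= \int[lebm]_u (f u ^+ 2)%:E)%E.
    by apply: integral_ge0 => u _; rewrite lee_fin sqr_ge0.
  by case: i => [[k|k]|]; [exact: sq0|apply: integral_ge0 => v _; exact: sq0|exact: sq0].
have gK i : (\int[P]_w g i w <= (K i / m%:R)%:E)%E.
  case: i => [[k|k]|]; [exact: boundV|by have [_] := boundU k; exact|].
  apply: le_trans (boundV 0%N n n0) _.
  by rewrite lee_fin ler_wpM2l // lef_pV2 ?posrE ?ltr0n // ler_nat.
have [A [mA PA bA]] := tight g m%:R mg g0 mR gK.
exists A; split => // w Aw z; split.
- move=> k kp; have kp' : (k < p.+1)%N by [].
  exact: (bA w Aw (Some (inl (Ordinal kp')))).
- exact: (bA w Aw None).
- by move=> k; exact: (bA w Aw (Some (inr k))).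
Qed.

End error_bounds.

(** For l >= 1, sqrt (c l) <= l sqrt (c l) <= Mb, hence c l <= Mb l sqrt (c l), and the sum of the
    latter is at most Mb^2. The bound starts at l = 1, where the weight l is at least 1. *)
Lemma summable_of_weighted_sqrt (R : realType) (c : nat -> R) (Mb : R) :
  (forall l, 0 <= c l) -> (forall N, \sum_(l < N) l%:R * Num.sqrt (c l) <= Mb) ->
  forall N, \sum_(1 <= l < N) c l <= Mb * Mb.
Proof.
move=> c0 cb N.
have w0 (l : nat) : 0 <= l%:R * Num.sqrt (c l) by rewrite mulr_ge0 // sqrtr_ge0.
have Mb0 : 0 <= Mb by have := cb 0%N; rewrite big_ord0.
have wb (l : nat) : l%:R * Num.sqrt (c l) <= Mb.
  apply: le_trans (cb l.+1); rewrite big_ord_recr /= lerDr.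
  by apply: sumr_ge0 => i _.
apply: (@le_trans _ _ (\sum_(1 <= l < N) Mb * (l%:R * Num.sqrt (c l)))).
  rewrite big_seq [leRHS]big_seq; apply: ler_sum => l; rewrite mem_index_iota => /andP[l1 _].
  have l1R : 1 <= l%:R :> R by rewrite ler1n.
  have sl : Num.sqrt (c l) <= l%:R * Num.sqrt (c l).
    by rewrite -[leLHS]mul1r ler_wpM2r // sqrtr_ge0.
  rewrite -[leLHS](sqr_sqrtr (c0 l)) expr2 ler_pM ?sqrtr_ge0 //.
  exact: le_trans sl (wb l).
rewrite -mulr_sumr ler_wpM2l // (le_trans _ (cb N)) //.
rewrite -(big_mkord xpredT (fun l => l%:R * Num.sqrt (c l))).
case: N => [|N]; first by rewrite !big_geq.
by rewrite [leRHS]big_ltn // mul0r add0r.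
Qed.

(** * Rate of convergence *)

Section deterministic_bound.
Variables (R : realType) (a b : R).
Local Notation lebm := (@lebesgue_measure R).
Local Notation cut := (cut a b).
Local Notation Iab := (Iab a b).

Lemma kerop_compop (p : nat) (Mk : nat -> R -> R -> R) (Gk : 'I_p -> R -> R -> R) :
  (forall (k : 'I_p) u v, Iab u -> Iab v -> Mk k.+1 u v = Gk k u v) ->
  (forall k u v, ~ Iab u -> Gk k u v = 0) -> (forall k u v, ~ Iab v -> Gk k u v = 0) ->
  forall f u, Iab u ->
  kerop a b (fun u u' => \sum_(1 <= k < p.+1) Rintegral lebm Iab (fun z => Mk k u z * Mk k u' z)) f u
  = compop lebm (index_enum 'I_p) Gk (cut f) u.
Proof.
move=> MG Gu Gv f u Iu; rewrite /compop.
apply: (kerop_cut (K' := fun u u' => \sum_(k <- index_enum 'I_p) ip lebm (Gk k u) (Gk k u'))) => //.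
- move=> u' Iu'; rewrite big_add1 big_mkord; apply: eq_bigr => k _.
  by apply: ip_kernel_cut => z Iz; [exact: MG|exact: MG|exact: Gv].
- move=> u' Iu'; rewrite big1 // => k _.
  transitivity (\int[lebm]_z (0 : R)); last by rewrite Rintegral_cst // mul0r.
  by apply: eq_Rintegral => z _; rewrite [X in _ * X]Gu // mulr0.
Qed.

Lemma compop_out (p : nat) (Gk : 'I_p -> R -> R -> R) f u :
  (forall k u v, ~ Iab u -> Gk k u v = 0) -> ~ Iab u ->
  compop lebm (index_enum 'I_p) Gk f u = 0.
Proof.
move=> Gu Iu; transitivity (\int[lebm]_z (0 : R)); last by rewrite Rintegral_cst // mul0r.
apply: eq_Rintegral => z _; rewrite big1 ?mul0r // => k _.
transitivity (\int[lebm]_z (0 : R)); last by rewrite Rintegral_cst // mul0r.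
by apply: eq_Rintegral => z' _; rewrite Gu // mul0r.
Qed.

Lemma eigen_cut (p : nat) (Mk : nat -> R -> R -> R) (Gk : 'I_p -> R -> R -> R) l f :
  (forall (k : 'I_p) u v, Iab u -> Iab v -> Mk k.+1 u v = Gk k u v) ->
  (forall k u v, ~ Iab u -> Gk k u v = 0) -> (forall k u v, ~ Iab v -> Gk k u v = 0) ->
  is_eigenI a b (fun u u' => \sum_(1 <= k < p.+1) Rintegral lebm Iab (fun z => Mk k u z * Mk k u' z)) l f ->
  {ae lebm, forall u, compop lebm (index_enum 'I_p) Gk (cut f) u = l * cut f u}.
Proof.
move=> MG Gu Gv [_].
apply: (@filterS _ (almost_everywhere (lebm : {measure set (measurableTypeR R) -> \bar R}))) => u H; case: (IabP a b u) => Iu.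
  by rewrite -(kerop_compop MG Gu Gv) // H // cutE.
by rewrite compop_out // cutN // mulr0.
Qed.

Variables (d0 : measure_display) (Omega : measurableType d0).
Variables (Y : int -> Omega -> R -> R) (w : Omega) (d n p : nat).
Variables (z : nat -> R -> R) (mu : R -> R).
Hypotheses (zi : forall j, sqint lebm (z j)) (z0 : forall j u, ~ Iab u -> z j u = 0)
  (zE : forall j u, Iab u -> Y j%:Z w u = z j u + mu u) (pn : (p < n)%N).
Let m := (n - p)%N.
Let zb := lagmean z n 0.

Let Mhat_empcov k u v : Iab u -> Iab v -> Mhat Y n p k w u v = empcov z m zb k u v.
Proof.
move=> Iu Iv; have nN : n%:R != 0 :> R by rewrite pnatr_eq0 -lt0n (leq_ltn_trans _ pn).
have Yb x : Iab x -> Ybar Y n w x = zb x + mu x.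
  move=> Ix; rewrite /Ybar /zb /lagmean big_add1 big_mkord.
  rewrite -[mu x](mulKf nN) -mulrDr; congr (_ * _).
  rewrite -[n in n%:R]card_ord -sumr_const mulr_suml -big_split; apply: eq_bigr => i _ /=.
  by rewrite zE // addn0 mul1r.
rewrite /Mhat /empcov big_add1 big_mkord; congr (_ * _); apply: eq_bigr => i _.
by rewrite !zE // !Yb //; congr (_ * _); ring.
Qed.

Variables (M : nat -> R -> R -> R) (G : 'I_p -> R -> R -> R).
Variables (phi psi zhat : 'I_d -> R -> R) (theta lam : 'I_d -> R) (th l dl : R).
Hypotheses (GG : forall k, HSkernel lebm (G k)).
Hypothesis MG : forall (k : 'I_p) u v, Iab u -> Iab v -> M k.+1 u v = G k u v.
Hypotheses (Gu : forall k u v, ~ Iab u -> G k u v = 0) (Gv : forall k u v, ~ Iab v -> G k u v = 0).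
Hypotheses (phiO : orthonormalI a b phi) (psiO : orthonormalI a b psi).
Hypotheses (th0 : 0 < th) (thetath : forall j, th <= theta j).
Hypothesis psieig : forall j, is_eigenI a b (Kker a b p M) (theta j) (psi j).
Hypothesis Gker : forall f, sqint lebm f -> (forall j, ip lebm f (cut (phi j)) = 0) ->
  forall k v, KT lebm (G k) f v = 0.
Hypothesis ztop : top_eigenI a b (Khat a b Y n p w) lam zhat.
Hypotheses (l0 : 0 <= l)
  (Sl : forall k : 'I_p, (HS lebm (fun u v => (lagprod z m k.+1 u v - G k u v)%R) <= l%:E)%E)
  (Rl : forall k : nat, (k <= p)%N -> ip lebm (lagmean z m k) (lagmean z m k) <= l)
  (zbl : ip lebm zb zb <= l).
Hypotheses (d_gt0 : (0 < d)%N) (dl0 : 0 < dl) (dl_th : dl <= th / 4)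
  (dl_l : p%:R * (4 * (l + 3 * l ^+ 2)) <= dl).

Let H (k : 'I_p) := empcov z m zb k.+1.
Let zbi : sqint lebm zb. Proof. exact: sqint_lagmean. Qed.
Let HH k : HSkernel lebm (H k). Proof. exact: HSkernel_empcov. Qed.
Let zb0 u : ~ Iab u -> zb u = 0.
Proof. by move=> Iu; rewrite /zb /lagmean big1 ?mulr0 // => i _; exact: z0. Qed.
Let Hu k u v : ~ Iab u -> H k u v = 0.
Proof.
move=> Iu; rewrite /H /empcov big1 ?mulr0 // => i _.
by rewrite z0 // zb0 // subrr mul0r.
Qed.
Let Hv k u v : ~ Iab v -> H k u v = 0.
Proof.
move=> Iv; rewrite /H /empcov big1 ?mulr0 // => i _.
by rewrite [z _ v]z0 // [zb v]zb0 // subrr mulr0.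
Qed.
Let MH (k : 'I_p) u v : Iab u -> Iab v -> Mhat Y n p k.+1 w u v = H k u v.
Proof. exact: Mhat_empcov. Qed.

(** The psi_i diagonalise the quadratic form of K, with diagonal entries theta_i >= th. *)
Let Glow (x : 'I_d -> R) (f := fun u => \sum_i x i * cut (psi i) u) :
  th * \sum_i x i ^+ 2 <= \sum_(k <- index_enum 'I_p) ip lebm (KT lebm (G k) f) (KT lebm (G k) f).
Proof.
have psiOc := orthonormal_cut psiO; have [psii psio] := psiOc.
have Q i j : \sum_(k <- index_enum 'I_p)
    ip lebm (KT lebm (G k) (cut (psi i))) (KT lebm (G k) (cut (psi j))) = theta i * (i == j)%:R.
  rewrite -ip_compop // -psio -ipZl //; apply: ip_ae.
  - by have [] := compop_sqint (index_enum 'I_p) GG (psii i).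
  - by have [] := sqintZ (theta i) (psii i).
  - by have [] := psii j.
  exact: eigen_cut MG Gu Gv (psieig i).
have -> : \sum_(k <- index_enum 'I_p) ip lebm (KT lebm (G k) f) (KT lebm (G k) f) =
    \sum_i theta i * x i ^+ 2.
  transitivity (\sum_(k <- index_enum 'I_p) \sum_i \sum_j x i * (x j *
      ip lebm (KT lebm (G k) (cut (psi i))) (KT lebm (G k) (cut (psi j))))).
    apply: eq_bigr => k _.
    have -> : KT lebm (G k) f = fun v => \sum_i x i * KT lebm (G k) (cut (psi i)) v.
      by apply/funext => v; exact: KT_sum.
    have Ki i : sqint lebm (KT lebm (G k) (cut (psi i))) by exact: KT_sqint.
    rewrite ip_suml //; last exact: sqint_lincomb.
    by apply: eq_bigr => i _; rewrite ip_sumr // mulr_sumr.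
  rewrite exchange_big; apply: eq_bigr => i _ /=; rewrite exchange_big /= (bigD1 i) //=.
  rewrite [X in _ + X]big1 => [|j ji].
    by rewrite -!mulr_sumr Q eqxx mulr1; ring.
  by rewrite -!mulr_sumr Q eq_sym (negbTE ji) !mulr0.
rewrite mulr_sumr; apply: ler_sum => i _; exact: ler_wpM2r (sqr_ge0 _) _ _ (thetath i).
Qed.

Let zO : orthonormal lebm (fun j => cut (zhat j)).
Proof. by have [zO _ _ _] := ztop; exact: orthonormal_cut. Qed.

Lemma distance_bound : distD a b zhat phi <= Num.sqrt (4 * dl / th).
Proof.
have [_ zeig _ zmax] := ztop.
have m0 : (0 < m)%N by rewrite subn_gt0.
have [A [As Apsd HA]] := compop_empcov m zi zbi (index_enum 'I_p) (fun k => k.+1).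
have B0 : 0 <= 4 * dl / th by rewrite divr_ge0 ?mulr_ge0 ?ltW.
have bound k : 1 - \sum_j ip lebm (cut (phi j)) (cut (zhat k)) ^+ 2 <= 4 * dl / th.
  refine (eigenspace_residual_bound (T := measurableTypeR R) (mu := lebm) (G := G) (H := H) (phi := fun j => cut (phi j)) (psi := fun j => cut (psi j))
    (z := fun j => cut (zhat j)) (lam := lam) (A := A) (c := fun i u => z i.+1 u - zb u)
    (e := fun=> 4 * (l + 3 * l ^+ 2)) GG HH _ _ zO Glow Gker As Apsd _ HA _ _ _ _ dl0 th0 dl_th k).
  - exact: orthonormal_cut.
  - exact: orthonormal_cut.
  - by move=> i; exact: sqintB.
  - by move=> j; exact: eigen_cut MH Hu Hv (zeig j).
  - move=> x g x0 gi gE gg gz j.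
    (* The kernel vanishes outside the interval, so an eigenfunction for a positive eigenvalue does
       too. It is thus an eigenfunction on the interval, and the maximality of [lam] applies. *)
    have gc : cut g = g.
      apply/funext => u; case: (IabP a b u) => Iu; first exact: cutE.
      rewrite cutN //; apply/esym/eqP; rewrite -(mulrI_eq0 _ (lregP (lt0r_neq0 x0))) -gE.
      by rewrite compop_out.
    apply: (zmax x g).
    + split; first exact: L2I_sqint.
      apply: aeW => u Iu; rewrite (kerop_compop MH Hu Hv) // gc; exact: gE.
    + by rewrite innerI_ip gc.
    + by move=> i; rewrite innerI_ip gc.
  - move=> k'; have [mG _ _ _] := GG k'.
    exact: (HS_empcov_error zi m0 zbi l0 mG (Sl k') (Rl (ltn_ord k')) (Rl (leq0n p)) zbl).
  - by rewrite /= sumr_const card_ord -[leLHS]mulr_natl; exact: dl_l.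
rewrite /distD ler_sqrt //.
have -> : 1 - d%:R^-1 * (\sum_(j < d) \sum_(k < d) innerI a b (phi j) (zhat k) ^+ 2) =
    d%:R^-1 * \sum_(k < d) (1 - \sum_(j < d) ip lebm (cut (phi j)) (cut (zhat k)) ^+ 2).
  have dN : d%:R != 0 :> R by rewrite pnatr_eq0 -lt0n.
  rewrite sumrB sumr_const card_ord mulrBr mulVf // exchange_big /=.
  by congr (_ - _ * _); apply: eq_bigr => j _; apply: eq_bigr => k _; rewrite innerI_ip.
rewrite ler_pdivrMl ?ltr0n //; apply: le_trans (ler_sum _ (fun k _ => bound k)) _.
by rewrite sumr_const card_ord [leRHS]mulr_natl.
Qed.

End deterministic_bound.

(** The expansion of M_0 shows that the covariance operator of X_0 sends [f] to 0 almost everywhere.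
    This suffices for <Cov f, f> = 0, and [KT_crosscov_eq0] turns it into vanishing at every v for
    every second time t. *)
Lemma KT_lagcov_eq0 (R : realType) (d0 : measure_display) (Omega : measurableType d0)
    (P : probability Omega R) (a b : R) (d : nat)
    (X : int -> Omega -> R -> R) (mu : R -> R) (M : nat -> R -> R -> R)
    (lam : 'I_d -> R) (phi : 'I_d -> R -> R)
    (lebm := @lebesgue_measure R) (C := crosscov P (xc a b X mu 0)) :
  (forall t, field2 lebm P (xc a b X mu t)) ->
  (forall u v, Iab a b u -> Iab a b v -> C (xc a b X mu 0) u v = M 0%N u v) ->
  orthonormalI a b phi ->
  {ae lebm, forall u, Iab a b u -> {ae lebm, forall v, Iab a b v ->
     M 0%N u v = \sum_(j < d) lam j * phi j u * phi j v}} ->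
  forall f, sqint lebm f -> (forall j, ip lebm f (cut a b (phi j)) = 0) ->
  forall t v, KT lebm (C (xc a b X mu t)) f v = 0.
Proof.
move=> xf CM phiO M0 f fi fphi t v; have [phii _] := orthonormal_cut phiO.
apply: (KT_crosscov_eq0 (xf 0)) => //.
have CHS := HSkernel_crosscov (xf 0) (xf 0); have [mC _ C1 C2] := CHS.
have [mf _] := fi; have [mKT _] := KT_sqint CHS fi.
transitivity (ip lebm (fun _ => 0) f); last first.
  by rewrite /ip; under eq_Rintegral do rewrite mul0r; rewrite Rintegral_cst // mul0r.
apply: ip_ae => //.
move: M0; apply: (@filterS _ (almost_everywhere (lebm : {measure set (measurableTypeR R) -> \bar R}))).
move=> u0 M0; case: (IabP a b u0) => Iu; last first.
  transitivity (\int[lebm]_z (0 : R)); last by rewrite Rintegral_cst // mul0r.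
  by apply: eq_Rintegral => z _; rewrite /C [X in X * _]cov_xc_out ?mul0r //; right.
transitivity (ip lebm (fun v => \sum_j (lam j * cut a b (phi j) u0) * cut a b (phi j) v) f).
  have [mC2 _] := C2 u0.
  have [ms _] : sqint lebm (fun v => \sum_j (lam j * cut a b (phi j) u0) * cut a b (phi j) v).
    exact: sqint_lincomb.
  apply: ip_ae => //.
  move: (M0 Iu); apply: (@filterS _ (almost_everywhere (lebm : {measure set (measurableTypeR R) -> \bar R}))).
  move=> z Mz; case: (IabP a b z) => Iz; last first.
    transitivity (0 : R); first by apply: cov_xc_out; left.
    by rewrite big1 // => j _; rewrite (cutN _ Iz) mulr0.
  (* [KT] integrates the first argument, whereas the inner almost-everywhere statement about M_0
     concerns the second; symmetry exchanges them. *)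
  transitivity (C (xc a b X mu 0) u0 z); first exact: ipC.
  rewrite CM // Mz //.
  by apply: eq_bigr => j _; rewrite !cutE.
by rewrite ip_suml // big1 // => j _; rewrite ipC fphi mulr0.
Qed.

Theorem theorem2 (R : realType) (d0 : measure_display) (Omega : measurableType d0)
  (P : probability Omega R) (a b : R) (d p : nat)
  (X eps Y : int -> Omega -> R -> R) (mu : R -> R) (M : nat -> R -> R -> R)
  (lam : 'I_d -> R) (phi : 'I_d -> R -> R)
  (lamhat : nat -> Omega -> 'I_d -> R) (psihat : nat -> Omega -> 'I_d -> R -> R) :
  a < b -> (0 < d)%N -> (0 < p)%N ->
  (* model *)
  (forall t w u, Y t w u = X t w u + eps t w u) ->
  (forall t, measurable_fun (setT `*` Iab a b) (fun q : Omega * R => X t q.1 q.2)) ->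
  (forall t, measurable_fun (setT `*` Iab a b) (fun q : Omega * R => eps t q.1 q.2)) ->
  (forall t u, Iab a b u ->
     P.-integrable setT (fun w => (eps t w u)%:E) /\ Ex P (fun w => eps t w u) = 0%E) ->
  (forall t s u v, t != s -> Iab a b u -> Iab a b v ->
     P.-integrable setT (fun w => (eps t w u * eps s w v)%:E) /\
     Ex P (fun w => eps t w u * eps s w v) = 0%E) ->
  (forall t, (\int[(@lebesgue_measure R)]_(u in Iab a b)
       Ex P (fun w => (X t w u ^+ 2 + eps t w u ^+ 2)%R) < +oo)%E) ->
  (* mean and autocovariances of X, independent of t *)
  (forall t u, Iab a b u ->
     P.-integrable setT (fun w => (X t w u)%:E) /\ Ex P (fun w => X t w u) = (mu u)%:E) ->
  (forall t (k : nat) u v, Iab a b u -> Iab a b v ->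
     P.-integrable setT (fun w => (X t w u * X (t + k%:Z) w v)%:E) /\
     Ex P (fun w => X t w u * X (t + k%:Z) w v) = (M k u v + mu u * mu v)%:E) ->
  (* X_t is d-dimensional: M_0 = sum_{j<=d} lam_j phi_j(u) phi_j(v), lam_d <> 0,
     and the space M = span{phi_1, ..., phi_d} *)
  orthonormalI a b phi ->
  (forall j k : 'I_d, (j <= k)%N -> lam k <= lam j) ->
  (forall j, lam j != 0) ->
  {ae (@lebesgue_measure R), forall u, Iab a b u ->
     {ae (@lebesgue_measure R), forall v, Iab a b v ->
        M 0%N u v = \sum_(j < d) lam j * phi j u * phi j v}} ->
  (* C1 *)
  strictly_stationary P a b Y ->
  psi_mixing_summable P a b Y ->
  (* C2 *)
  (forall t, (\int[P]_w ((\int[(@lebesgue_measure R)]_(u in Iab a b) ((Y t w u) ^+ 2)%R%:E) *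
                        (\int[(@lebesgue_measure R)]_(u in Iab a b) ((Y t w u) ^+ 2)%R%:E)) < +oo)%E) ->
  (* C3: eigenvalues of K are theta_1 > ... > theta_d > 0 = theta_{d+1} = ... *)
  (exists (theta : 'I_d -> R) (psi : 'I_d -> R -> R),
     [/\ orthonormalI a b psi,
         (forall j k : 'I_d, (j < k)%N -> theta k < theta j),
         (forall j, 0 < theta j),
         (forall j, is_eigenI a b (Kker a b p M) (theta j) (psi j)) &
         (forall g, L2I a b g -> (forall j, innerI a b g (psi j) = 0) ->
            is_eigenI a b (Kker a b p M) 0 g)]) ->
  (* C4 *)
  (forall s t u v, Iab a b u -> Iab a b v ->
     P.-integrable setT (fun w => (X s w u * eps t w v)%:E) /\
     Ex P (fun w => X s w u * eps t w v) = 0%E) ->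
  (* psihat n w : orthonormal eigenfunctions of Khat for its d largest eigenvalues *)
  (forall n : nat, (p < n)%N ->
     {ae P, forall w, top_eigenI a b (Khat a b Y n p w) (lamhat n w) (psihat n w)}) ->
  Op_root_n P (fun n w => distD a b (psihat n w) phi).
Proof.
move=> ab d_gt0 p_gt0 YE mX meps eps_mean eps_white sq_fin X_mean X_cov phiO lam_dec lam_n0 M0.
move=> stat [c [c0 mix [Mb cb]]] Y_four [theta [psi [psiO theta_dec theta0 psieig _]]] X_eps ztop.
move=> e e0; pose lebm := @lebesgue_measure R.
have cS := summable_of_weighted_sqrt c0 cb.
have [L [L1 tight]] := lag_errors_tight YE mX meps eps_mean eps_white sq_fin X_mean X_cov
  X_eps Y_four stat c0 cS mix p e0.
have ylast : (d.-1 < d)%N by rewrite prednK.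
pose th := theta (Ordinal ylast).
have thetath j : th <= theta j.
  have [jl|jl] := ltnP j d.-1; first by apply/ltW/theta_dec.
  suff -> : j = Ordinal ylast by [].
  apply: val_inj; apply/eqP; rewrite eqn_leq jl andbT -ltnS prednK //; exact: ltn_ord.
have th0 : 0 < th by exact: theta0.
(* With m = n - p and l = L / m: l + 3 l^2 <= 4 L^2 / m because L and m are at least 1, and 1 / m <=
   2 / n. So p 4 (l + 3 l^2) <= 32 p L^2 / n, and [distance_bound] multiplies this by 4 / th. *)
pose D := 128 * p%:R * L ^+ 2 / th.
have pR : 0 < p%:R :> R by rewrite ltr0n.
have L0 : 0 < L by exact: lt_le_trans L1.
have D0 : 0 < D by rewrite divr_gt0 // mulr_gt0 ?exprn_gt0 // mulr_gt0.
exists (Num.sqrt D); split; first by rewrite sqrtr_gt0.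
exists (maxn p.*2 (Num.bound D)) => n; rewrite geq_max => /andP[pn Dn].
have pn' : (p < n)%N by rewrite (leq_trans _ pn) // -addnn -addn1 leq_add2l.
have nm : (n <= (n - p).*2)%N by lia.
have m0 : (0 < n - p)%N by rewrite subn_gt0.
have [A [mA PA bA]] := tight (n - p)%N n m0 (leq_subr _ _).
(* Paths lie in L2, and the psihat are eigenfunctions, only almost surely; the null set [N] is added
   to the exceptional event. *)
have [N [mN PN0 subN]] : {ae P, forall w, (forall j : nat, sqint lebm (yc a b Y mu j%:Z w)) /\
    top_eigenI a b (Khat a b Y n p w) (lamhat n w) (psihat n w)}.
  exact: (filterI (ae_sqint_yc YE mX meps sq_fin X_mean X_cov) (ztop n pn')).
exists (A `|` N); split; first exact: measurableU.
  move=> w /= Dw; have [Aw|Aw] := pselect (A w); first by left.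
  right; apply: subN => /= -[zi top]; have [bV bm bU] := bA w Aw.
  have nR : 0 < n%:R :> R by rewrite ltr0n (leq_ltn_trans _ pn').
  have mR : 0 < (n - p)%:R :> R by rewrite ltr0n.
  (* With l = L / (n - p), the bound n <= 2 (n - p) gives 4 p (l + 3 l^2) <= dl,
     and D is chosen so that dl <= th / 4 as soon as D <= n. *)
  pose dl := 32 * p%:R * L ^+ 2 / n%:R.
  suff : distD a b (psihat n w) phi <= Num.sqrt (4 * dl / th).
    have -> : 4 * dl / th = D / n%:R by rewrite /D /dl; field; rewrite !lt0r_neq0.
    by rewrite (sqrtrM _ (ltW D0)) (sqrtrV (ltW nR)) leNgt Dw.
  have xf := field2_xc mX meps sq_fin X_mean X_cov.
  have le_ip f : sqint lebm f -> (\int[lebm]_u (f u ^+ 2)%:E <= (L / (n - p)%:R)%:E)%E ->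
      ip lebm f f <= L / (n - p)%:R.
    by move=> fi; rewrite -EFin_ip // lee_fin.
  pose z j := yc a b Y mu (j : nat)%:Z w.
  pose G (k : 'I_p) := crosscov P (xc a b X mu 0) (xc a b X mu k.+1%:Z).
  have z0 j u : ~ Iab a b u -> z j u = 0 by move=> Iu; exact: cutN.
  have zE j u : Iab a b u -> Y j%:Z w u = z j u + mu u.
    by move=> Iu; rewrite /z /yc cutE // subrK.
  have GG k : HSkernel lebm (G k) by exact: HSkernel_crosscov.
  have MG (k : 'I_p) u v : Iab a b u -> Iab a b v -> M k.+1 u v = G k u v.
    by move=> Iu Iv; rewrite -(cov_xc X_mean X_cov 0 k.+1 Iu Iv) add0r.
  have Gu k u v : ~ Iab a b u -> G k u v = 0 by move=> Iu; apply: cov_xc_out; left.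
  have Gv k u v : ~ Iab a b v -> G k u v = 0 by move=> Iv; apply: cov_xc_out; right.
  have Gker f : sqint lebm f -> (forall j, ip lebm f (cut a b (phi j)) = 0) ->
      forall k v, KT lebm (G k) f v = 0.
    move=> fi fphi k v; apply: (KT_lagcov_eq0 xf _ phiO M0) => // u' v' Iu Iv.
    by rewrite -(cov_xc X_mean X_cov 0 0 Iu Iv) add0r.
  have l0 : 0 <= L / (n - p)%:R by rewrite divr_ge0 // ltW.
  have Rl k : (k <= p)%N -> ip lebm (lagmean z (n - p) k) (lagmean z (n - p) k) <= L / (n - p)%:R.
    by move=> kp; apply: le_ip; [exact: sqint_lagmean|exact: bV].
  have zbl : ip lebm (lagmean z n 0) (lagmean z n 0) <= L / (n - p)%:R.
    by apply: le_ip; [exact: sqint_lagmean|].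
  have dl0 : 0 < dl by rewrite divr_gt0 // mulr_gt0 ?exprn_gt0 // mulr_gt0.
  have dl_th : dl <= th / 4.
    have Dn' : D <= n%:R.
      by apply: ltW; apply: lt_le_trans (archi_boundP (ltW D0)) _; rewrite ler_nat.
    have -> : dl = D * th / 4 / n%:R by rewrite /D /dl; field; rewrite !lt0r_neq0.
    have : D * th <= n%:R * th by rewrite ler_wpM2r // ltW.
    by rewrite ler_pdivrMr //; lra.
  have dl_l : p%:R * (4 * (L / (n - p)%:R + 3 * (L / (n - p)%:R) ^+ 2)) <= dl.
    have q1 : 1 <= (n - p)%:R :> R by rewrite ler1n.
    have LL : L <= L ^+ 2 by rewrite ler_eXnr.
    have sq : (L / (n - p)%:R) ^+ 2 <= L ^+ 2 / (n - p)%:R.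
      by rewrite expr_div_n ler_wpM2l ?sqr_ge0 // lef_pV2 ?posrE ?exprn_gt0 // ler_eXnr.
    have lin : L / (n - p)%:R <= L ^+ 2 / (n - p)%:R by rewrite ler_wpM2r // invr_ge0 ltW.
    have qn : L ^+ 2 / (n - p)%:R <= 2 * (L ^+ 2 / n%:R).
      rewrite mulrCA ler_wpM2l ?sqr_ge0 // -[leLHS]mul1r ler_pdivrMr // mulrAC.
      by rewrite ler_pdivlMr // mul1r -natrM ler_nat mul2n.
    have -> : dl = p%:R * (4 * (4 * (2 * (L ^+ 2 / n%:R)))) by rewrite /dl; ring.
    rewrite ler_wpM2l ?(ltW pR) // ler_wpM2l //; lra.
  exact: (distance_bound zi z0 zE pn' GG MG Gu Gv phiO psiO th0 thetath psieig Gker top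
    l0 bU Rl zbl d_gt0 dl0 dl_th dl_l).
by rewrite measureU0.
Qed.
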